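(* Let $f$ be a continuous compactly supported $\mathbb{C}^2$-valued function on $\mathbb{R}$. Then for each $n\in\mathbb{Z}$, $j\in\{1,2\}$ and $x\in[0,\pi]$, the function $t\mapsto (P_{n,j}(t)f_t)(x)$ is integrable over $E(h)$, over $\gamma(0,h)$ and over $\gamma(1,h)$. Moreover, if $\lambda_{n,j}(0)$ is not an ESS of $L(Q)$, then this function is integrable over $(-h,h)$, and if $\lambda_{n,j}(1)$ is not an ESS, it is integrable over $(1-h,1+h)$.
   Context: Let $p,q$ be $\pi$-periodic complex-valued functions on $\mathbb{R}$ of bounded variation on $[0,\pi]$, $Q(x)=\begin{pmatrix}p(x)&q(x)\\ q(x)&-p(x)\end{pmatrix}$, $J=\begin{pmatrix}0&1\\-1&0\end{pmatrix}$, $l(\mathbf y,Q)=J\mathbf y'+Q\mathbf y$. $L(Q)$ is the operator in $L_2^2(-\infty,\infty)$ generated by $l$; for $t\in\mathbb{C}$, $L_t(Q)$ is the operator in $L_2^2[0,\pi]$ generated by $l$ and $\mathbf y(\pi)=e^{i\pi t}\mathbf y(0)$. $\mathbf c,\mathbf s$ solve $l(\mathbf y,Q)=\lambda\mathbf y$ with $\mathbf c(0)=(1,0)^T$, $\mathbf s(0)=(0,1)^T$; $F(\lambda)=c_1(\pi,\lambda)+s_2(\pi,\lambda)$; eigenvalues of $L_t(Q)$ are the roots of $F(\lambda)=2\cos\pi t$, labeled $\lambda_{n,j}(t)$ ($n\in\mathbb{Z}$, $j=1,2$) so that $\lambda_{n,j}(t)$ is analytic in $t$ near any point where it is simple, and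 simple except at finitely many $t$ in any bounded set. When $\lambda_{n,j}(t)$ is simple: $\Psi_{n,j,t}$, $\Psi^*_{n,j,t}$ are unit-norm eigenfunctions of $L_t(Q)$ and of its adjoint $L_{\bar t}(\bar Q)$ (eigenvalue $\overline{\lambda_{n,j}(t)}$), $\alpha_{n,j}(t)=(\Psi_{n,j,t},\Psi^*_{n,j,t})$, and $P_{n,j}(t)g=\frac{(g,\Psi^*_{n,j,t})}{(\Psi_{n,j,t},\Psi^*_{n,j,t})}\Psi_{n,j,t}$ is the Riesz projection (the paper's $a_{n,j}(t)\Psi_{n,j,t}$); $\|P_{n,j}(t)\|=1/|\alpha_{n,j}(t)|$. ESS: $\lambda_0=\lambda_{n,j}(t_0)$, $t_0\in(-1,1]$, such that for every $\varepsilon>0$, $1/\alpha_{n,j}$ is not integrable on $(t_0-\varepsilon,t_0+\varepsilon)$. For $f$ as in the claim, $f_t(x)=\sum_{k\in\mathbb{Z}}f(x+k\pi)e^{-i\pi kt}$ (a finite sum for $x$ in a bounded set), and $P_{n,j}(t)f_t$ means $P_{n,j}(t)$ applied to $f_t|_{[0,\pi]}$. Fix $h\in(0,1/10)$, $D_h=\{t:|\operatorname{Im}t|\le2h,\ -h\le\operatorname{Re}t\le2-h\}$; $A$ is the set of $t\in D_h$ for which some eigenvalue $\lambda$ of $L_t(Q)$ satisfies $F'(\lambda)=0$ or $s_1(\pi,\lambda)=0$ (its only accumulation points are $0,1$). Assume $h\notin\overline A$ and the semicircles $\gamma(0,h)=\{|t|=h,\operatorname{Im}t\ge0\}$, $\gamma(1,h)=\{|t-1|=h,\operatorname{Im}t\ge0\}$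 do not meet $A$. $B(h)=[h,1-h]\cup[1+h,2-h]$ and $E(h)$ is $B(h)$ minus the finitely many points of $A$ lying in $B(h)$. *)

(* Defs.v *)
From HB Require Import structures.
From mathcomp Require Import all_boot all_order all_algebra.
From mathcomp Require Import all_classical all_reals all_analysis.
From mathcomp Require Import complex.
From Stdlib Require Import ClassicalEpsilon.

Set Implicit Arguments.
Unset Strict Implicit.
Unset Printing Implicit Defensive.

Import Order.TTheory GRing.Theory Num.Theory.
Import numFieldNormedType.Exports.
Local Open Scope classical_set_scope.
Local Open Scope ring_scope.

Section Defs.
Variable R : realType.
Local Notation C := (complex R).
Local Notation C2 := (C * C)%type.

Definition rc (x : R) : C := Complex x 0.
Definition ci : C := Complex 0 1.
Definition cmod (z : C) : R := Num.sqrt (complex.Re z ^+ 2 + complex.Im z ^+ 2).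
Definition cconj (z : C) : C := Complex (complex.Re z) (- complex.Im z).
Definition cexp (z : C) : C :=
  Complex (expR (complex.Re z) * cos (complex.Im z))
          (expR (complex.Re z) * sin (complex.Im z)).
Definition ccos (z : C) : C := (cexp (ci * z) + cexp (- (ci * z))) / 2.
Definition piC : C := rc pi.

Definition cintegrable (D : set R) (g : R -> C) : Prop :=
  (@lebesgue_measure R).-integrable D (EFin \o (fun x => complex.Re (g x))) /\
  (@lebesgue_measure R).-integrable D (EFin \o (fun x => complex.Im (g x))).
Definition c2integrable (D : set R) (g : R -> C2) : Prop :=
  cintegrable D (fun x => (g x).1) /\ cintegrable D (fun x => (g x).2).
Definition cint (D : set R) (g : R -> C) : C :=
  Complex (Rintegral (@lebesgue_measure R) D (fun x => complex.Re (g x)))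
          (Rintegral (@lebesgue_measure R) D (fun x => complex.Im (g x))).

(** ** The Dirac system  J y' + Q y = lam y,  Q = [[p, q],[q, -p]],  J = [[0,1],[-1,0]].
    Solved for y' this reads  y1' = q y1 - (lam + p) y2,  y2' = (lam - p) y1 - q y2. *)
Definition odeM (p q : R -> C) (lam : C) (s : R) (y : C2) : C2 :=
  (q s * y.1 - (lam + p s) * y.2, (lam - p s) * y.1 - q s * y.2).

(** y is an (absolutely continuous, Caratheodory) solution on [0, pi] of
    l(y, Q) = lam y, written as the equivalent integral equation. *)
Definition is_sol (p q : R -> C) (lam : C) (y : R -> C2) : Prop :=
  c2integrable `[0, pi] (fun s => odeM p q lam s (y s)) /\
  forall x, 0 <= x <= pi ->
    y x = ((y 0).1 + cint `[0, x] (fun s => (odeM p q lam s (y s)).1),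
           (y 0).2 + cint `[0, x] (fun s => (odeM p q lam s (y s)).2)).

Definition zero2 : R -> C2 := fun _ => (0, 0).

Definition ode_sol (p q : R -> C) (lam : C) (y0 : C2) : R -> C2 :=
  epsilon (inhabits zero2) (fun y => y 0 = y0 /\ is_sol p q lam y).
Definition c_fun p q lam := ode_sol p q lam (1, 0).
Definition s_fun p q lam := ode_sol p q lam (0, 1).
Definition Fdisc (p q : R -> C) (lam : C) : C :=
  (c_fun p q lam pi).1 + (s_fun p q lam pi).2.

(** lam is an eigenvalue of L_t(Q) :  F(lam) = 2 cos (pi t) *)
Definition char_eq (p q : R -> C) (t lam : C) : Prop :=
  Fdisc p q lam = 2 * ccos (piC * t).

Definition has_cderiv (G : C -> C) (z d : C) : Prop :=
  forall e : R, 0 < e -> exists2 d0 : R, 0 < d0 &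
    forall w, 0 < cmod (w - z) < d0 -> cmod ((G w - G z) / (w - z) - d) < e.

(** z is a zero of order exactly m of G (order 0 = not a zero) *)
Definition root_order (G : C -> C) (z : C) (m : nat) : Prop :=
  exists2 L : C, L != 0 & forall e : R, 0 < e -> exists2 d0 : R, 0 < d0 &
    forall w, 0 < cmod (w - z) < d0 -> cmod (G w / (w - z) ^+ m - L) < e.

Definition series_to (u : nat -> C) (L : C) : Prop :=
  forall e : R, 0 < e -> exists N0 : nat, forall N : nat, (N0 <= N)%N ->
    cmod (\sum_(k < N) u k - L) < e.

(** lam_{n,j}(t) is simple: no other label carries the same value
    (labels count multiplicity, see [is_labeling]) *)
Definition simple_lab (lam : int -> 'I_2 -> R -> C) (n : int) (j : 'I_2) (t : R) : Prop :=
  forall (m : int) (i : 'I_2), (m, i) != (n, j) -> lam m i t != lam n j t.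

(** The labeling lam_{n,j}(t), n in Z, j in {1,2} (here 'I_2), t real:
    (1) for each t, (lam_{n,j}(t))_{n,j} lists the roots of F(lam) = 2 cos(pi t)
        with multiplicity;
    (2) lam_{n,j} is (real-)analytic in t near every t where it is simple;
    (3) lam_{n,j}(t) is simple except at finitely many t of any bounded set. *)
Definition is_labeling (p q : R -> C) (lam : int -> 'I_2 -> R -> C) : Prop :=
  [/\ (forall (t : R) (mu : C), exists m : nat,
         root_order (fun z => Fdisc p q z - 2 * ccos (piC * rc t)) mu m /\
         exists s : seq (int * 'I_2),
           [/\ uniq s, size s = m & forall k, k \in s <-> lam k.1 k.2 t = mu]),
      (forall n j (t0 : R), simple_lab lam n j t0 ->
         exists2 r : R, 0 < r & exists a : nat -> C, forall t : R, `|t - t0| < r ->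
           series_to (fun k => a k * rc (t - t0) ^+ k) (lam n j t)) &
      (forall n j (M : R), exists s : seq R, forall t : R, `|t| <= M ->
         ~ simple_lab lam n j t -> t \in s)].

Definition eigfun (p q : R -> C) (t lam : C) (y : R -> C2) : Prop :=
  [/\ is_sol p q lam y,
      y pi = (cexp (ci * piC * t) * (y 0).1, cexp (ci * piC * t) * (y 0).2) &
      exists2 x, 0 <= x <= pi & y x != (0, 0)].

Definition pconj (p : R -> C) : R -> C := fun x => cconj (p x).

(** a chosen eigenfunction (the Riesz projection does not depend on the choice) *)
Definition eigsel (p q : R -> C) (t lam : C) : R -> C2 :=
  epsilon (inhabits zero2) (eigfun p q t lam).

Definition ip (u v : R -> C2) : C :=
  cint `[0, pi] (fun x => (u x).1 * cconj (v x).1 + (u x).2 * cconj (v x).2).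
Definition l2norm (u : R -> C2) : R := Num.sqrt (complex.Re (ip u u)).

(** Psi_{t}: eigenfunction of L_t(Q) for lam; Psi*_{t}: eigenfunction of the
    adjoint L_{conj t}(conj Q) for conj lam *)
Definition Psi p q t lam := eigsel p q t lam.
Definition PsiS p q t lam := eigsel (pconj p) (pconj q) (cconj t) (cconj lam).

Definition riesz (p q : R -> C) (t lam : C) (g : R -> C2) (x : R) : C2 :=
  let c := ip g (PsiS p q t lam) / ip (Psi p q t lam) (PsiS p q t lam) in
  (c * (Psi p q t lam x).1, c * (Psi p q t lam x).2).

(** alpha = (Psi, PsiS) for unit-norm eigenfunctions *)
Definition alpha (p q : R -> C) (t lam : C) : C :=
  ip (Psi p q t lam) (PsiS p q t lam) /
  rc (l2norm (Psi p q t lam) * l2norm (PsiS p q t lam)).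

(** f_t(x) = sum_{k in Z} f(x + k pi) e^{- i pi k t}  (finitely many nonzero terms) *)
Definition ft (f : R -> C2) (t : C) (x : R) : C2 :=
  (\sum_(k \in [set: int]) (f (x + k%:~R * pi)).1 * cexp (- (ci * piC * rc k%:~R * t)),
   \sum_(k \in [set: int]) (f (x + k%:~R * pi)).2 * cexp (- (ci * piC * rc k%:~R * t))).

Definition ESS (p q : R -> C) (lam : int -> 'I_2 -> R -> C) (lam0 : C) : Prop :=
  exists n j (t0 : R), [/\ -1 < t0 <= 1, lam0 = lam n j t0 &
    forall eps : R, 0 < eps ->
      (\int[@lebesgue_measure R]_(t in `](t0 - eps)%R, (t0 + eps)%R[)
         ((cmod (alpha p q (rc t) (lam n j t)))^-1)%:E = +oo)%E].

Definition Aset (p q : R -> C) (h : R) : set C :=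
  [set t | [/\ `|complex.Im t| <= 2 * h, - h <= complex.Re t <= 2 - h &
     exists lam, char_eq p q t lam /\
       (has_cderiv (Fdisc p q) lam 0 \/ (s_fun p q lam pi).1 = 0)]].

Definition Bset (h : R) : set R := `[h, 1 - h] `|` `[1 + h, 2 - h].
Definition Eset (p q : R -> C) (h : R) : set R :=
  [set t | Bset h t /\ ~ Aset p q h (rc t)].

(** parametrizations of gamma(0,h) and gamma(1,h): theta in [0, pi] *)
Definition gam0 (h : R) (th : R) : C := rc h * cexp (ci * rc th).
Definition gam1 (h : R) (th : R) : C := 1 + gam0 h th.
Definition dgam (h : R) (th : R) : C := ci * rc h * cexp (ci * rc th).

Definition is_branch (p q : R -> C) (g : R -> C) (mu : R -> C) : Prop :=
  (forall th, 0 <= th <= pi -> char_eq p q (g th) (mu th)) /\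
  (forall th0, 0 <= th0 <= pi -> forall e : R, 0 < e -> exists2 d : R, 0 < d &
     forall th, 0 <= th <= pi -> `|th - th0| < d -> cmod (mu th - mu th0) < e).

Definition BVc (p : R -> C) : Prop :=
  bounded_variation 0 pi (fun x => complex.Re (p x)) /\
  bounded_variation 0 pi (fun x => complex.Im (p x)).

Definition c2continuous (f : R -> C2) : Prop :=
  [/\ continuous (fun x : R => complex.Re (f x).1), continuous (fun x : R => complex.Im (f x).1),
      continuous (fun x : R => complex.Re (f x).2) & continuous (fun x : R => complex.Im (f x).2)].

Definition cscal2 (c : C) (v : C2) : C2 := (c * v.1, c * v.2).
End Defs.

(* Main.v *)
Require Import Defs.
From HB Require Import structures.
From mathcomp Require Import all_boot all_order all_algebra.
From mathcomp Require Import all_classical all_reals all_analysis.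
From mathcomp Require Import measurable_realfun complex.
From mathcomp Require Import ring lra zify.
From Stdlib Require Import ClassicalEpsilon.
Set Implicit Arguments.
Unset Strict Implicit.
Unset Printing Implicit Defensive.
Import Order.TTheory GRing.Theory Num.Theory.
Import numFieldNormedType.Exports.
Local Open Scope classical_set_scope.
Local Open Scope ring_scope.
Local Notation Re := complex.Re.
Local Notation Im := complex.Im.

(** By Lagrange's identity the Riesz projection at an eigenvalue [l] of [L_t] has a kernel
    that is a polynomial in the values at [l] of the fundamental solutions and [e^{-i pi t}],
    divided by [F'(l)], as long as [t] is not an integer. Hence it is continuous in [t] wherever
    the label is simple, and on the contours, where [F'] does not vanish. Near a
    non-integer [t0] a label stays bounded by the asymptotics [F(l) ~ 2 cos(pi l)],
    and a Lojasiewicz inequality [|F - c0|^n <= (n+1) |F'|^(n+1)] near the level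
    [c0 = 2 cos(pi t0)], together with [|F - c0| >= K |t - t0|], gives
    [1/|F'| = O(|t - t0|^(-n/(n+1)))], which is integrable. Near an
    integer that is not an ESS, the projection is dominated by [1/|alpha|]. *)

(** Complex analyticity of F is never established. What replaces it is a Wronskian calculus:
    expanding a solution at m in the basis of solutions at l produces an explicit [G] with F(m) -
    F(l) - (m - l) G(l) = O(|m - l|^2) uniformly on discs, and iterating the same expansion
    approximates F by polynomials to any order. A second obstacle is a multiple eigenvalue at t0:
    continuity of the label is known only at simple points, so it might have no limit at t0. Hence
    its boundedness comes from barriers, lines |Re l| = n of a well chosen parity that it cannot
    cross, and the inequality between F - c0 and F' must be uniform on a disc, with one exponent for
    all points of the level set. Near an integer t0 the lower bound on |F - c0| degenerates with the
    critical point of cos(pi t), and only the comparison with 1/|alpha| remains. Eigenfunctions are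
    chosen pointwise, so nothing is known about the measurability of alpha; integrals are therefore
    compared by an inequality valid for arbitrary nonnegative functions. *)

Section Modulus.
Variable R : realType.
Local Notation C := R[i].
Implicit Types (z w : C) (x y : R).

Lemma ReD z w : Re (z + w) = Re z + Re w. Proof. by case: z w => [a b] []. Qed.
Lemma ImD z w : Im (z + w) = Im z + Im w. Proof. by case: z w => [a b] []. Qed.
Lemma ReN z : Re (- z) = - Re z. Proof. by case: z. Qed.
Lemma ImN z : Im (- z) = - Im z. Proof. by case: z. Qed.
Lemma ReB z w : Re (z - w) = Re z - Re w. Proof. by rewrite ReD ReN. Qed.
Lemma ImB z w : Im (z - w) = Im z - Im w. Proof. by rewrite ImD ImN. Qed.
Lemma ReM z w : Re (z * w) = Re z * Re w - Im z * Im w.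
Proof. by case: z w => [a b] []. Qed.
Lemma ImM z w : Im (z * w) = Re z * Im w + Im z * Re w.
Proof. by case: z w => [a b] []. Qed.
Lemma ReV z : Re z^-1 = Re z / (Re z ^+ 2 + Im z ^+ 2).
Proof. by case: z. Qed.
Lemma ImV z : Im z^-1 = - (Im z / (Re z ^+ 2 + Im z ^+ 2)).
Proof. by case: z. Qed.
Lemma complex_ext z w : Re z = Re w -> Im z = Im w -> z = w.
Proof. by case: z w => [a b] [c d] /= -> ->. Qed.
Definition ReE := (ReB, ImB, ReD, ImD, ReN, ImN, ReM, ImM).

Lemma cmodE z : cmod z = Normc.normc z. Proof. by case: z. Qed.
Lemma cmod_ge0 z : 0 <= cmod z. Proof. exact: sqrtr_ge0. Qed.
Lemma cmodM z w : cmod (z * w) = cmod z * cmod w.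
Proof. by rewrite !cmodE Normc.normcM. Qed.
Lemma cmod0 : cmod (0 : C) = 0. Proof. by rewrite cmodE Normc.normc0. Qed.
Lemma cmod1 : cmod (1 : C) = 1. Proof. by rewrite cmodE Normc.normc1. Qed.
Lemma cmodV z : cmod z^-1 = (cmod z)^-1.
Proof. by rewrite !cmodE Normc.normcV. Qed.
Lemma cmodN z : cmod (- z) = cmod z.
Proof. by rewrite /cmod ReN ImN !sqrrN. Qed.
Lemma cmodX z n : cmod (z ^+ n) = cmod z ^+ n.
Proof. by elim: n => [|n IH]; rewrite ?expr0 ?cmod1 // !exprS cmodM IH. Qed.
Lemma cmodD z w : cmod (z + w) <= cmod z + cmod w.
Proof.
have := @ler_normD _ C z w.
by rewrite !normc_def !cmodE; case: z w => [a b] [c d] /=; rewrite -rmorphD lecR.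
Qed.
Lemma cmodB z w : cmod (z - w) <= cmod z + cmod w.
Proof. by rewrite -(cmodN w) cmodD. Qed.
Lemma cmod_distC z w : cmod (z - w) = cmod (w - z).
Proof. by rewrite -opprB cmodN. Qed.
Lemma cmod_dist z w : cmod z - cmod w <= cmod (z - w).
Proof. by rewrite lerBlDr -{1}(subrK w z) cmodD. Qed.
Lemma cmod_tri (v : C) z w : cmod (z - w) <= cmod (z - v) + cmod (v - w).
Proof. by apply: le_trans (cmodD _ _); rewrite addrA subrK. Qed.
Lemma cmod_eq0 z : (cmod z == 0) = (z == 0).
Proof.
apply/eqP/eqP => [|->]; last exact: cmod0.
by rewrite cmodE => /Normc.eq0_normc.
Qed.
Lemma cmod_gt0 z : (0 < cmod z) = (z != 0).
Proof. by rewrite lt_neqAle cmod_ge0 andbT eq_sym cmod_eq0. Qed.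
Lemma cmod_rc x : cmod (rc x) = `|x|.
Proof. by rewrite /cmod /= expr0n addr0 sqrtr_sqr. Qed.
Lemma cmod_sqr z : cmod z ^+ 2 = Re z ^+ 2 + Im z ^+ 2.
Proof. by rewrite sqr_sqrtr // addr_ge0 ?sqr_ge0. Qed.
Lemma Re_le z : `|Re z| <= cmod z.
Proof. by rewrite -sqrtr_sqr ler_wsqrtr // lerDl sqr_ge0. Qed.
Lemma Im_le z : `|Im z| <= cmod z.
Proof. by rewrite -sqrtr_sqr ler_wsqrtr // lerDr sqr_ge0. Qed.
Lemma cmod_le z : cmod z <= `|Re z| + `|Im z|.
Proof.
rewrite -(@ler_pXn2r _ 2) ?nnegrE ?cmod_ge0 ?addr_ge0 //.
rewrite cmod_sqr sqrrD !real_normK ?num_real //.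
by rewrite -addrA lerD2l lerDr mulrn_wge0 // mulr_ge0.
Qed.
Lemma cmod_conj z : cmod (cconj z) = cmod z.
Proof. by rewrite /cmod /= sqrrN. Qed.
Lemma cconjD z w : cconj (z + w) = cconj z + cconj w.
Proof. by apply: complex_ext; rewrite ?ReE /= ?ReE /=; ring. Qed.
Lemma cconjB z w : cconj (z - w) = cconj z - cconj w.
Proof. by apply: complex_ext; rewrite ?ReE /= ?ReE /=; ring. Qed.
Lemma cconjM z w : cconj (z * w) = cconj z * cconj w.
Proof. by apply: complex_ext; rewrite ?ReE /= ?ReE /=; ring. Qed.
Lemma cconjK z : cconj (cconj z) = z.
Proof. by apply: complex_ext; rewrite /= ?opprK. Qed.
Lemma rcD x y : rc (x + y) = rc x + rc y.
Proof. by apply: complex_ext; rewrite /= ?addr0. Qed.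
Lemma rcB x y : rc (x - y) = rc x - rc y.
Proof. by apply: complex_ext; rewrite /= ?subr0. Qed.
Lemma rcM x y : rc (x * y) = rc x * rc y.
Proof. by apply: complex_ext; rewrite /= !(mulr0, mul0r, subr0, addr0). Qed.
Lemma rcN x : rc (- x) = - rc x.
Proof. by apply: complex_ext; rewrite /= ?oppr0. Qed.

Lemma rc0 : rc (0 : R) = 0. Proof. by []. Qed.

Lemma rc_nat n : rc (n%:R : R) = n%:R.
Proof. by rewrite -[LHS]/((n%:R)%:C%C) rmorph_nat. Qed.
Lemma ciM : ci R * ci R = -1.
Proof. by apply: complex_ext; rewrite ?ReE /= ?ReE /=; ring. Qed.
Lemma cmod_ci : cmod (ci R) = 1.
Proof. by rewrite /cmod /= expr0n expr1n add0r sqrtr1. Qed.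

Lemma cexpD z w : cexp (z + w) = cexp z * cexp w.
Proof.
by apply: complex_ext; rewrite /cexp /= !ReE /= expRD ?cosD ?sinD; ring.
Qed.
Lemma cexp0 : cexp (0 : C) = 1.
Proof. by rewrite /cexp /= expR0 cos0 sin0 mulr1 mulr0. Qed.
Lemma cexpN z : cexp (- z) * cexp z = 1.
Proof. by rewrite -cexpD addNr cexp0. Qed.

Lemma cmod_cexp z : cmod (cexp z) = expR (Re z).
Proof.
rewrite /cmod /= !exprMn -mulrDr cos2Dsin2 mulr1 sqrtr_sqr ger0_norm //.
Qed.
Lemma cexp_conj z : cexp (cconj z) = cconj (cexp z).
Proof. by rewrite /cexp /cconj /= cosN sinN mulrN. Qed.
End Modulus.

(** * Bounded measurable functions on [0, pi] and their integrals *)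

Section RealIntegral.
Variable R : realType.
Local Notation mu := (@lebesgue_measure R).
Local Notation I := ([set` `[0, pi]] : set R).

Implicit Types (f g : R -> R) (x y K c : R).

(** Bounded measurable functions form an algebra containing the coefficients of bounded variation as
    well as the solutions, so every integrability condition on [0, pi] reduces to membership. *)
Definition bm (f : R -> R) :=
  measurable_fun I f /\ exists K, forall x, 0 <= x <= pi -> `|f x| <= K.

Lemma bm_ext f g : (forall x, 0 <= x <= pi -> f x = g x) -> bm f -> bm g.
Proof.
move=> fg [mf [K fK]]; split.
  by apply: eq_measurable_fun mf => x; rewrite inE /= in_itv /= => /fg.
by exists K => x xI; rewrite -fg // fK.
Qed.

Lemma bm_cst c : bm (fun=> c).
Proof. by split; [exact: measurable_cst|exists `|c|]. Qed.

Lemma bmD f g : bm f -> bm g -> bm (fun x => f x + g x).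
Proof.
move=> [mf [K fK]] [mg [L gL]]; split; first exact: measurable_realfun.measurable_funD.
by exists (K + L) => x xI; apply: le_trans (ler_normD _ _) (lerD (fK _ xI) (gL _ xI)).
Qed.

Lemma bmM f g : bm f -> bm g -> bm (fun x => f x * g x).
Proof.
move=> [mf [K fK]] [mg [L gL]]; split; first exact: measurable_realfun.measurable_funM.
by exists (K * L) => x xI; rewrite normrM ler_pM // ?fK ?gL.
Qed.

Lemma bmN f : bm f -> bm (fun x => - f x).
Proof.
move=> bf; apply: bm_ext (bmM (bm_cst (-1)) bf) => x _.
by rewrite mulN1r.
Qed.

Lemma bmB f g : bm f -> bm g -> bm (fun x => f x - g x).
Proof. by move=> bf bg; exact: bmD bf (bmN bg). Qed.

Lemma bm_continuous f : {within I, continuous f} -> bm f.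
Proof.
move=> cf; split; first exact: measurable_realfun.subspace_continuous_measurable_fun.
have [|M [_ MP]] := @compact_bounded _ R^o (f @` I).
  apply: continuous_compact => //; exact: segment_compact.
exists (M + 1) => x xI.
by apply: (MP (M + 1)); [rewrite ltrDl|exists x].
Qed.

Lemma bm_lip (f : R -> R) (K : R) : (forall x y, 0 <= x -> x <= y -> y <= pi -> `|f y - f x| <= K * (y - x)) ->
  bm f.
Proof.
move=> fK; apply: bm_continuous.
(* [|K| + 1] is positive whatever the sign of [K], so it can serve as a divisor. *)
have {}fK x y : 0 <= x <= pi -> 0 <= y <= pi -> `|f y - f x| <= (`|K| + 1) * `|y - x|.
  move=> /andP[x0 xp] /andP[y0 yp].
  have KK : K <= `|K| + 1 by rewrite (le_trans (ler_norm K)) // lerDl.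
  have [xy|/ltW xy] := lerP x y.
    by rewrite (le_trans (fK _ _ x0 xy yp)) // ler_wpM2r ?subr_ge0.
  by rewrite distrC (le_trans (fK _ _ y0 xy xp)) // ler_wpM2r ?subr_ge0.
apply/subspace_continuousP => x; rewrite /= in_itv /= => xI.
apply/cvgrPdist_le => /= e e0; near=> y.
have yI : 0 <= y <= pi.
  have : I y by near: y; exact: withinT.
  by rewrite /= in_itv.
rewrite distrC (le_trans (fK _ _ xI yI)) // mulrC -ler_pdivlMr ?ltr_wpDl //.
near: y; apply: cvg_within; apply/nbhs_normP => /=.
exists (e / (`|K| + 1)) => /=; first by rewrite divr_gt0 // ltr_wpDl.
by move=> z /=; rewrite distrC => /ltW.
Unshelve. all: by end_near. Qed.

Lemma bm_integrable f (A : set R) : bm f -> measurable A -> A `<=` I ->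
  mu.-integrable A (EFin \o f).
Proof.
move=> [mf [K fK]] mA AI.
have intf : mu.-integrable I (EFin \o f).
  apply: measurable_bounded_integrable; [exact: measurable_itv| |exact: mf|].
    by rewrite /= lebesgue_measure_itv /=; case: ifP => _; rewrite -?EFinD ltry.
  exists K; split; [exact: num_real|] => M KM x.
  by rewrite /= in_itv /= => /fK/le_trans; apply; exact: ltW.
by apply: integrableS intf.
Qed.

Lemma sub_itv0 (x : R) : x <= pi -> [set` `[0, x]] `<=` I.
Proof. by move=> xp; apply: subset_itvl; rewrite bnd_simp. Qed.

Local Notation P f x := (Rintegral mu [set` `[0, x]] f).

Lemma RID f g x : bm f -> bm g -> x <= pi ->
  P (fun s => f s + g s) x = P f x + P g x.
Proof.
move=> bf bg xp; rewrite RintegralD //; apply: bm_integrable => //; exact: sub_itv0.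
Qed.

Lemma RIB f g x : bm f -> bm g -> x <= pi ->
  P (fun s => f s - g s) x = P f x - P g x.
Proof.
move=> bf bg xp; rewrite RintegralB //; apply: bm_integrable => //; exact: sub_itv0.
Qed.

Lemma RIZ c f x : bm f -> x <= pi -> P (fun s => c * f s) x = c * P f x.
Proof.
move=> bf xp; rewrite RintegralZl //; apply: bm_integrable => //; exact: sub_itv0.
Qed.

Lemma RI_eq f g x : (forall s, 0 <= s <= x -> f s = g s) -> P f x = P g x.
Proof. by move=> fg; apply: eq_Rintegral => s; rewrite inE /= in_itv /= => /fg. Qed.

Lemma RI_diff f x y K : bm f -> 0 <= x -> x <= y -> y <= pi ->
  (forall s, x <= s <= y -> `|f s| <= K) -> `|P f y - P f x| <= K * (y - x).
Proof.
move=> bf x0 xy yp fK.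
have yI : mu.-integrable `[0, y] (EFin \o f) by apply: bm_integrable => //; exact: sub_itv0.
rewrite (Rintegral_itvB yI) ?bnd_simp //.
have xyI : [set` `]x, y]] `<=` I by apply: subset_itv; rewrite bnd_simp.
apply: (le_trans (le_normr_Rintegral _ _)) => //; first exact: bm_integrable.
have -> : K * (y - x) = \int[mu]_(_ in `]x, y]) K.
  rewrite Rintegral_cst //= lebesgue_measure_itv /=; congr (_ * _).
  by case: ifPn; rewrite lte_fin // -leNgt => yx; rewrite /= (le_anti (_ : x <= y <= x)) ?xy ?yx ?subrr.
apply: le_Rintegral => //.
- have [mf [L fL]] := bf.
  apply: (@bm_integrable (fun s => `|f s|)) => //; split.
    exact: measurableT_comp.
  by exists L => s /fL; rewrite normr_id.
- by apply: (@bm_integrable (fun=> K)) => //; exact: bm_cst.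
- by move=> s; rewrite /= in_itv /= => /andP[/ltW xs sy]; apply: fK; rewrite xs.
Qed.

Lemma RI0 f : P f 0 = 0. Proof. by rewrite set_itv1 Rintegral_set1. Qed.

Lemma RI_le f g x : bm f -> bm g -> x <= pi ->
  (forall s, 0 <= s <= x -> f s <= g s) -> P f x <= P g x.
Proof.
move=> bf bg xp fg; by apply: le_Rintegral => //; apply: bm_integrable => //; exact: sub_itv0.
Qed.

Lemma RI_norm_le f g x : bm f -> bm g -> x <= pi ->
  (forall s, 0 <= s <= x -> `|f s| <= g s) -> `|P f x| <= P g x.
Proof.
move=> bf bg xp fg; rewrite ler_norml; apply/andP; split.
  rewrite lerNl -(mulN1r (P f x)) -RIZ //; apply: RI_le => //.
    by apply: bmM => //; exact: bm_cst.
  by move=> s /fg; rewrite mulN1r ler_norml => /andP[]; rewrite lerNl.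
by apply: RI_le => // s /fg; rewrite ler_norml => /andP[].
Qed.

Lemma RI_cst c x : 0 <= x -> P (fun=> c) x = c * x.
Proof.
move=> x0; rewrite Rintegral_cst //= lebesgue_measure_itv /=; congr (_ * _).
case: ifPn; rewrite lte_fin ?oppr0 ?addr0 //= ?subr0 // -leNgt => yx; apply/eqP.
by rewrite eq_le x0 yx.
Qed.

(** Cut [0, x] into n equal pieces: the total increment is at most n K (x/n)^2, which tends to 0. *)
Lemma small_increments_constant (h : R -> R) (K : R) : 
  (forall x y, 0 <= x -> x <= y -> y <= pi -> `|h y - h x| <= K * (y - x) ^+ 2) ->
  forall x, 0 <= x <= pi -> h x = h 0.
Proof.
move=> hK x /andP[x0 xp].
have stepP (n : nat) : (0 < n)%N -> `|h x - h 0| <= K * x ^+ 2 / n%:R.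
  move=> n0; have nR : 0 < n%:R :> R by rewrite ltr0n.
  suff: forall k, (k <= n)%N -> `|h (x * k%:R / n%:R) - h 0| <= k%:R * (K * (x / n%:R) ^+ 2).
    move=> /(_ n (leqnn n)); rewrite mulfK ?gt_eqF // => /le_trans; apply.
    by rewrite le_eqVlt; apply/orP; left; apply/eqP; field; rewrite gt_eqF.
  elim=> [_|k IH kn]; first by rewrite mulr0 !mul0r subrr normr0.
  have -> : h (x * k.+1%:R / n%:R) - h 0 =
    (h (x * k.+1%:R / n%:R) - h (x * k%:R / n%:R)) + (h (x * k%:R / n%:R) - h 0) by ring.
  apply: le_trans (ler_normD _ _) _.
  rewrite -natr1 [X in _ <= X]mulrDl mul1r addrC; apply: lerD; first by apply: IH; exact: ltnW.
  apply: le_trans (hK _ _ _ _ _) _.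
  - by rewrite divr_ge0 ?mulr_ge0.
  - by rewrite ler_pM2r ?invr_gt0 // ler_wpM2l // lerDl.
  - apply: le_trans xp; rewrite ler_pdivrMr // ler_wpM2l //.
    by rewrite natr1 ler_nat.
  - rewrite le_eqVlt; apply/orP; left; apply/eqP; congr (_ * _ ^+ 2).
    by field; rewrite gt_eqF.
apply/eqP; rewrite -subr_eq0 -normr_le0; apply/ler_addgt0Pr => e e0; rewrite add0r.
have [n hn] : exists n : nat, K * x ^+ 2 / e < n.+1%:R.
  exists (Num.bound `|K * x ^+ 2 / e|).
  apply: le_lt_trans (ler_norm _) _; apply: lt_trans (archi_boundP _) _ => //.
  by rewrite ltr_nat.
apply: le_trans (stepP n.+1 _) _ => //.
by rewrite ler_pdivrMr ?ltr0n // (mulrC e) -ler_pdivrMr // ltW.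
Qed.

End RealIntegral.

(** * Complex integrals, primitives and the product rule in integrated form *)

Section ComplexIntegral.
Variable R : realType.
Local Notation C := R[i].
Local Notation mu := (@lebesgue_measure R).
Local Notation I := ([set` `[0, pi]] : set R).
Local Notation RP f x := (Rintegral mu [set` `[0, x]] f).

Lemma RI_ftc (F f : R -> R) x : (forall y : R, is_derive y (1 : R) F (f y)) -> continuous f ->
  0 <= x -> RP f x = F x - F 0.
Proof.
move=> dF cf; rewrite le_eqVlt => /predU1P[<-|x0]; first by rewrite RI0 subrr.
have cF : continuous F.
  by move=> y; apply: differentiable_continuous; apply/derivable1_diffP; case: (dF y).
rewrite /Rintegral (@continuous_FTC2 _ f F 0 x) //.
- exact: continuous_subspaceT.
- split => [y _|| ]; first by case: (dF y).
    exact/cvg_at_right_filter/cF.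
  exact/cvg_at_left_filter/cF.
- by move=> y _; rewrite derive1E; case: (dF y).
Qed.

Lemma is_derive_scale (a y : R) : is_derive y (1 : R) (fun x : R => a *: x) a.
Proof.
by apply: is_derive_eq (is_deriveZ _ _) _; rewrite /GRing.scale /= mulr1.
Qed.
Lemma is_derive_expR_scale (a y : R) : is_derive y (1 : R) (fun x : R => expR (a * x)) (a * expR (a * y)).
Proof.
have -> : (fun x : R => expR (a * x)) = expR \o (fun x => a *: x) by [].
rewrite mulrC; apply: is_derive1_comp.
exact: is_derive_scale.
Qed.
Lemma is_derive_cos_scale (a y : R) : is_derive y (1 : R) (fun x : R => cos (a * x)) (- (a * sin (a * y))).
Proof.
have -> : (fun x : R => cos (a * x)) = cos \o (fun x => a *: x) by [].
rewrite mulrC -mulNr; apply: is_derive1_comp.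
exact: is_derive_scale.
Qed.
Lemma is_derive_sin_scale (a y : R) : is_derive y (1 : R) (fun x : R => sin (a * x)) (a * cos (a * y)).
Proof.
have -> : (fun x : R => sin (a * x)) = sin \o (fun x => a *: x) by [].
rewrite mulrC; apply: is_derive1_comp.
exact: is_derive_scale.
Qed.

Implicit Types (f g : R -> C) (x y K : R) (c : C).

Definition cbm (g : R -> C) := bm (fun x => Re (g x)) /\ bm (fun x => Im (g x)).

Lemma cbm_ext f g : (forall x, 0 <= x <= pi -> f x = g x) -> cbm f -> cbm g.
Proof.
by move=> fg [rf jf]; split; [apply: bm_ext rf|apply: bm_ext jf] => x /fg ->.
Qed.
Lemma cbm_cst c : cbm (fun=> c). Proof. by split; exact: bm_cst. Qed.
Lemma cbmD f g : cbm f -> cbm g -> cbm (fun x => f x + g x).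
Proof.
move=> [rf jf] [rg jg]; split.
  by apply: bm_ext (bmD rf rg) => x _; rewrite ReD.
by apply: bm_ext (bmD jf jg) => x _; rewrite ImD.
Qed.
Lemma cbmM f g : cbm f -> cbm g -> cbm (fun x => f x * g x).
Proof.
move=> [rf jf] [rg jg]; split.
  by apply: bm_ext (bmB (bmM rf rg) (bmM jf jg)) => x _; rewrite ReM.
by apply: bm_ext (bmD (bmM rf jg) (bmM jf rg)) => x _; rewrite ImM.
Qed.
Lemma cbmZ c f : cbm f -> cbm (fun x => c * f x).
Proof. by move=> cf; apply: cbmM => //; exact: cbm_cst. Qed.
Lemma cbmN f : cbm f -> cbm (fun x => - f x).
Proof. by move=> cf; apply: cbm_ext (cbmZ (-1) cf) => x _; rewrite mulN1r. Qed.
Lemma cbmB f g : cbm f -> cbm g -> cbm (fun x => f x - g x).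
Proof. by move=> cf cg; apply: cbmD cf (cbmN cg). Qed.
Lemma cbm_conj f : cbm f -> cbm (fun x => cconj (f x)).
Proof. by move=> [rf jf]; split=> //=; exact: bmN. Qed.
Lemma cbm_bnd f : cbm f -> exists2 K, 0 <= K & forall x, 0 <= x <= pi -> cmod (f x) <= K.
Proof.
move=> [[_ [K rK]] [_ [L jL]]]; exists (K + L); last first.
  by move=> x xI; rewrite (le_trans (cmod_le _)) // lerD // ?rK ?jL.
have z : 0 <= (0 : R) <= pi by rewrite lexx pi_ge0.
by rewrite (le_trans _ (lerD (rK _ z) (jL _ z))) // addr_ge0.
Qed.
Lemma cbm_lip (f : R -> C) K :
  (forall x y, 0 <= x -> x <= y -> y <= pi -> cmod (f y - f x) <= K * (y - x)) -> cbm f.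
Proof.
move=> fK; split; apply: (@bm_lip _ _ K) => x y x0 xy yp; apply: le_trans (fK _ _ x0 xy yp).
  by rewrite -ReB Re_le.
by rewrite -ImB Im_le.
Qed.
Lemma bm_cmod f : cbm f -> bm (fun x => cmod (f x)).
Proof.
move=> bf; have [K _ fK] := cbm_bnd bf; case: bf => [[mr _] [mi _]]; split; last first.
  by exists K => x /fK; rewrite ger0_norm ?cmod_ge0.
apply: (measurableT_comp (f := @Num.sqrt R)).
  by apply: measurable_realfun.continuous_measurable_fun; exact: sqrt_continuous.
by apply: measurable_realfun.measurable_funD; exact: measurable_realfun.measurable_funX.
Qed.

Local Notation P f x := (cint [set` `[0, x]] f).

Lemma cintD f g x : cbm f -> cbm g -> x <= pi -> P (fun s => f s + g s) x = P f x + P g x.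
Proof.
move=> [rf jf] [rg jg] xp; apply: complex_ext.
  by rewrite ReD /= -RID //; apply: (@RI_eq R) => s _; rewrite ReD.
by rewrite ImD /= -RID //; apply: (@RI_eq R) => s _; rewrite ImD.
Qed.
Lemma cintZ c f x : cbm f -> x <= pi -> P (fun s => c * f s) x = c * P f x.
Proof.
move=> [rf jf] xp; have bZ a (k : R -> R) : bm k -> bm (fun s => a * k s).
  exact: bmM (bm_cst _).
apply: complex_ext.
  rewrite ReM /= -!RIZ // -RIB //; try exact: bZ.
  by apply: (@RI_eq R) => s _; rewrite ReM.
rewrite ImM /= -!RIZ // -RID //; try exact: bZ.
by apply: (@RI_eq R) => s _; rewrite ImM.
Qed.
Lemma cint_eq f g x : (forall s, 0 <= s <= x -> f s = g s) -> P f x = P g x.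
Proof. by move=> fg; apply: complex_ext => /=; apply: (@RI_eq R) => s /fg ->. Qed.
Lemma cintN f x : cbm f -> x <= pi -> P (fun s => - f s) x = - P f x.
Proof.
by move=> bf xp; rewrite -mulN1r -cintZ //; apply: cint_eq => s _; rewrite mulN1r.
Qed.
Lemma cintB f g x : cbm f -> cbm g -> x <= pi -> P (fun s => f s - g s) x = P f x - P g x.
Proof. by move=> bf bg xp; rewrite cintD ?cintN //; exact: cbmN. Qed.
Lemma cint_conj f x : cbm f -> x <= pi -> P (fun s => cconj (f s)) x = cconj (P f x).
Proof.
move=> [rf jf] xp; apply: complex_ext => //=.
by rewrite -mulN1r -RIZ //; apply: (@RI_eq R) => s _; rewrite mulN1r.
Qed.
Lemma cint0 f : P f 0 = 0.
Proof. by rewrite /cint !RI0. Qed.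
Lemma cint_cst c x : 0 <= x -> P (fun=> c) x = rc x * c.
Proof.
by move=> x0; rewrite /cint !RI_cst //; apply: complex_ext; rewrite ReE /=; ring.
Qed.
(** The factor 2 adds the bounds for the real and the imaginary part; sharp constants are of no
    interest here. *)
Lemma cint_diff f x y K : cbm f -> 0 <= x -> x <= y -> y <= pi ->
  (forall s, x <= s <= y -> cmod (f s) <= K) -> cmod (P f y - P f x) <= 2 * K * (y - x).
Proof.
move=> [rf jf] x0 xy yp fK; rewrite (le_trans (cmod_le _)) // ReB ImB /=.
have -> : 2 * K * (y - x) = K * (y - x) + K * (y - x) by ring.
apply: lerD; apply: RI_diff => // s /fK; apply: le_trans.
  exact: Re_le.
exact: Im_le.
Qed.
Lemma cint_norm_le f (g : R -> R) x : cbm f -> bm g -> x <= pi ->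
  (forall s, 0 <= s <= x -> cmod (f s) <= g s) -> cmod (P f x) <= 2 * RP g x.
Proof.
move=> [rf jf] bg xp fg; rewrite (le_trans (cmod_le _)) //= mulr_natl mulr2n.
apply: lerD; apply: RI_norm_le => // s /fg; apply: le_trans.
  exact: Re_le.
exact: Im_le.
Qed.
Lemma cint_bnd f x K : cbm f -> 0 <= x -> x <= pi ->
  (forall s, 0 <= s <= pi -> cmod (f s) <= K) -> cmod (P f x) <= 2 * K * pi.
Proof.
move=> bf x0 xp fK; have K0 : 0 <= K by rewrite (le_trans (cmod_ge0 _) (fK 0 _)) // lexx pi_ge0.
rewrite -(subr0 (P f x)) -(cint0 f) (le_trans (@cint_diff f 0 x K _ _ _ _ _)) //.
  by move=> s /andP[s0 sx]; apply: fK; rewrite s0 (le_trans sx).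
by rewrite subr0 ler_wpM2l // mulr_ge0.
Qed.
Lemma cbm_integrable f x : cbm f -> x <= pi -> cintegrable [set` `[0, x]] f.
Proof. by move=> [rf jf] xp; split; apply: bm_integrable => //; exact: sub_itv0. Qed.

Lemma cbm_cint f : cbm f -> cbm (fun x => P f x).
Proof.
move=> bf; have [K K0 fK] := cbm_bnd bf; apply: (@cbm_lip _ (2 * K)) => x y x0 xy yp.
apply: cint_diff => // s /andP[xs sy]; apply: fK.
by rewrite (le_trans x0 xs) (le_trans sy yp).
Qed.

(** The relation f' = g in integrated form, since g inherits the jumps of the coefficients and f
    need not be differentiable there. *)
Definition prim (f g : R -> C) := cbm g /\ forall x, 0 <= x <= pi -> f x = f 0 + P g x.

Lemma prim_lip f g : prim f g -> exists2 K, 0 <= K &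
  forall x y, 0 <= x -> x <= y -> y <= pi -> cmod (f y - f x) <= K * (y - x).
Proof.
move=> [bg fg]; have [K K0 gK] := cbm_bnd bg; exists (2 * K); first by rewrite mulr_ge0.
move=> x y x0 xy yp; rewrite (fg y) ?(le_trans x0 xy) // (fg x) ?x0 ?(le_trans xy) //.
rewrite opprD addrACA subrr add0r; apply: cint_diff => // s /andP[xs sy]; apply: gK.
by rewrite (le_trans x0 xs) (le_trans sy yp).
Qed.
Lemma prim_cbm f g : prim f g -> cbm f.
Proof. by move=> /prim_lip[K _]; exact: cbm_lip. Qed.
Lemma prim_ext f g f1 g1 : (forall x, 0 <= x <= pi -> f x = f1 x) ->
  (forall x, 0 <= x <= pi -> g x = g1 x) -> prim f g -> prim f1 g1.
Proof.
move=> ff gg [bg fg]; split; first exact: cbm_ext bg.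
move=> x xI; rewrite -!ff ?lexx ?pi_ge0 // fg //; congr (_ + _); apply: cint_eq => s /andP[s0 sx].
by rewrite gg // s0 (le_trans sx) //; case/andP: xI.
Qed.

Lemma primD f g f1 g1 : prim f g -> prim f1 g1 -> prim (fun x => f x + f1 x) (fun x => g x + g1 x).
Proof.
move=> [bg fg] [bg1 fg1]; split; first exact: cbmD.
move=> x xI; have [_ xp] := andP xI.
by rewrite (cintD bg bg1 xp) (fg x xI) (fg1 x xI) addrACA.
Qed.
Lemma primZ c f g : prim f g -> prim (fun x => c * f x) (fun x => c * g x).
Proof.
move=> [bg fg]; split; first exact: cbmZ.
move=> x xI; have [_ xp] := andP xI.
by rewrite (cintZ _ bg xp) (fg x xI) mulrDr.
Qed.
Lemma primB f g f1 g1 : prim f g -> prim f1 g1 -> prim (fun x => f x - f1 x) (fun x => g x - g1 x).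
Proof.
move=> pf /(primZ (-1)) pf1; apply: prim_ext (primD pf pf1) => x _; by rewrite mulN1r.
Qed.

(* The error of the linear approximation is quadratic in the step, so it vanishes upon summing over a fine subdivision. *)
Lemma prim_of_quadratic_error f g K : cbm g ->
  (forall x y, 0 <= x -> x <= y -> y <= pi ->
     cmod (f y - f x - (P g y - P g x)) <= K * (y - x) ^+ 2) -> prim f g.
Proof.
move=> bg fK; split=> // x xI; pose h s := f s - P g s.
suff : h x = h 0 by rewrite /h cint0 subr0 => <-; rewrite subrK.
have hh a b : h b - h a = f b - f a - (P g b - P g a) by rewrite /h; ring.
apply: complex_ext.
  apply: (@small_increments_constant _ (fun s => Re (h s)) K) => // a b a0 ab bp.
  by rewrite -ReB hh; apply: le_trans (Re_le _) (fK _ _ _ _ _).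
apply: (@small_increments_constant _ (fun s => Im (h s)) K) => // a b a0 ab bp.
by rewrite -ImB hh; apply: le_trans (Im_le _) (fK _ _ _ _ _).
Qed.
Lemma primM f g f1 g1 : prim f g -> prim f1 g1 ->
  prim (fun x => f x * f1 x) (fun x => g x * f1 x + f x * g1 x).
Proof.
move=> pf pf1; have bf := prim_cbm pf; have bf1 := prim_cbm pf1.
have [K K0 fK] := prim_lip pf; have [L L0 fL] := prim_lip pf1.
case: (pf) => bg fg; case: (pf1) => bg1 fg1.
have [G G0 gG] := cbm_bnd bg; have [H H0 gH] := cbm_bnd bg1.
have bb : cbm (fun x => g x * f1 x + f x * g1 x) by apply: cbmD; apply: cbmM.
apply: (@prim_of_quadratic_error _ _ (2 * (G * L + K * H))) => // x y x0 xy yp.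
have xI : 0 <= x <= pi by rewrite x0 (le_trans xy).
have yI : 0 <= y <= pi by rewrite yp (le_trans x0).
have [_ xp] := andP xI; have [y0 _] := andP yI.
(* Freeze f1 at y and f at x: the error of the product rule over [x, y] is the integral of [k],
   whose terms are a bounded derivative times an increment of size O(y - x). *)
pose k s := g s * (f1 y - f1 s) + (f x - f s) * g1 s.
have bk : cbm k.
  by apply: cbmD; apply: cbmM => //; apply: cbmB => //; exact: cbm_cst.
have PkE z : 0 <= z -> z <= pi ->
    P k z = f1 y * P g z + f x * P g1 z - P (fun x => g x * f1 x + f x * g1 x) z.
  move=> z0 zp; rewrite -!cintZ // -cintD // -?cintB //; try by [apply: cbmZ|apply: cbmD; apply: cbmZ].
  by apply: cint_eq => s _; rewrite /k; ring.
have -> : f y * f1 y - f x * f1 x -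
   (P (fun x => g x * f1 x + f x * g1 x) y - P (fun x => g x * f1 x + f x * g1 x) x) =
   P k y - P k x.
  rewrite !PkE // (fg y) // (fg1 y) // (fg x) // (fg1 x) //; ring.
have -> : 2 * (G * L + K * H) * (y - x) ^+ 2 =
   2 * ((G * L + K * H) * (y - x)) * (y - x) by ring.
apply: cint_diff => // s /andP[xs sy].
have sI : 0 <= s <= pi by rewrite (le_trans x0 xs) (le_trans sy yp).
have [s0 sp] := andP sI.
rewrite (le_trans (cmodD _ _)) // !cmodM mulrDl -!mulrA; apply: lerD.
  apply: ler_pM; rewrite ?cmod_ge0 ?gG // (le_trans (fL _ _ _ _ _)) // ler_wpM2l //.
  by rewrite lerD2l lerN2.
rewrite mulrCA mulrC; apply: ler_pM; rewrite ?cmod_ge0 ?gH // cmod_distC (le_trans (fK _ _ _ _ _)) //.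
by rewrite ler_wpM2l // lerD2r.
Qed.
Lemma prim_cexp (k : C) : prim (fun x => cexp (k * rc x)) (fun x => k * cexp (k * rc x)).
Proof.
have cE (a : R) : continuous (fun x => expR (a * x)).
  move=> x; apply: differentiable_continuous; apply/derivable1_diffP.
  by case: (is_derive_expR_scale a x).
have cC (a : R) : continuous (fun x => cos (a * x)).
  move=> x; apply: differentiable_continuous; apply/derivable1_diffP.
  by case: (is_derive_cos_scale a x).
have cS (a : R) : continuous (fun x => sin (a * x)).
  move=> x; apply: differentiable_continuous; apply/derivable1_diffP.
  by case: (is_derive_sin_scale a x).
have E x : cexp (k * rc x) = Complex (expR (Re k * x) * cos (Im k * x)) (expR (Re k * x) * sin (Im k * x)).
  by rewrite /cexp !ReE /= !mulr0 subr0 add0r.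
pose fr x := Re k * (expR (Re k * x) * cos (Im k * x)) - Im k * (expR (Re k * x) * sin (Im k * x)).
pose fi x := Re k * (expR (Re k * x) * sin (Im k * x)) + Im k * (expR (Re k * x) * cos (Im k * x)).
have cfr : continuous fr.
  move=> x; apply: cvgB; apply: cvgM; [exact: cvg_cst| |exact: cvg_cst|]; apply: cvgM;
    [exact: cE|exact: cC|exact: cE|exact: cS].
have cfi : continuous fi.
  move=> x; apply: cvgD; apply: cvgM; [exact: cvg_cst| |exact: cvg_cst|]; apply: cvgM;
    [exact: cE|exact: cS|exact: cE|exact: cC].
have RE x : Re (k * cexp (k * rc x)) = fr x by rewrite E !ReE.
have IE x : Im (k * cexp (k * rc x)) = fi x by rewrite E !ReE.
split.
  split; apply: bm_continuous; apply: continuous_subspaceT.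
    by under eq_fun do rewrite RE.
  by under eq_fun do rewrite IE.
move=> x /andP[x0 xp]; rewrite !E mulr0 expR0 mulr0 cos0 sin0.
have dr y : is_derive y (1 : R) (fun x : R => expR (Re k * x) * cos (Im k * x)) (fr y).
  have := @is_deriveM _ _ _ _ _ _ _ _ (is_derive_expR_scale (Re k) y) (is_derive_cos_scale (Im k) y).
  by move=> h; apply: is_derive_eq h _; rewrite /fr /GRing.scale /=; ring.
have di y : is_derive y (1 : R) (fun x : R => expR (Re k * x) * sin (Im k * x)) (fi y).
  have := @is_deriveM _ _ _ _ _ _ _ _ (is_derive_expR_scale (Re k) y) (is_derive_sin_scale (Im k) y).
  by move=> h; apply: is_derive_eq h _; rewrite /fi /GRing.scale /=; ring.
apply: complex_ext; rewrite ReE /=.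
  under eq_Rintegral do rewrite RE.
  by rewrite (RI_ftc dr) // !mulr0 expR0 cos0 mulr1; ring.
under eq_Rintegral do rewrite IE.
by rewrite (RI_ftc di) // !mulr0 expR0 sin0 mulr0; ring.
Qed.
End ComplexIntegral.

(** * Functions of bounded variation *)

Section BoundedVariation.
Variable R : realType.
Local Notation C := R[i].
Implicit Types (f V : R -> R) (x y K c : R).

(** V is any function whose increments dominate those of g, such as the total variation of g from 0;
    it is easily combined when g is a sum or a product. *)
Definition increment_bound V (g : R -> C) :=
  forall x y, 0 <= x -> x <= y -> y <= pi -> cmod (g y - g x) <= V y - V x.

Lemma bounded_variation_increment f : bounded_variation 0 pi f ->
  exists V, forall x y, 0 <= x -> x <= y -> y <= pi -> `|f y - f x| <= V y - V x.
Proof.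
move=> bf; exists (fun x => fine (total_variation 0 x f)) => x y x0 xy yp.
have y0 := le_trans x0 xy.
have fy : total_variation 0 y f \is a fin_num.
  by apply/bounded_variationP => //; exact: bounded_variationl bf.
have fx : total_variation 0 x f \is a fin_num.
  by apply/bounded_variationP => //; apply: bounded_variationl bf => //; exact: le_trans yp.
have fxy : total_variation x y f \is a fin_num.
  by apply/bounded_variationP => //; apply: bounded_variationr (bounded_variationl _ _ bf).
rewrite (total_variationD f x0 xy) fineD // addrAC subrr add0r -lee_fin fineK //.
exact: total_variation_ge.
Qed.

Lemma BVc_increment_bound (p : R -> C) : BVc p -> exists V, increment_bound V p.
Proof.
move=> [/bounded_variation_increment[V rV] /bounded_variation_increment[W iW]].
exists (fun x => V x + W x) => x y x0 xy yp.
rewrite (le_trans (cmod_le _)) // ReB ImB opprD addrACA.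
by apply: lerD; [exact: rV|exact: iW].
Qed.

Lemma bm_nondecreasing f : (forall x y, 0 <= x -> x <= y -> y <= pi -> f x <= f y) -> bm f.
Proof.
move=> fnd; split; last first.
  exists (`|f 0| + `|f pi|) => x /andP[x0 xp]; rewrite ler_norml; apply/andP; split.
    rewrite opprD (le_trans _ (fnd 0 x _ _ _)) //.
    by rewrite -lerBrDl opprK (le_trans _ (_ : 0 <= _)) ?oppr_le0 // addrC -lerBlDr sub0r -normrN ler_norm.
  by rewrite (le_trans (fnd x pi _ _ _)) // (le_trans (ler_norm _)) // lerDr.
(* Clamping the argument to [0, pi] extends f to a nondecreasing function on the whole line. *)
pose g x := f (Num.max 0 (Num.min x pi)).
apply: (@eq_measurable_fun _ _ _ _ _ g).
  move=> x; rewrite inE /= in_itv /= => /andP[x0 xp].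
  by rewrite /g (min_idPl xp) (max_idPr x0).
apply: measurable_realfun.nondecreasing_measurable => // x y xy; apply: fnd.
- by rewrite le_max lexx.
- have h : Num.min x pi <= Num.min y pi by rewrite le_min !ge_min xy lexx orbT.
  by rewrite ge_max; apply/andP; split; rewrite le_max ?lexx // h orbT.
- by rewrite ge_max pi_ge0 ge_min lexx orbT.
Qed.

(** Jordan decomposition: f is the difference of the nondecreasing functions f + V and V. *)
Lemma bm_increment f V : (forall x y, 0 <= x -> x <= y -> y <= pi -> `|f y - f x| <= V y - V x) ->
  bm f.
Proof.
move=> fV; have Vnd x y : 0 <= x -> x <= y -> y <= pi -> V x <= V y.
  by move=> x0 xy yp; rewrite -subr_ge0 (le_trans _ (fV x y _ _ _)).
apply: (bm_ext (f := fun x => (f x + V x) - V x)); first by move=> x _; rewrite addrK.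
apply: bmB; apply: bm_nondecreasing => // x y x0 xy yp.
have := fV x y x0 xy yp; rewrite ler_norml => /andP[]; lra.
Qed.

Lemma increment_bound_cbm V p : increment_bound V p -> cbm p.
Proof.
move=> pV; split; apply: (@bm_increment _ V) => x y x0 xy yp; apply: le_trans (pV x y x0 xy yp).
  by rewrite -ReB Re_le.
by rewrite -ImB Im_le.
Qed.

End BoundedVariation.

(** * Gronwall's inequality and geometric limits *)

Section Gronwall.
Variable R : realType.
Local Notation C := R[i].
Local Notation mu := (@lebesgue_measure R).
Local Notation RP f x := (Rintegral mu [set` `[0, x]] f).
Implicit Types (m : R -> R) (A B D L k x : R).

Lemma bm_expR k : bm (fun x => expR (k * x)).
Proof.
apply: bm_continuous; apply: continuous_subspaceT => x.
apply: differentiable_continuous; apply/derivable1_diffP.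
by case: (is_derive_expR_scale k x).
Qed.

Lemma RI_expR k x : k != 0 -> 0 <= x -> x <= pi ->
  RP (fun s => expR (k * s)) x = (expR (k * x) - 1) / k.
Proof.
move=> k0 x0 xp.
have cE0 : continuous (fun x => expR (k * x)).
  move=> y; apply: differentiable_continuous; apply/derivable1_diffP.
  by case: (is_derive_expR_scale k y).
have cE : continuous (fun x => k * expR (k * x)).
  by move=> y; apply: cvgM; [exact: cvg_cst|exact: cE0].
have := RI_ftc (is_derive_expR_scale k) cE x0.
by rewrite RIZ ?mulr0 ?expR0 => [<-| |//]; [rewrite mulrC mulKf|exact: bm_expR].
Qed.

Lemma RI_expR_le k m D x : 0 < k -> 0 <= D -> 0 <= x -> x <= pi -> bm m ->
  (forall s, 0 <= s <= x -> m s <= D * expR (k * s)) -> RP m x <= D / k * expR (k * x).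
Proof.
move=> k0 D0 x0 xp bmm mD.
apply: (@le_trans _ _ (RP (fun s => D * expR (k * s)) x)).
  by apply: RI_le => //; apply: bmM; [exact: bm_cst|exact: bm_expR].
rewrite RIZ //; last exact: bm_expR.
rewrite RI_expR ?gt_eqF // mulrA -mulrA (mulrC _ k^-1) mulrA.
by rewrite ler_wpM2l ?divr_ge0 ?(ltW k0) // lerBlDr lerDl.
Qed.

Lemma half_pow_small B (e : R) : 0 < e -> exists n : nat, B / 2 ^+ n < e.
Proof.
move=> e0; exists (Num.bound `|B / e|).
rewrite ltr_pdivrMr ?exprn_gt0 // mulrC -ltr_pdivrMr //.
apply: le_lt_trans (ler_norm _) _.
apply: lt_le_trans (archi_boundP _) _; first exact: normr_ge0.
by rewrite -natrX ler_nat ltnW // ltn_expl.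
Qed.

(** With the weight exp(2 L x), L times integration halves a bound, so the constant 2 A + K / 2^n
    improves to A + (2 A + K / 2^n) / 2 = 2 A + K / 2^(n+1); then n tends to infinity. *)
Lemma gronwall m A L : bm m -> 0 <= A -> 0 < L ->
  (forall x, 0 <= x <= pi -> m x <= A + L * RP m x) ->
  forall x, 0 <= x <= pi -> m x <= 2 * A * expR (2 * L * x).
Proof.
move=> bmm A0 L0 mA.
have E1 x : 0 <= x <= pi -> 1 <= expR (2 * L * x).
  by move=> /andP[x0 _]; rewrite -expR0 ler_expR !mulr_ge0 // ltW.
have [K mK] : exists K, forall x, 0 <= x <= pi -> `|m x| <= K by case: bmm.
have K0 : 0 <= K by rewrite (le_trans _ (mK 0 _)) // lexx pi_ge0.
have stepP n : forall x, 0 <= x <= pi -> m x <= (2 * A + K / 2 ^+ n) * expR (2 * L * x).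
  elim: n => [|n IH] x xI.
    rewrite expr0 divr1 (le_trans (ler_norm _)) // (le_trans (mK _ xI)) //.
    rewrite -[leLHS]mulr1 ler_pM ?E1 // lerDr mulr_ge0 //.
  have [x0 xp] := andP xI.
  have D0 : 0 <= 2 * A + K / 2 ^+ n by rewrite addr_ge0 ?mulr_ge0 // divr_ge0 // exprn_ge0.
  have := @RI_expR_le (2 * L) m (2 * A + K / 2 ^+ n) x _ D0 x0 xp bmm _.
  have L20 : 0 < 2 * L by rewrite mulr_gt0.
  move=> /(_ L20) mI.
  have {}mI : L * RP m x <= (2 * A + K / 2 ^+ n) / 2 * expR (2 * L * x).
    apply: (@le_trans _ _ (L * ((2 * A + K / 2 ^+ n) / (2 * L) * expR (2 * L * x)))).
      rewrite ler_pM2l //; apply: mI => s /andP[s0 sx]; apply: IH.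
      by rewrite s0 (le_trans sx).
    rewrite le_eqVlt; apply/orP; left; apply/eqP; field.
    by rewrite !gt_eqF // exprn_gt0.
  apply: (le_trans (mA _ xI)).
  apply: (@le_trans _ _ (A * expR (2 * L * x) + (2 * A + K / 2 ^+ n) / 2 * expR (2 * L * x))).
    by apply: lerD => //; rewrite -[leLHS]mulr1 ler_wpM2l // E1.
  rewrite le_eqVlt; apply/orP; left; apply/eqP; rewrite exprS; field.
  by rewrite gt_eqF // exprn_gt0.
move=> x xI; apply/ler_addgt0Pr => e e0.
have [n hn] := half_pow_small K (divr_gt0 e0 (expR_gt0 (2 * L * x))).
rewrite (le_trans (stepP n _ xI)) // mulrDl lerD2l.
by rewrite -ler_pdivlMr ?expR_gt0 // ltW.
Qed.

(** The limit is the supremum of the lower bounds u_n - 2 D / 2^n, for which every u_m + 2 D / 2^m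
    is an upper bound. *)
Lemma real_geometric_limit (u : nat -> R) D : (forall n, `|u n.+1 - u n| <= D / 2 ^+ n) ->
  exists l, forall n, `|u n - l| <= 2 * D / 2 ^+ n.
Proof.
move=> uD; have D0 : 0 <= D by have := uD 0%N; rewrite expr0 divr1; apply: le_trans.
have step n (k : nat) : `|u (n + k)%N - u n| <= 2 * D / 2 ^+ n - 2 * D / 2 ^+ (n + k)%N.
  elim: k => [|k IH]; first by rewrite addn0 !subrr normr0.
  rewrite addnS -(subrKA (u (n + k)%N)) (le_trans (ler_normD _ _)) //.
  rewrite (le_trans (lerD (uD _) IH)) // exprS.
  rewrite le_eqVlt; apply/orP; left; apply/eqP; field.
  by rewrite !expf_neq0 // pnatr_eq0.
have dist n (m : nat) : `|u m - u n| <= 2 * D / 2 ^+ n + 2 * D / 2 ^+ m.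
  have g (k : nat) : 0 <= 2 * D / 2 ^+ k by rewrite divr_ge0 ?mulr_ge0 // exprn_ge0.
  have [nm|/ltnW nm] := leqP n m.
    have := step n (m - n)%N; rewrite subnKC // => /le_trans; apply.
    by rewrite lerD2l ge0_cp.
  have := step m (n - m)%N; rewrite subnKC // distrC => /le_trans; apply.
  by rewrite addrC lerD2r (le_trans _ (g n)) // oppr_le0.
pose S := [set u n - 2 * D / 2 ^+ n | n in [set: nat]].
have ubS n : ubound S (u n + 2 * D / 2 ^+ n).
  move=> _ [m _ <-]; have := dist n m; rewrite ler_norml => /andP[_]; lra.
have supS : has_sup S by split; [exists (u 0%N - 2 * D / 2 ^+ 0); exists 0%N|exists (u 0%N + 2 * D / 2 ^+ 0)].
exists (sup S) => n; rewrite ler_norml; apply/andP; split.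
  have := sup_le_ub supS.1 (ubS n); lra.
have : u n - 2 * D / 2 ^+ n <= sup S by apply: ub_le_sup; [exact: supS.2|exists n].
lra.
Qed.

Lemma complex_geometric_limit (u : nat -> C) D : (forall n, cmod (u n.+1 - u n) <= D / 2 ^+ n) ->
  exists l, forall n, cmod (u n - l) <= 4 * D / 2 ^+ n.
Proof.
move=> uD.
have [|a aD] := @real_geometric_limit (fun n => Re (u n)) D.
  by move=> n; rewrite -ReB (le_trans (Re_le _)).
have [|b bD] := @real_geometric_limit (fun n => Im (u n)) D.
  by move=> n; rewrite -ImB (le_trans (Im_le _)).
exists (Complex a b) => n; rewrite (le_trans (cmod_le _)) // ReB ImB /=.
have -> : 4 * D / 2 ^+ n = 2 * D / 2 ^+ n + 2 * D / 2 ^+ n by ring.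
by apply: lerD; [exact: aD|exact: bD].
Qed.

Lemma cbm_uniform_limit (g : nat -> R -> C) (f : R -> C) D : (forall n, cbm (g n)) ->
  (forall n x, 0 <= x <= pi -> cmod (g n x - f x) <= D / 2 ^+ n) -> cbm f.
Proof.
move=> bg gf; have [K K0 gK] := cbm_bnd (bg 0%N).
have fK x : 0 <= x <= pi -> cmod (f x) <= K + D.
  move=> xI; have -> : f x = g 0%N x - (g 0%N x - f x) by ring.
  by rewrite (le_trans (cmodB _ _)) // lerD ?gK // (le_trans (gf _ _ xI)) // expr0 divr1.
have lim (h : C -> R) : (forall z w, `|h z - h w| <= cmod (z - w)) ->
    forall x, 0 <= x <= pi -> h (g n x) @[n --> \oo] --> h (f x).
  move=> hc x xI; apply/cvgrPdist_lt => e e0.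
  have [N hN] := half_pow_small D e0.
  exists N => // n /= Nn; rewrite distrC; apply: le_lt_trans (hc _ _) _.
  apply: le_lt_trans (gf n x xI) (le_lt_trans _ hN).
  have D0 : 0 <= D by have := le_trans (cmod_ge0 _) (gf 0%N x xI); rewrite expr0 divr1.
  by rewrite ler_wpM2l // lef_pV2 ?posrE ?exprn_gt0 // ler_eXn2l // ltr1n.
split; split.
- apply: (@measurable_realfun.measurable_fun_cvg _ _ _ _ (fun n x => Re (g n x))).
    by move=> n; case: (bg n) => [[]].
  move=> x; rewrite /= in_itv /= => xI; apply: lim => // z w.
  by rewrite -ReB Re_le.
- by exists (K + D) => x xI; rewrite (le_trans (Re_le _)) // fK.
- apply: (@measurable_realfun.measurable_fun_cvg _ _ _ _ (fun n x => Im (g n x))).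
    by move=> n; case: (bg n) => [_ []].
  move=> x; rewrite /= in_itv /= => xI; apply: lim => // z w.
  by rewrite -ImB Im_le.
- by exists (K + D) => x xI; rewrite (le_trans (Im_le _)) // fK.
Qed.
End Gronwall.

(** * Existence of solutions of the Dirac system *)

Section Dirac.
Variable R : realType.
Local Notation C := R[i].
Local Notation C2 := (C * C)%type.
Local Notation mu := (@lebesgue_measure R).
Local Notation P f x := (cint [set` `[0, x]] f).
Implicit Types (p q : R -> C) (u v : R -> C2) (l m : C) (x : R).

(** Solutions with a bounded integrand; by [is_solP] this agrees with [is_sol] for bounded
    coefficients. *)
Definition sol p q l u :=
  prim (fun x => (u x).1) (fun x => (odeM p q l x (u x)).1) /\
  prim (fun x => (u x).2) (fun x => (odeM p q l x (u x)).2).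

Definition nrm2 (y : C2) : R := cmod y.1 + cmod y.2.

Lemma nrm2_ge0 y : 0 <= nrm2 y.
Proof. by rewrite addr_ge0 ?cmod_ge0. Qed.

(** Regularity bootstrap: the integral of a merely integrable function is continuous, hence bounded,
    so a solution in the integrable sense has a bounded right-hand side. *)
Lemma cbm_integral f (a : C) (y : R -> C) : cintegrable [set` `[0, pi]] f ->
  (forall x, 0 <= x <= pi -> y x = a + P f x) -> cbm y.
Proof.
move=> [rf jf] yE; have p0 := pi_ge0 R.
have bR : bm (fun x => Rintegral mu [set` `[0, x]] (fun s => Re (f s))).
  by apply: bm_continuous; exact: (parameterized_integral_continuous p0 rf).
have bI : bm (fun x => Rintegral mu [set` `[0, x]] (fun s => Im (f s))).
  by apply: bm_continuous; exact: (parameterized_integral_continuous p0 jf).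
split.
  apply: bm_ext (bmD (bm_cst (Re a)) bR) => x xI.
  by rewrite yE // ReD.
apply: bm_ext (bmD (bm_cst (Im a)) bI) => x xI.
by rewrite yE // ImD.
Qed.

Lemma cbm_odeM p q l u : cbm p -> cbm q ->
  cbm (fun x => (u x).1) -> cbm (fun x => (u x).2) ->
  cbm (fun x => (odeM p q l x (u x)).1) /\ cbm (fun x => (odeM p q l x (u x)).2).
Proof.
move=> bp bq b1 b2; split => /=.
  by apply: cbmB; apply: cbmM => //; apply: cbmD => //; exact: cbm_cst.
by apply: cbmB; apply: cbmM => //; apply: cbmB => //; exact: cbm_cst.
Qed.

Lemma is_solP p q l u : cbm p -> cbm q -> is_sol p q l u <-> sol p q l u.
Proof.
move=> bp bq; split.
  move=> [[i1 i2] uE].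
  have u1 x : 0 <= x <= pi -> (u x).1 = (u 0).1 + P (fun s => (odeM p q l s (u s)).1) x.
    by move=> /uE ->.
  have u2 x : 0 <= x <= pi -> (u x).2 = (u 0).2 + P (fun s => (odeM p q l s (u s)).2) x.
    by move=> /uE ->.
  by have [b1 b2] := cbm_odeM l bp bq (cbm_integral i1 u1) (cbm_integral i2 u2).
move=> [[b1 u1] [b2 u2]]; split; first by split; exact: cbm_integrable.
by move=> x xI; rewrite -u1 // -u2 //; case: (u x).
Qed.

Lemma odeM_le p q l K x (y : C2) : cmod (q x) <= K -> cmod (l + p x) <= K ->
  cmod (l - p x) <= K -> cmod (odeM p q l x y).1 <= K * nrm2 y /\ cmod (odeM p q l x y).2 <= K * nrm2 y.
Proof.
move=> qK pK mK; rewrite /nrm2 /= mulrDr; split; rewrite (le_trans (cmodB _ _)) // !cmodM.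
  by apply: lerD; rewrite ler_wpM2r // cmod_ge0.
by apply: lerD; rewrite ler_wpM2r // cmod_ge0.
Qed.

Lemma odeMB p q l x (y z : C2) : odeM p q l x y - odeM p q l x z = odeM p q l x (y - z).
Proof. by rewrite /odeM; congr (_, _) => /=; ring. Qed.

Lemma coef_bnd p q (M : R) : cbm p -> cbm q -> exists2 K, 0 < K & forall l, cmod l <= M ->
  forall x, 0 <= x <= pi -> [/\ cmod (q x) <= K, cmod (l + p x) <= K & cmod (l - p x) <= K].
Proof.
move=> /cbm_bnd[A A0 pA] /cbm_bnd[B B0 qB]; exists (`|M| + A + B + 1).
  by rewrite ltr_wpDl // !addr_ge0.
move=> l lM x xI; have := pA x xI; have := qB x xI; have := ler_norm M; have := normr_ge0 M.
move=> ? ? ? ?; split; [lra| |].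
  by apply: le_trans (cmodD _ _) _; lra.
by apply: le_trans (cmodB _ _) _; lra.
Qed.

(* Picard iteration, contracting for the norm weighted by exp(-8Kx). *)
Lemma sol_exists p q l (y0 : C2) : cbm p -> cbm q -> exists u, u 0 = y0 /\ sol p q l u.
Proof.
move=> bp bq; have [K K0 cK] := coef_bnd (cmod l) bp bq.
have {}cK x := cK l (lexx _) x.
pose A (u : R -> C2) (s : R) := odeM p q l s (u s).
pose T (u : R -> C2) (x : R) : C2 := (y0.1 + P (fun s => (A u s).1) x, y0.2 + P (fun s => (A u s).2) x).
pose y n := iter n T (fun=> y0).
have by_ n : cbm (fun x => (y n x).1) /\ cbm (fun x => (y n x).2).
  elim: n => [|n [b1 b2]]; first by split; exact: cbm_cst.
  have [c1 c2] := cbm_odeM l bp bq b1 b2.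
  by split => /=; apply: cbmD; try exact: cbm_cst; exact: cbm_cint.
have bA n : cbm (fun s => (A (y n) s).1) /\ cbm (fun s => (A (y n) s).2).
  by have [b1 b2] := by_ n; exact: cbm_odeM.
(* Each component of the integral is at most 2 K D / (2 L) = D / 4 times the weight exp(2 L x), so
   the two together contract by 1/2. *)
pose L := 4 * K; have L0 : 0 < L by rewrite mulr_gt0.
have L20 : 0 <= 2 * L by rewrite mulr_ge0 // ltW.
have contract (a b : R -> C2) (D : R) : 0 <= D ->
    cbm (fun x => (a x).1) -> cbm (fun x => (a x).2) ->
    cbm (fun x => (b x).1) -> cbm (fun x => (b x).2) ->
    (forall x, 0 <= x <= pi -> nrm2 (a x - b x) <= D * expR (2 * L * x)) ->
    forall x, 0 <= x <= pi -> nrm2 (T a x - T b x) <= D / 2 * expR (2 * L * x).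
  move=> D0 a1 a2 b1 b2 ab x xI; have [x0 xp] := andP xI.
  have [ca1 ca2] := cbm_odeM l bp bq a1 a2; have [cb1 cb2] := cbm_odeM l bp bq b1 b2.
  have bb : bm (fun s => nrm2 (a s - b s)) by apply: bmD; apply: bm_cmod; exact: cbmB.
  have bA1 (f : R -> C) : cbm f -> (forall s, 0 <= s <= x -> cmod (f s) <= K * nrm2 (a s - b s)) ->
      cmod (P f x) <= D / 4 * expR (2 * L * x).
    move=> bf fK; apply: le_trans (cint_norm_le bf (bmM (bm_cst K) bb) xp fK) _.
    have -> : D / 4 * expR (2 * L * x) = 2 * (K * (D / (2 * L) * expR (2 * L * x))).
      by rewrite /L; field; rewrite gt_eqF.
    rewrite RIZ // ler_pM2l // ler_pM2l //.
    apply: RI_expR_le => //; first by rewrite mulr_gt0.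
    by move=> s /andP[s0 sx]; apply: ab; rewrite s0 (le_trans sx).
  have TE : T a x - T b x = (P (fun s => (A a s).1 - (A b s).1) x, P (fun s => (A a s).2 - (A b s).2) x).
    rewrite (cintB ca1 cb1 xp) (cintB ca2 cb2 xp).
    by rewrite /T; congr (_, _); rewrite /= opprD addrACA subrr add0r.
  have nA s : 0 <= s <= x -> cmod (A a s - A b s).1 <= K * nrm2 (a s - b s) /\
      cmod (A a s - A b s).2 <= K * nrm2 (a s - b s).
    move=> /andP[s0 sx]; have [|q1 q2 q3] := cK s; first by rewrite s0 (le_trans sx).
    by rewrite /A odeMB; exact: odeM_le.
  rewrite TE /nrm2 /=.
  have -> : D / 2 * expR (2 * L * x) = D / 4 * expR (2 * L * x) + D / 4 * expR (2 * L * x) by field.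
  by apply: lerD; apply: bA1; [exact: cbmB|by move=> s /nA[]|exact: cbmB|by move=> s /nA[]].
have [D D0 y1] : exists2 D, 0 <= D & forall x, 0 <= x <= pi -> nrm2 (y 1%N x - y 0%N x) <= D.
  have [b11 b12] := by_ 1%N; have [b01 b02] := by_ 0%N.
  have [D1 D10 h1] := cbm_bnd (cbmB b11 b01); have [D2 D20 h2] := cbm_bnd (cbmB b12 b02).
  by exists (D1 + D2) => [|x xI]; [rewrite addr_ge0|apply: lerD; [exact: h1|exact: h2]].
have E1 x : 0 <= x <= pi -> 1 <= expR (2 * L * x).
  by move=> /andP[x0 _]; rewrite -expR0 ler_expR !mulr_ge0 // ltW.
have step n : forall x, 0 <= x <= pi -> nrm2 (y n.+1 x - y n x) <= D / 2 ^+ n * expR (2 * L * x).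
  elim: n => [|n IH] x xI.
    by rewrite expr0 divr1 (le_trans (y1 _ xI)) // -[leLHS]mulr1 ler_wpM2l // E1.
  have -> : D / 2 ^+ n.+1 = D / 2 ^+ n / 2 by rewrite exprSr invfM mulrA.
  have [b11 b12] := by_ n.+1; have [b01 b02] := by_ n.
  by apply: contract => //; rewrite divr_ge0 // exprn_ge0.
pose E := D * expR (2 * L * pi).
have stepE n x : 0 <= x <= pi -> nrm2 (y n.+1 x - y n x) <= E / 2 ^+ n.
  move=> xI; rewrite (le_trans (step n x xI)) // /E mulrAC ler_wpM2r ?invr_ge0 ?exprn_ge0 //.
  by rewrite ler_wpM2l // ler_expR ler_wpM2l //; case/andP: xI.
have lim x : exists z : C2, 0 <= x <= pi -> forall n, nrm2 (y n x - z) <= 8 * E / 2 ^+ n.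
  have [xI|xI] := boolP (0 <= x <= pi); last by exists 0.
  have [|z1 h1] := @complex_geometric_limit _ (fun n => (y n x).1) E.
    by move=> n; apply: le_trans (stepE n x xI); rewrite /nrm2 lerDl cmod_ge0.
  have [|z2 h2] := @complex_geometric_limit _ (fun n => (y n x).2) E.
    by move=> n; apply: le_trans (stepE n x xI); rewrite /nrm2 lerDr cmod_ge0.
  exists (z1, z2) => _ n; have -> : 8 * E / 2 ^+ n = 4 * E / 2 ^+ n + 4 * E / 2 ^+ n by ring.
  by apply: lerD; [exact: h1|exact: h2].
have [u uy] := @boolp.choice _ _ _ lim.
have b1 : cbm (fun x => (u x).1).
  apply: (@cbm_uniform_limit _ (fun n x => (y n x).1) _ (8 * E)); first by move=> n; case: (by_ n).
  by move=> n x xI; apply: le_trans (uy x xI n); rewrite /nrm2 lerDl cmod_ge0.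
have b2 : cbm (fun x => (u x).2).
  apply: (@cbm_uniform_limit _ (fun n x => (y n x).2) _ (8 * E)); first by move=> n; case: (by_ n).
  by move=> n x xI; apply: le_trans (uy x xI n); rewrite /nrm2 lerDr cmod_ge0.
have fixT x : 0 <= x <= pi -> u x = T u x.
  move=> xI; suff h e : 0 < e -> nrm2 (u x - T u x) <= e.
    have : nrm2 (u x - T u x) <= 0 by apply/ler_addgt0Pr => e e0; rewrite add0r h.
    have := cmod_ge0 (u x - T u x).1; have := cmod_ge0 (u x - T u x).2; rewrite /nrm2 => h1 h2 h3.
    have /eqP : cmod (u x - T u x).1 = 0 by lra.
    have /eqP : cmod (u x - T u x).2 = 0 by lra.
    rewrite !cmod_eq0 /= !subr_eq0 => /eqP e2 /eqP e1.
    by rewrite (surjective_pairing (u x)) e1 e2.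
  move=> e0.
  have EE0 : 0 <= 8 * E by rewrite !mulr_ge0 // expR_ge0.
  have EX n : 0 <= 8 * E / 2 ^+ n by rewrite divr_ge0 // exprn_ge0.
  have [n hn] := half_pow_small (8 * E * (1 + expR (2 * L * pi))) e0.
  apply: le_trans (ltW hn).
  have tri (a b c : C2) : nrm2 (a - b) <= nrm2 (c - a) + nrm2 (c - b).
    rewrite /nrm2 addrACA; apply: lerD.
      by rewrite /= (cmod_distC c.1 a.1) cmod_tri.
    by rewrite /= (cmod_distC c.2 a.2) cmod_tri.
  apply: le_trans (tri _ _ (y n.+1 x)) _.
  have -> : 8 * E * (1 + expR (2 * L * pi)) / 2 ^+ n = 8 * E / 2 ^+ n + 8 * E / 2 ^+ n * expR (2 * L * pi) by ring.
  apply: lerD.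
    apply: le_trans (uy x xI n.+1) _; rewrite ler_wpM2l //.
    by rewrite lef_pV2 ?posrE ?exprn_gt0 // ler_eXn2l // ltr1n.
  have [yn1 yn2] := by_ n.
  have := @contract (y n) u _ (EX n) yn1 yn2 b1 b2 _ x xI.
  move=> /(_ _) h; apply: (le_trans (h _)).
    move=> s sI; apply: (le_trans (uy s sI n)).
    by rewrite -[leLHS]mulr1 ler_wpM2l // E1.
  rewrite -mulrA ler_wpM2l // (@le_trans _ _ (expR (2 * L * x))) //.
    by rewrite ler_piMl ?expR_ge0 // invf_le1 // ler1n.
  by rewrite ler_expR ler_wpM2l //; case/andP: xI.
have z : 0 <= (0 : R) <= pi by rewrite lexx pi_ge0.
have u0 : u 0 = y0 by rewrite fixT // /T !cint0 !addr0; case: (y0).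
exists u; split=> //; have [c1 c2] := cbm_odeM l bp bq b1 b2.
by split; split=> // x xI; rewrite u0 fixT.
Qed.
End Dirac.

(** * Wronskians, and dependence of solutions on the spectral parameter *)

Section Solutions.
Variable R : realType.
Local Notation C := R[i].
Local Notation C2 := (C * C)%type.
Local Notation P f x := (cint [set` `[0, x]] f).
Variables p q : R -> C.
Hypotheses (bp : cbm p) (bq : cbm q).
Implicit Types (u v : R -> C2) (l m : C) (x : R).
Local Notation c := (c_fun p q).
Local Notation s := (s_fun p q).
Local Notation sol := (sol p q).

Definition wr u v x : C := (u x).1 * (v x).2 - (u x).2 * (v x).1.
(** The bilinear pairing, without conjugation: it is this one that appears in the derivative of the
    Wronskian. *)
Definition dt u v x : C := (u x).1 * (v x).1 + (u x).2 * (v x).2.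

Lemma zeroI : 0 <= (0 : R) <= pi. Proof. by rewrite lexx pi_ge0. Qed.
Lemma piI : 0 <= (pi : R) <= pi. Proof. by rewrite lexx pi_ge0. Qed.

Lemma sol_cbm l u : sol l u -> cbm (fun x => (u x).1) /\ cbm (fun x => (u x).2).
Proof. by move=> [h1 h2]; split; [exact: prim_cbm h1|exact: prim_cbm h2]. Qed.

Lemma cbm_dt l m u v : sol l u -> sol m v -> cbm (dt u v).
Proof.
move=> /sol_cbm[u1 u2] /sol_cbm[v1 v2]; by apply: cbmD; exact: cbmM.
Qed.

Lemma dtC u v : dt u v = dt v u.
Proof. by apply/funext => x; rewrite /dt (mulrC (u x).1) (mulrC (u x).2). Qed.

Lemma wr_prim l m u v : sol l u -> sol m v -> prim (wr u v) (fun x => (m - l) * dt u v x).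
Proof.
move=> [u1 u2] [v1 v2]; apply: prim_ext (primB (primM u1 v2) (primM u2 v1)) => x _ //.
by rewrite /odeM /dt /=; ring.
Qed.

(** All dependence on the spectral parameter is extracted from this identity, which turns a
    difference of parameters into an explicit factor of an integral. *)
Lemma lagrange l m u v x : sol l u -> sol m v -> 0 <= x <= pi ->
  wr u v x = wr u v 0 + (m - l) * P (dt u v) x.
Proof.
move=> su sv xI; have [_ ->//] := wr_prim su sv.
by rewrite cintZ //; [exact: cbm_dt su sv|case/andP: xI].
Qed.

Lemma ode_solP l y0 : ode_sol p q l y0 0 = y0 /\ sol l (ode_sol p q l y0).
Proof.
rewrite /ode_sol; have [w [w0 ws]] := sol_exists l y0 bp bq.
have := @epsilon_spec _ (inhabits (@zero2 R)) (fun y => y 0 = y0 /\ is_sol p q l y).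
move=> h; have [|h0 hs] := h; first by exists w; split=> //; apply/is_solP.
by split=> //; apply/is_solP.
Qed.
Lemma c0 l : c l 0 = (1, 0). Proof. by have [] := ode_solP l (1, 0). Qed.
Lemma s0 l : s l 0 = (0, 1). Proof. by have [] := ode_solP l (0, 1). Qed.
Lemma c_sol l : sol l (c l). Proof. by have [] := ode_solP l (1, 0). Qed.
Lemma s_sol l : sol l (s l). Proof. by have [] := ode_solP l (0, 1). Qed.

Lemma wr_cs l x : 0 <= x <= pi -> wr (c l) (s l) x = 1.
Proof.
move=> xI; rewrite (lagrange (c_sol l) (s_sol l) xI) subrr mul0r addr0.
by rewrite /wr c0 s0 /= mulr1 mulr0 subr0.
Qed.

(** Cramer's rule: since [c] and [s] have Wronskian 1, the coordinates of u(x) in that basis are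
    Wronskians with [s] and [c], and Lagrange's identity evaluates them. *)
Lemma sol_expand l m u x : sol m u -> 0 <= x <= pi ->
  let A := (u 0).1 - (m - l) * P (dt u (s l)) x in
  let B := (u 0).2 + (m - l) * P (dt u (c l)) x in
  u x = (A * (c l x).1 + B * (s l x).1, A * (c l x).2 + B * (s l x).2).
Proof.
move=> su xI A B; have W := wr_cs l xI.
have AE : A = wr u (s l) x.
  by rewrite (lagrange su (s_sol l) xI) /wr s0 /A /= mulr1 mulr0 subr0; ring.
have BE : B = - wr u (c l) x.
  by rewrite (lagrange su (c_sol l) xI) /wr c0 /B /= mulr1 mulr0 sub0r; ring.
rewrite AE BE (surjective_pairing (u x)) /wr /=; congr (_, _).
  by rewrite -[LHS]mulr1 -W /wr; ring.
by rewrite -[LHS]mulr1 -W /wr; ring.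
Qed.

Lemma sol_repr l u x : sol l u -> 0 <= x <= pi ->
  u x = ((u 0).1 * (c l x).1 + (u 0).2 * (s l x).1, (u 0).1 * (c l x).2 + (u 0).2 * (s l x).2).
Proof.
by move=> su xI; rewrite (sol_expand l su xI) subrr !mul0r subr0 addr0.
Qed.

(** At equal parameters Wronskians are constant, so the initial vector can be read off at any x;
    this inverts the transfer matrix. *)
Lemma sol_init l u x : sol l u -> 0 <= x <= pi ->
  u 0 = (wr u (s l) x, - wr u (c l) x).
Proof.
move=> su xI; rewrite (lagrange su (s_sol l) xI) (lagrange su (c_sol l) xI).
rewrite /wr s0 c0 /= subrr !mul0r !mulr1 !mulr0 subr0 sub0r !addr0 opprK.
by case: (u 0).
Qed.

Lemma sol_comb l a b u v : sol l u -> sol l v ->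
  sol l (fun x => (a * (u x).1 + b * (v x).1, a * (u x).2 + b * (v x).2)).
Proof.
move=> [u1 u2] [v1 v2]; split.
  by apply: prim_ext (primD (primZ a u1) (primZ b v1)) => x _ //=; ring.
by apply: prim_ext (primD (primZ a u2) (primZ b v2)) => x _ //=; ring.
Qed.

Lemma cmod1_le (y : C2) : cmod y.1 <= nrm2 y. Proof. by rewrite lerDl cmod_ge0. Qed.
Lemma cmod2_le (y : C2) : cmod y.2 <= nrm2 y. Proof. by rewrite lerDr cmod_ge0. Qed.

Lemma sol_bnd (M : R) : exists2 B, 0 < B & forall l, cmod l <= M -> forall u, sol l u ->
  forall x, 0 <= x <= pi -> nrm2 (u x) <= B * nrm2 (u 0).
Proof.
have [K K0 cK] := coef_bnd M bp bq.
exists (2 * expR (2 * (4 * K) * pi)); first by rewrite mulr_gt0 // expR_gt0.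
move=> l lM u su x xI; have [b1 b2] := sol_cbm su; case: (su) => [[d1 e1] [d2 e2]].
have bb : bm (fun x => nrm2 (u x)) by apply: bmD; exact: bm_cmod.
have L0 : 0 < 4 * K by rewrite mulr_gt0.
have := @gronwall R (fun x => nrm2 (u x)) (nrm2 (u 0)) (4 * K) bb (nrm2_ge0 _) L0.
move=> g; apply: le_trans (g _ x xI) _; last first.
  rewrite mulrAC ler_wpM2r ?nrm2_ge0 // ler_wpM2l // ler_expR ler_wpM2l //; last by case/andP: xI.
  by rewrite !mulr_ge0 // ltW.
move=> {x xI} {g} x xI; have [x0 xp] := andP xI.
have odb t : 0 <= t <= x -> cmod (odeM p q l t (u t)).1 <= K * nrm2 (u t) /\
    cmod (odeM p q l t (u t)).2 <= K * nrm2 (u t).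
  by move=> /andP[t0 tx]; have [|q1 q2 q3] := cK l lM t; [rewrite t0 (le_trans tx)|exact: odeM_le].
have int1 : cmod (P (fun t => (odeM p q l t (u t)).1) x) <= 2 * (K * Rintegral (@lebesgue_measure R) [set` `[0, x]] (fun t => nrm2 (u t))).
  rewrite -RIZ //; apply: cint_norm_le => //; first by apply: bmM => //; exact: bm_cst.
  by move=> t /odb[].
have int2 : cmod (P (fun t => (odeM p q l t (u t)).2) x) <= 2 * (K * Rintegral (@lebesgue_measure R) [set` `[0, x]] (fun t => nrm2 (u t))).
  rewrite -RIZ //; apply: cint_norm_le => //; first by apply: bmM => //; exact: bm_cst.
  by move=> t /odb[].
rewrite [in leLHS]/nrm2 (e1 x xI) (e2 x xI).
rewrite (le_trans (lerD (cmodD _ _) (cmodD _ _))) //.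
rewrite [in leRHS]/nrm2; move: int1 int2; set RI := Rintegral _ _ _.
move=> h1 h2; lra.
Qed.

(** From y back to 0 through Wronskians, then forward to x: a solution is controlled by any one of
    its values, which is what lets an L2 norm bound its supremum. *)
Lemma sol_bnd_any (M : R) : exists2 B, 0 < B & forall l, cmod l <= M -> forall u, sol l u ->
  forall x y, 0 <= x <= pi -> 0 <= y <= pi -> nrm2 (u x) <= B * nrm2 (u y).
Proof.
have [B B0 hB] := sol_bnd M; exists (B * (2 * B)); first by rewrite !mulr_gt0.
move=> l lM u su x y xI yI; rewrite (le_trans (hB l lM u su x xI)) //.
rewrite -mulrA ler_pM2l // (sol_init su yI).
have nc : nrm2 (c l y) <= B.
  apply: le_trans (hB l lM _ (c_sol l) y yI) _.
  by rewrite c0 /nrm2 /= cmod1 cmod0 addr0 mulr1.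
have ns : nrm2 (s l y) <= B.
  apply: le_trans (hB l lM _ (s_sol l) y yI) _.
  by rewrite s0 /nrm2 /= cmod1 cmod0 add0r mulr1.
have wb v : nrm2 (v y) <= B -> cmod (wr u v y) <= B * nrm2 (u y).
  move=> vB; rewrite (le_trans (cmodB _ _)) // !cmodM [nrm2 (u y)]/nrm2 mulrDr.
  apply: lerD; rewrite mulrC ler_wpM2r ?cmod_ge0 // (le_trans _ vB) //.
    exact: cmod2_le.
  exact: cmod1_le.
rewrite [leLHS]/nrm2 cmodN -mulrA mulr_natl mulr2n.
by apply: lerD; exact: wb.
Qed.

Lemma cmod_dt u v x : cmod (dt u v x) <= nrm2 (u x) * nrm2 (v x).
Proof.
rewrite (le_trans (cmodD _ _)) // !cmodM /nrm2 mulrDl.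
by apply: lerD; rewrite ler_wpM2l ?cmod_ge0 // ?cmod1_le ?cmod2_le.
Qed.

Lemma cs_bnd (M : R) : exists2 B, 0 < B & forall l, cmod l <= M -> forall x, 0 <= x <= pi ->
  nrm2 (c l x) <= B /\ nrm2 (s l x) <= B.
Proof.
have [B B0 hB] := sol_bnd M; exists B => // l lM x xI; split.
  apply: le_trans (hB l lM _ (c_sol l) x xI) _.
  by rewrite c0 /nrm2 /= cmod1 cmod0 addr0 mulr1.
apply: le_trans (hB l lM _ (s_sol l) x xI) _.
by rewrite s0 /nrm2 /= cmod1 cmod0 add0r mulr1.
Qed.

(** For a common initial value [sol_expand] and [sol_repr] differ only by terms carrying the factor
    m - l. *)
Lemma sol_lip (M : R) : exists2 B, 0 < B & forall l m, cmod l <= M -> cmod m <= M ->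
  forall u v, sol m u -> sol l v -> u 0 = v 0 -> nrm2 (u 0) <= 1 ->
  forall x, 0 <= x <= pi -> nrm2 (u x - v x) <= B * cmod (m - l).
Proof.
have [B B0 hB] := sol_bnd M; have [D D0 hD] := cs_bnd M.
exists (2 * (2 * (B * D) * pi * D)).
  by rewrite !mulr_gt0 // pi_gt0.
move=> l m lM mM u v su sv uv u1 x xI; have [x0 xp] := andP xI.
have uB t : 0 <= t <= pi -> nrm2 (u t) <= B.
  by move=> tI; rewrite (le_trans (hB m mM u su t tI)) // ler_piMr // ltW.
have pb w : sol l w -> (forall t, 0 <= t <= pi -> nrm2 (w t) <= D) ->
    cmod (P (dt u w) x) <= 2 * (B * D) * pi.
  move=> sw wD; apply: cint_bnd => //; first exact: cbm_dt su sw.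
  move=> t tI; rewrite (le_trans (cmod_dt _ _ _)) // ler_pM ?nrm2_ge0 ?uB ?wD //.
have pbs : cmod (P (dt u (s l)) x) <= 2 * (B * D) * pi.
  by apply: pb; [exact: s_sol|move=> t tI; case: (hD l lM t tI)].
have pbc : cmod (P (dt u (c l)) x) <= 2 * (B * D) * pi.
  by apply: pb; [exact: c_sol|move=> t tI; case: (hD l lM t tI)].
have [hc hs] := hD l lM x xI.
have ->: u x - v x = ((m - l) * (P (dt u (c l)) x * (s l x).1 - P (dt u (s l)) x * (c l x).1),
      (m - l) * (P (dt u (c l)) x * (s l x).2 - P (dt u (s l)) x * (c l x).2)).
  by rewrite (sol_expand l su xI) (sol_repr sv xI) -uv; congr (_, _) => /=; ring.
rewrite /nrm2 /= !cmodM -mulrDr mulrC ler_wpM2r ?cmod_ge0 //.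
rewrite (le_trans (lerD (cmodB _ _) (cmodB _ _))) // !cmodM.
set W := 2 * (B * D) * pi in pbs pbc *.
have W0 : 0 <= W := le_trans (cmod_ge0 _) pbs.
have {}hc : W * nrm2 (c l x) <= W * D by rewrite ler_wpM2l.
have {}hs : W * nrm2 (s l x) <= W * D by rewrite ler_wpM2l.
have kc a := ler_wpM2r (cmod_ge0 a) pbc.
have ks a := ler_wpM2r (cmod_ge0 a) pbs.
have -> : 2 * (W * D) = W * D + W * D by ring.
apply: le_trans (lerD hc hs).
rewrite /nrm2 !mulrDr.
have := kc (s l x).1; have := kc (s l x).2; have := ks (c l x).1; have := ks (c l x).2.
lra.
Qed.
End Solutions.

(** * Symmetries of the system *)

Section Symmetries.
Variable R : realType.
Local Notation C := R[i].
Implicit Types (p q : R -> C) (u : R -> C * C) (l : C).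

Lemma prim_conj (f g : R -> C) : prim f g -> prim (fun x => cconj (f x)) (fun x => cconj (g x)).
Proof.
move=> [bg fg]; split; first exact: cbm_conj.
by move=> x xI; rewrite fg // cconjD cint_conj //; case/andP: xI.
Qed.

Lemma sol_conj p q l u : sol p q l u ->
  sol (pconj p) (pconj q) (cconj l) (fun x => (cconj (u x).1, cconj (u x).2)).
Proof.
move=> [/prim_conj u1 /prim_conj u2]; split.
  by apply: prim_ext u1 => // x _; rewrite /= /pconj cconjB !cconjM cconjD.
by apply: prim_ext u2 => // x _; rewrite /= /pconj cconjB !cconjM cconjB.
Qed.

Lemma pconjK p : pconj (pconj p) = p.
Proof. by apply/funext => x; rewrite /pconj cconjK. Qed.

(** Exchanges the upper and lower half-planes of the spectral parameter, so that asymptotics have to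
    be computed in only one of them. *)
Lemma sol_flip p q l u : sol p q l u ->
  sol (fun x => - p x) q (- l) (fun x => ((u x).1, - (u x).2)).
Proof.
move=> [u1 u2]; split; first by apply: prim_ext u1 => // x _ /=; ring.
apply: prim_ext (primZ (-1) u2) => x _ /=; first by rewrite mulN1r.
by ring.
Qed.
End Symmetries.

(** * The discriminant F and its derivative G *)

Section Projection.
Variable R : realType.
Local Notation C := R[i].
Local Notation C2 := (C * C)%type.
Local Notation P f x := (cint [set` `[0, x]] f).
Variables p q : R -> C.
Hypotheses (bp : cbm p) (bq : cbm q).
Implicit Types (u v w : R -> C2) (l m : C) (x : R).
Local Notation c := (c_fun p q).
Local Notation s := (s_fun p q).
Local Notation sol := (sol p q).
Local Notation F := (Fdisc p q).
Local Notation pr u v := (P (dt u v) pi).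

(** Lipschitz on every disc: stands in for analytic dependence on the spectral parameter, and is
    stable under sums and products. *)
Definition loclip (Phi : C -> C) := forall M : R, exists2 B, 0 <= B &
  forall l m, cmod l <= M -> cmod m <= M -> cmod (Phi m - Phi l) <= B * cmod (m - l).

Lemma loclip_cst (a : C) : loclip (fun=> a).
Proof. by move=> M; exists 0 => // l m _ _; rewrite subrr cmod0 mul0r. Qed.
Lemma loclip_bnd Phi : loclip Phi -> forall M : R, exists2 B, 0 <= B & forall l, cmod l <= M -> cmod (Phi l) <= B.
Proof.
move=> h M; have [B B0 hB] := h `|M|; exists (B * `|M| + cmod (Phi 0)).
  by rewrite addr_ge0 ?cmod_ge0 // mulr_ge0.
move=> l lM; have lM' : cmod l <= `|M| by rewrite (le_trans lM) // ler_norm.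
rewrite -{1}(subrK (Phi 0) (Phi l)) (le_trans (cmodD _ _)) // lerD2r.
rewrite (le_trans (hB 0 l _ _)) ?cmod0 // subr0 ler_wpM2l //.
Qed.
Lemma loclipD Phi Psi : loclip Phi -> loclip Psi -> loclip (fun l => Phi l + Psi l).
Proof.
move=> h k M; have [A A0 hA] := h M; have [B B0 hB] := k M.
exists (A + B) => [|l m lM mM]; first by rewrite addr_ge0.
by rewrite opprD addrACA mulrDl (le_trans (cmodD _ _)) // lerD ?hA ?hB.
Qed.
Lemma loclipM Phi Psi : loclip Phi -> loclip Psi -> loclip (fun l => Phi l * Psi l).
Proof.
move=> h k M; have [A A0 hA] := h M; have [B B0 hB] := k M.
have [D D0 hD] := loclip_bnd h M; have [E E0 hE] := loclip_bnd k M.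
exists (A * E + D * B) => [|l m lM mM]; first by rewrite addr_ge0 // mulr_ge0.
have -> : Phi m * Psi m - Phi l * Psi l = (Phi m - Phi l) * Psi m + Phi l * (Psi m - Psi l) by ring.
rewrite (le_trans (cmodD _ _)) // !cmodM mulrDl; apply: lerD.
  by rewrite mulrAC ler_pM ?cmod_ge0 ?hA ?hE.
by rewrite -mulrA ler_pM ?cmod_ge0 ?hB ?hD.
Qed.
Lemma loclipN Phi : loclip Phi -> loclip (fun l => - Phi l).
Proof.
move=> h; have := loclipM (loclip_cst (-1)) h.
by under [X in loclip X -> _]eq_fun do rewrite mulN1r.
Qed.

(** Solutions sharing one initial value for all l; the bound on that value matches the normalisation
    in [sol_lip]. *)
Definition family (u : C -> R -> C2) (y0 : C2) :=
  nrm2 y0 <= 1 /\ forall l, u l 0 = y0 /\ sol l (u l).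

Lemma c_family : family c (1, 0).
Proof.
split; first by rewrite /nrm2 /= cmod1 cmod0 addr0.
by move=> l; split; [exact: c0|exact: c_sol].
Qed.
Lemma s_family : family s (0, 1).
Proof.
split; first by rewrite /nrm2 /= cmod1 cmod0 add0r.
by move=> l; split; [exact: s0|exact: s_sol].
Qed.

Lemma family_lip (u : C -> R -> C2) y0 (M : R) : family u y0 -> exists2 B, 0 < B & forall l m,
  cmod l <= M -> cmod m <= M -> forall x, 0 <= x <= pi -> nrm2 (u m x - u l x) <= B * cmod (m - l).
Proof.
move=> [y1 fu]; have [B B0 hB] := sol_lip bp bq M; exists B => // l m lM mM x xI.
have [ul sl] := fu l; have [um sm] := fu m.
by apply: hB => //; rewrite ?um ?ul.
Qed.
Lemma family_bnd (u : C -> R -> C2) y0 (M : R) : family u y0 -> exists2 B, 0 < B & forall l,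
  cmod l <= M -> forall x, 0 <= x <= pi -> nrm2 (u l x) <= B.
Proof.
move=> [y1 fu]; have [B B0 hB] := sol_bnd bp bq M; exists B => // l lM x xI.
have [ul sl] := fu l.
by rewrite (le_trans (hB l lM _ sl x xI)) // ul ler_piMr // ltW.
Qed.
Lemma loclip_val1 (u : C -> R -> C2) y0 x : family u y0 -> 0 <= x <= pi -> loclip (fun l => (u l x).1).
Proof.
move=> fu xI M; have [B B0 hB] := family_lip M fu; exists B; first exact: ltW.
by move=> l m lM mM; apply: le_trans (hB l m lM mM x xI); exact: (cmod1_le (_ - _)).
Qed.
Lemma loclip_val2 (u : C -> R -> C2) y0 x : family u y0 -> 0 <= x <= pi -> loclip (fun l => (u l x).2).
Proof.
move=> fu xI M; have [B B0 hB] := family_lip M fu; exists B; first exact: ltW.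
by move=> l m lM mM; apply: le_trans (hB l m lM mM x xI); exact: (cmod2_le (_ - _)).
Qed.

Definition cbm2 w := cbm (fun x => (w x).1) /\ cbm (fun x => (w x).2).
Lemma cbm2_dt u v : cbm2 u -> cbm2 v -> cbm (dt u v).
Proof. by move=> [u1 u2] [v1 v2]; apply: cbmD; exact: cbmM. Qed.
Lemma family_cbm2 (u : C -> R -> C2) y0 l : family u y0 -> cbm2 (u l).
Proof. by move=> [_ /(_ l)[_ /sol_cbm[]]]. Qed.

Lemma pair_lip (u : C -> R -> C2) y0 (M D : R) : family u y0 -> 0 <= D -> exists2 B, 0 <= B & forall l m,
  cmod l <= M -> cmod m <= M -> forall w, cbm2 w -> (forall x, 0 <= x <= pi -> nrm2 (w x) <= D) ->
  cmod (pr (u m) w - pr (u l) w) <= B * cmod (m - l).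
Proof.
move=> fu D0; have [B B0 hB] := family_lip M fu; exists (2 * (B * D) * pi).
  by rewrite !mulr_ge0 ?pi_ge0 // ltW.
move=> l m lM mM w bw wD; have um := family_cbm2 m fu; have ul := family_cbm2 l fu.
rewrite -cintB //; try exact: cbm2_dt.
rewrite (@cint_eq _ _ (dt (fun x => u m x - u l x) w)); last first.
  by move=> t _; rewrite /dt /=; ring.
have -> : 2 * (B * D) * pi * cmod (m - l) = 2 * (B * cmod (m - l) * D) * pi by ring.
apply: cint_bnd; rewrite ?pi_ge0 //.
  by apply: cbm2_dt => //; case: um ul => [? ?] [? ?]; split; exact: cbmB.
move=> t tI; rewrite (le_trans (cmod_dt _ _ _)) // ler_pM ?nrm2_ge0 ?wD // hB //.
Qed.

Lemma loclip_pair (u : C -> R -> C2) y0 w : family u y0 -> cbm2 w -> loclip (fun l => pr (u l) w).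
Proof.
move=> fu bw M; case: (bw) => [/cbm_bnd[D1 D10 h1] /cbm_bnd[D2 D20 h2]].
have [B B0 hB] := pair_lip M fu (addr_ge0 D10 D20); exists B => // l m lM mM.
by apply: hB => // x xI; apply: lerD; [exact: h1|exact: h2].
Qed.
Lemma loclip_pair2 (u v : C -> R -> C2) y0 z0 : family u y0 -> family v z0 -> loclip (fun l => pr (u l) (v l)).
Proof.
move=> fu fv M; have [Du Du0 hu] := family_bnd M fu; have [Dv Dv0 hv] := family_bnd M fv.
have [A A0 hA] := pair_lip M fu (ltW Dv0); have [B B0 hB] := pair_lip M fv (ltW Du0).
exists (A + B) => [|l m lM mM]; first by rewrite addr_ge0.
have -> : pr (u m) (v m) - pr (u l) (v l) =
   (pr (u m) (v m) - pr (u l) (v m)) + (pr (v m) (u l) - pr (v l) (u l)).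
  by rewrite (dtC (v m)) (dtC (v l)); ring.
rewrite mulrDl (le_trans (cmodD _ _)) //; apply: lerD.
  by apply: hA => // [|x xI]; [exact: family_cbm2 fv|exact: hv].
by apply: hB => // [|x xI]; [exact: family_cbm2 fu|exact: hu].
Qed.

Local Notation c1 l := (c l pi).1.
Local Notation c2 l := (c l pi).2.
Local Notation s1 l := (s l pi).1.
Local Notation s2 l := (s l pi).2.

(** The derivative of F, obtained from the difference quotient in [Fdisc_diff] by letting m = l. *)
Definition G l : C :=
  - (c1 l * pr (c l) (s l)) + s1 l * pr (c l) (c l) - c2 l * pr (s l) (s l) + s2 l * pr (c l) (s l).

Lemma Fdisc_diff l m : F m - F l = (m - l) *
  (- (c1 l * pr (c m) (s l)) + s1 l * pr (c m) (c l) - c2 l * pr (s m) (s l) + s2 l * pr (s m) (c l)).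
Proof.
have pI := piI R; rewrite /Fdisc.
rewrite [c m pi](sol_expand bp bq l (c_sol bp bq m) pI) [s m pi](sol_expand bp bq l (s_sol bp bq m) pI).
by rewrite c0 // s0 //=; ring.
Qed.

Lemma loclip_F : loclip F.
Proof.
by apply: loclipD; [exact: loclip_val1 c_family (piI R)|exact: loclip_val2 s_family (piI R)].
Qed.

Lemma loclip_G : loclip G.
Proof.
have lc1 := loclip_val1 c_family (piI R); have lc2 := loclip_val2 c_family (piI R).
have ls1 := loclip_val1 s_family (piI R); have ls2 := loclip_val2 s_family (piI R).
have cs := loclip_pair2 c_family s_family; have cc := loclip_pair2 c_family c_family.
have ss := loclip_pair2 s_family s_family.
apply: loclipD; [apply: loclipD; [apply: loclipD|]|].
- by apply: loclipN; exact: loclipM.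
- exact: loclipM.
- by apply: loclipN; exact: loclipM.
- exact: loclipM.
Qed.

(** Each pairing in [Fdisc_diff] moves by O(|m - l|) when m is replaced by l, so the remainder is
    quadratic. This is the form in which F' = G is used. *)
Lemma Fdisc_taylor2 (M : R) : exists2 B, 0 <= B & forall l m, cmod l <= M -> cmod m <= M ->
  cmod (F m - F l - (m - l) * G l) <= B * cmod (m - l) ^+ 2.
Proof.
have [Dc Dc0 hc] := family_bnd M c_family; have [Ds Ds0 hs] := family_bnd M s_family.
have D0 : 0 <= Dc + Ds by rewrite addr_ge0 // ltW.
have [A A0 hA] := pair_lip M c_family D0; have [B B0 hB] := pair_lip M s_family D0.
exists ((Dc + Ds) * (A + A + B + B)) => [|l m lM mM]; first by rewrite mulr_ge0 // !addr_ge0.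
have bc x : 0 <= x <= pi -> nrm2 (c l x) <= Dc + Ds.
  by move=> /(hc l lM)/le_trans; apply; rewrite lerDl ltW.
have bs x : 0 <= x <= pi -> nrm2 (s l x) <= Dc + Ds.
  by move=> /(hs l lM)/le_trans; apply; rewrite lerDr ltW.
have cc := family_cbm2 l c_family; have cs := family_cbm2 l s_family.
have k1 := hA l m lM mM _ cs bs; have k2 := hA l m lM mM _ cc bc.
have k3 := hB l m lM mM _ cs bs; have k4 := hB l m lM mM _ cc bc.
have -> : F m - F l - (m - l) * G l = (m - l) * (- (c1 l * (pr (c m) (s l) - pr (c l) (s l))) +
   s1 l * (pr (c m) (c l) - pr (c l) (c l)) - c2 l * (pr (s m) (s l) - pr (s l) (s l)) +
   s2 l * (pr (s m) (c l) - pr (s l) (c l))).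
  rewrite (Fdisc_diff l m) /G (dtC (s l) (c l)).
  move: (pr (c m) (s l)) (pr (c m) (c l)) (pr (s m) (s l)) (pr (s m) (c l)) (pr (c l) (s l))
    (pr (c l) (c l)) (pr (s l) (s l)) (c1 l) (c2 l) (s1 l) (s2 l) => *; ring.
have nc1 : cmod (c1 l) <= Dc + Ds := le_trans (cmod1_le _) (bc _ (piI R)).
have nc2 : cmod (c2 l) <= Dc + Ds := le_trans (cmod2_le _) (bc _ (piI R)).
have ns1 : cmod (s1 l) <= Dc + Ds := le_trans (cmod1_le _) (bs _ (piI R)).
have ns2 : cmod (s2 l) <= Dc + Ds := le_trans (cmod2_le _) (bs _ (piI R)).
have four (a b e f : C) : cmod (- a + b - e + f) <= cmod a + cmod b + cmod e + cmod f.
  rewrite (le_trans (cmodD _ _)) // lerD2r (le_trans (cmodB _ _)) // lerD2r.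
  by rewrite (le_trans (cmodD _ _)) // cmodN.
rewrite cmodM; set d := cmod (m - l) in k1 k2 k3 k4 *.
have -> : (Dc + Ds) * (A + A + B + B) * d ^+ 2 = d * ((Dc + Ds) * (A * d) + (Dc + Ds) * (A * d) +
  (Dc + Ds) * (B * d) + (Dc + Ds) * (B * d)) by ring.
rewrite ler_wpM2l ?cmod_ge0 // (le_trans (four _ _ _ _)) // !cmodM.
by do 3?[apply: lerD]; rewrite ler_pM ?cmod_ge0.
Qed.

End Projection.

(** * Eigenvectors of 2x2 matrices of determinant one *)

Section TwoByTwo.
Variable K : fieldType.

(** The vectors (m12, r - m11) and (r - m22, m21) both solve the equations; if both vanish the
    matrix is r times the identity and (1, 0) works. *)
Lemma eigenvector2 (m11 m12 m21 m22 r r' : K) : m11 + m22 = r + r' -> m11 * m22 - m12 * m21 = 1 ->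
  r * r' = 1 -> exists a b, (a, b) != (0, 0) /\ m11 * a + m12 * b = r * a /\ m21 * a + m22 * b = r * b.
Proof.
move=> tr dd rr.
have key : (m11 - r) * (m22 - r) = m12 * m21.
  have -> : (m11 - r) * (m22 - r) = (m11 * m22 - m12 * m21) + m12 * m21 - r * (m11 + m22) + r * r by ring.
  by rewrite tr dd -rr; ring.
have [z1|z1] := eqVneq (m12, r - m11) (0, 0); last first.
  exists m12, (r - m11); split=> //; split; first by ring.
  by rewrite mulrC -key; ring.
have [z2|z2] := eqVneq (r - m22, m21) (0, 0); last first.
  exists (r - m22), m21; split=> //; split; last by ring.
  by rewrite -key; ring.
case: z1 => z11 z12; case: z2 => z21 z22; exists 1, 0; split.
  by rewrite xpair_eqE oner_eq0.
have /eqP : r - m11 = 0 by []. rewrite subr_eq0 => /eqP ->.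
by rewrite z22; split; ring.
Qed.

(* The spectral projection of a 2x2 matrix with distinct eigenvalues has rank one. *)
Lemma rank_one_factor (m11 m12 m21 m22 r r' a b g d : K) : m11 + m22 = r + r' ->
  m11 * m22 - m12 * m21 = 1 -> r * r' = 1 -> r != r' ->
  (a, b) != (0, 0) -> m11 * a + m12 * b = r * a -> m21 * a + m22 * b = r * b ->
  (g, d) != (0, 0) -> m11 * g + m12 * d = r' * g -> m21 * g + m22 * d = r' * d ->
  exists2 k, k != 0 & [/\ m11 - r' = k * a * d, m12 = - (k * a * g), m21 = k * b * d & m22 - r' = - (k * b * g)].
Proof.
move=> tr dd rr nrr ab ea eb gd eg ed.
(* A row annihilated by the nonzero vector (g, d) is a multiple of (d, -g). *)
have row (x y : K) : x * g + y * d = 0 -> exists k, x = k * d /\ y = - (k * g).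
  move=> e; have [g0|g0] := eqVneq g 0.
    have d0 : d != 0 by move: gd; rewrite g0 xpair_eqE eqxx.
    exists (x / d); split; first by rewrite divfK.
    move: e; rewrite g0 !mulr0 add0r oppr0 => /eqP; by rewrite mulf_eq0 (negbTE d0) orbF => /eqP.
  exists (- (y / g)); split; last by rewrite mulNr opprK divfK.
  apply: (mulIf g0); rewrite mulNr mulrAC mulNr divfK //.
  by apply/eqP; rewrite -addr_eq0 e.
have [|k1 [e11 e12]] := row (m11 - r') m12; first by rewrite mulrBl addrAC eg subrr.
have [|k2 [e21 e22]] := row m21 (m22 - r'); first by rewrite mulrBl addrA ed subrr.
have scal : ~ (m11 = r /\ m12 = 0 /\ m21 = 0 /\ m22 = r).
  move=> [h1 [_ [_ h2]]]; case/negP: nrr; move: tr; rewrite h1 h2 => /addrI ->; exact: eqxx.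
have scal' : ~ (m11 = r' /\ m12 = 0 /\ m21 = 0 /\ m22 = r').
  move=> [h1 [_ [_ h2]]]; case/negP: nrr; move: tr; rewrite h1 h2 => /addIr ->; exact: eqxx.
have gd0 (x : K) : x * d = 0 -> x * g = 0 -> x = 0.
  move=> /eqP; rewrite mulf_eq0 => /orP[/eqP//|/eqP d0] /eqP; rewrite mulf_eq0 => /orP[/eqP//|/eqP g0].
  by move: gd; rewrite g0 d0 eqxx.
(* Cayley-Hamilton, (M - r)(M - r') = 0: the column factor (k1, k2) of M - r' is annihilated by M -
   r. *)
have A1 : (m11 - r) * k1 + m12 * k2 = 0.
  apply: gd0.
    have -> : ((m11 - r) * k1 + m12 * k2) * d = (m11 - r) * (k1 * d) + m12 * (k2 * d) by ring.
    rewrite -e11 -e21.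
    have -> : (m11 - r) * (m11 - r') + m12 * m21 = m11 * m11 - m11 * (r + r') + r * r' + m12 * m21 by ring.
    by rewrite -tr rr -dd; ring.
  have -> : ((m11 - r) * k1 + m12 * k2) * g = - ((m11 - r) * (- (k1 * g)) + m12 * (- (k2 * g))) by ring.
  rewrite -e12 -e22.
  have -> : - ((m11 - r) * m12 + m12 * (m22 - r')) = m12 * ((r + r') - (m11 + m22)) by ring.
  by rewrite tr subrr mulr0.
have A2 : m21 * k1 + (m22 - r) * k2 = 0.
  apply: gd0.
    have -> : (m21 * k1 + (m22 - r) * k2) * d = m21 * (k1 * d) + (m22 - r) * (k2 * d) by ring.
    rewrite -e11 -e21.
    have -> : m21 * (m11 - r') + (m22 - r) * m21 = m21 * ((m11 + m22) - (r + r')) by ring.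
    by rewrite tr subrr mulr0.
  have -> : (m21 * k1 + (m22 - r) * k2) * g = - (m21 * (- (k1 * g)) + (m22 - r) * (- (k2 * g))) by ring.
  rewrite -e12 -e22.
  have -> : - (m21 * m12 + (m22 - r) * (m22 - r')) = - (m22 * m22 - m22 * (r + r') + r * r' + m12 * m21) by ring.
  by rewrite -tr rr -dd; ring.
have ea' : (m11 - r) * a + m12 * b = 0 by rewrite mulrBl addrAC ea subrr.
have eb' : m21 * a + (m22 - r) * b = 0 by rewrite mulrBl addrA eb subrr.
(* Two independent vectors in the kernel of M - r would force M = r, whose trace is not r + r'. *)
have W : k1 * b - k2 * a = 0.
  apply/eqP/negPn/negP => W0; apply: scal.
  have z (x : K) : x * (k1 * b - k2 * a) = 0 -> x = 0.
    by move=> /eqP; rewrite mulf_eq0 (negbTE W0) orbF => /eqP.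
  have w1 : m11 - r = 0.
    apply: z; rewrite -[RHS](mul0r b) -A1 -[LHS]addr0 -(mul0r k2) -ea'; ring.
  have w2 : m12 = 0.
    apply: z; rewrite -[RHS](mul0r k1) -ea' -[LHS]addr0 -(mul0r a) -A1; ring.
  have w3 : m21 = 0.
    apply: z; rewrite -[RHS](mul0r b) -A2 -[LHS]addr0 -(mul0r k2) -eb'; ring.
  have w4 : m22 - r = 0.
    apply: z; rewrite -[RHS](mul0r k1) -eb' -[LHS]addr0 -(mul0r a) -A2; ring.
  by split; [exact/subr0_eq|split=> //; split=> //; exact/subr0_eq].
have [k [ka kb]] : exists k, k1 = k * a /\ k2 = k * b.
  have [a0|a0] := eqVneq a 0.
    have b0 : b != 0 by move: ab; rewrite a0 xpair_eqE eqxx.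
    exists (k2 / b); rewrite divfK //; split=> //.
    move: W; rewrite a0 !mulr0 subr0 => /eqP; by rewrite mulf_eq0 (negbTE b0) orbF => /eqP.
  exists (k1 / a); rewrite divfK //; split=> //.
  by apply: (mulIf a0); rewrite mulrAC divfK // -(subr0_eq W).
exists k; last by rewrite -ka -kb.
apply/eqP => k0; apply: scal'; move: e11 e12 e21 e22; rewrite ka kb k0 !mul0r oppr0.
by move=> /subr0_eq -> -> -> /subr0_eq ->.
Qed.
End TwoByTwo.

(** * Eigenfunctions as eigenvectors of the monodromy matrix *)

Section Riesz.
Variable R : realType.
Local Notation C := R[i].
Local Notation C2 := (C * C)%type.
Local Notation P f x := (cint [set` `[0, x]] f).
Variables p q : R -> C.
Hypotheses (bp : cbm p) (bq : cbm q).
Implicit Types (u v w g : R -> C2) (l m t : C) (x : R).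
Local Notation c := (c_fun p q).
Local Notation s := (s_fun p q).
Local Notation F := (Fdisc p q).
Local Notation pr u v := (P (dt u v) pi).
Local Notation c1 l := (c l pi).1.
Local Notation c2 l := (c l pi).2.
Local Notation s1 l := (s l pi).1.
Local Notation s2 l := (s l pi).2.

(** The Floquet multiplier; when l is an eigenvalue of L_t, this number and its inverse [mult (- t)]
    are the eigenvalues of the monodromy matrix, which has determinant 1. *)
Definition mult t : C := cexp (ci R * piC R * t).

Lemma multN t : mult t * mult (- t) = 1.
Proof. by rewrite /mult mulrN mulrC cexpN. Qed.

Lemma char_eqE t l : char_eq p q t l <-> F l = mult t + mult (- t).
Proof.
rewrite /char_eq /ccos /mult mulrN -mulrA.
rewrite mulrC divfK //; by rewrite pnatr_eq0.
Qed.

Lemma char_eqN t l : char_eq p q t l -> char_eq p q (- t) l.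
Proof. by rewrite !char_eqE opprK addrC. Qed.

Lemma det_cs l : c1 l * s2 l - s1 l * c2 l = 1.
Proof. by rewrite (mulrC (s1 l)); exact: (wr_cs bp bq l (piI R)). Qed.

(** The quasi-periodic condition makes the initial vector an eigenvector of the monodromy matrix; it
    is nonzero because the zero vector only starts the zero solution. *)
Lemma eigfun_init t l y : eigfun p q t l y ->
  [/\ y 0 != (0, 0), c1 l * (y 0).1 + s1 l * (y 0).2 = mult t * (y 0).1 &
    c2 l * (y 0).1 + s2 l * (y 0).2 = mult t * (y 0).2].
Proof.
move=> [/(is_solP _ _ bp bq) sy ypi [x xI yx]].
have ypi' := sol_repr bp bq sy (piI R); rewrite ypi in ypi'; case: ypi' => e1 e2.
split; [|by rewrite [RHS]e1; ring|by rewrite [RHS]e2; ring].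
apply/eqP => y0; case/negP: yx; rewrite (sol_repr bp bq sy xI) y0 /=.
by rewrite !mul0r !addr0.
Qed.

Lemma eigfun_exists t l : char_eq p q t l -> exists y, eigfun p q t l y.
Proof.
move=> /char_eqE tr.
have [a [b [ab [ea eb]]]] := eigenvector2 tr (det_cs l) (multN t).
exists (fun x => (a * (c l x).1 + b * (s l x).1, a * (c l x).2 + b * (s l x).2)).
have E0 : (a * (c l 0).1 + b * (s l 0).1, a * (c l 0).2 + b * (s l 0).2) = (a, b).
  by rewrite c0 // s0 //=; congr (_, _); ring.
split.
- by apply/is_solP => //; apply: sol_comb; [exact: c_sol|exact: s_sol].
- rewrite E0 /=; congr (_, _); first by rewrite -[RHS]ea; ring.
  by rewrite -[RHS]eb; ring.
- by exists 0; rewrite ?lexx ?pi_ge0 // E0.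
Qed.

Lemma PsiP t l : char_eq p q t l -> eigfun p q t l (Psi p q t l).
Proof. by move=> /eigfun_exists h; exact: epsilon_spec h. Qed.

Lemma cconj_eq0 (z : C) : (cconj z == 0) = (z == 0).
Proof. by rewrite -!cmod_eq0 cmod_conj. Qed.

Lemma cconjN (z : C) : cconj (- z) = - cconj z.
Proof. by case: z. Qed.

Lemma mult_conj t : cconj (mult t) = mult (- cconj t).
Proof.
rewrite /mult -cexp_conj; congr cexp.
by apply: complex_ext; rewrite /= ?ReE /= ?ReE /=; ring.
Qed.
End Riesz.

(** * The kernel of the Riesz projection *)

Section RieszFormula.
Variable R : realType.
Local Notation C := R[i].
Local Notation C2 := (C * C)%type.
Local Notation P f x := (cint [set` `[0, x]] f).
Implicit Types (p q : R -> C) (u v w g : R -> C2) (l m t : C) (x : R).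
Local Notation pr u v := (P (dt u v) pi).

Lemma cbm_pconj p : cbm p -> cbm (pconj p).
Proof. exact: cbm_conj. Qed.

Definition conj2 u : R -> C2 := fun x => (cconj (u x).1, cconj (u x).2).

Lemma eigfun_conj p q t l y : cbm p -> cbm q -> eigfun p q t l y ->
  eigfun (pconj p) (pconj q) (- cconj t) (cconj l) (conj2 y).
Proof.
move=> bp bq [sy ypi [x xI yx]]; split.
- apply/is_solP; [exact: cbm_pconj|exact: cbm_pconj|apply: sol_conj; exact/is_solP].
- by rewrite /conj2 ypi -/(mult _) -/(mult (- cconj t)) -mult_conj !cconjM.
- exists x => //; apply: contra yx; rewrite /conj2 !xpair_eqE !cconj_eq0 => /andP[/eqP e1 /eqP e2].
  by rewrite (surjective_pairing (y x)) e1 e2.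
Qed.

Lemma PsiSP p q t l : cbm p -> cbm q -> char_eq p q t l ->
  eigfun (pconj p) (pconj q) (cconj t) (cconj l) (PsiS p q t l).
Proof.
move=> bp bq /char_eqN h; apply: epsilon_spec.
have [y /(eigfun_conj bp bq)] := eigfun_exists bp bq h.
by rewrite cconjN opprK; exists (conj2 y).
Qed.

(** Conjugation brings the adjoint eigenfunction back to the same equation with the inverse
    multiplier, so Hermitian products with it become bilinear pairings of solutions at one
    parameter. *)
Lemma PsiS_conj p q t l : cbm p -> cbm q -> char_eq p q t l ->
  eigfun p q (- t) l (conj2 (PsiS p q t l)).
Proof.
move=> bp bq h; have := eigfun_conj (cbm_pconj bp) (cbm_pconj bq) (PsiSP bp bq h).
by rewrite !cconjK !pconjK.
Qed.

Lemma pr_comb p q l u v g : cbm p -> cbm q -> cbm2 g -> sol p q l v ->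
  pr g v = (v 0).1 * pr g (c_fun p q l) + (v 0).2 * pr g (s_fun p q l).
Proof.
move=> bp bq bg sv; have cc := sol_cbm (c_sol bp bq l); have cs := sol_cbm (s_sol bp bq l).
rewrite -!cintZ //; try exact: cbm2_dt.
rewrite -cintD //; try by [apply: cbmZ; exact: cbm2_dt].
by apply: cint_eq => x xI; rewrite /dt (sol_repr bp bq sv xI) /=; ring.
Qed.

Variables p q : R -> C.
Hypotheses (bp : cbm p) (bq : cbm q).
Local Notation c := (c_fun p q).
Local Notation s := (s_fun p q).
Local Notation c1 l := (c l pi).1.
Local Notation c2 l := (c l pi).2.
Local Notation s1 l := (s l pi).1.
Local Notation s2 l := (s l pi).2.

(** With a, b the initial values of the eigenfunction and v the conjugated adjoint one, [rnum1] and
    [rnum2] are k a (g, v) and k b (g, v), rewritten through the entries of the monodromy matrix. *)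
Definition rnum1 t l g : C := - (s1 l * pr g (c l)) + (c1 l - mult (- t)) * pr g (s l).
Definition rnum2 t l g : C := - ((s2 l - mult (- t)) * pr g (c l)) + c2 l * pr g (s l).

(** Multiplying both pairings of the quotient by the constant k of [rank_one_factor] turns them into
    expressions in the monodromy matrix, so the chosen eigenfunctions and their scaling disappear.
    Distinct multipliers make that factorisation available. *)
Lemma riesz_formula t l g x : char_eq p q t l -> mult t != mult (- t) -> cbm2 g -> 0 <= x <= pi ->
  riesz p q t l g x =
    (- (((c l x).1 * rnum1 t l g + (s l x).1 * rnum2 t l g) / G p q l),
     - (((c l x).2 * rnum1 t l g + (s l x).2 * rnum2 t l g) / G p q l)).
Proof.
move=> ch mm bg xI; have ePsi := PsiP bp bq ch; have eS := PsiS_conj bp bq ch.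
rewrite /riesz; set u := Psi p q t l in ePsi *; set v := conj2 _ in eS.
have ipE w : ip w (PsiS p q t l) = pr w v by [].
rewrite !ipE {ipE}; clearbody u v.
have [u0 eu1 eu2] := eigfun_init bp bq ePsi; have [v0 ev1 ev2] := eigfun_init bp bq eS.
have su : sol p q l u by apply/is_solP => //; case: ePsi.
have sv : sol p q l v by apply/is_solP => //; case: eS.
have tr := (char_eqE p q t l).1 ch.
move: u0 eu1 eu2 v0 ev1 ev2; rewrite (surjective_pairing (u 0)) (surjective_pairing (v 0)).
move=> /= u0 eu1 eu2 v0 ev1 ev2.
have [k k0 [k1 k2 k3 k4]] := rank_one_factor tr (det_cs bp bq l) (multN t) mm u0 eu1 eu2 v0 ev1 ev2.
have bc := sol_cbm (c_sol bp bq l); have bs := sol_cbm (s_sol bp bq l).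
have bu := sol_cbm su.
have uv : k * pr u v = - G p q l.
  rewrite (pr_comb u bp bq bu sv) dtC (dtC u (s l)).
  rewrite (pr_comb u bp bq bc su) (pr_comb u bp bq bs su) (dtC (s l) (c l)) /G.
  have e11 : c1 l = mult (- t) + k * (u 0).1 * (v 0).2 by rewrite -k1; ring.
  have e22 : s2 l = mult (- t) - k * (u 0).2 * (v 0).1 by rewrite -[LHS](subrK (mult (- t))) k4 addrC.
  rewrite e11 e22 k2 k3.
  move: (pr (c l) (c l)) (pr (c l) (s l)) (pr (s l) (s l)) (u 0).1 (u 0).2 (v 0).1 (v 0).2 (mult (- t)) => *; ring.
have gv : k * pr g v = (v 0).1 * k * pr g (c l) + (v 0).2 * k * pr g (s l).
  by rewrite (pr_comb u bp bq bg sv); ring.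
(* Also correct when G vanishes: both sides are then 0, inverses of 0 being 0. *)
have -> : pr g v / pr u v = - (k * pr g v / G p q l).
  by rewrite -mulrN -invrN -uv invfM mulrACA divff // mul1r.
rewrite (sol_repr bp bq su xI) /rnum1 /rnum2 k1 k2 k3 k4 gv.
move: (pr g (c l)) (pr g (s l)) (G p q l) (u 0).1 (u 0).2 (v 0).1 (v 0).2 (c l x) (s l x) => *.
by congr (_, _) => /=; ring.
Qed.

End RieszFormula.

(** * Bounding the projection by 1/|alpha| *)

Section AlphaBound.
Variable R : realType.
Local Notation C := R[i].
Local Notation C2 := (C * C)%type.
Local Notation P f x := (cint [set` `[0, x]] f).
Implicit Types (p q : R -> C) (u v w g : R -> C2) (l m t : C) (x : R).
Local Notation pr u v := (P (dt u v) pi).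

(** The value at x is bounded by the value at every y; squaring and integrating over y gives pi
    times the square of u(x), and the 2 comes from (a + b)^2 <= 2 (a^2 + b^2). *)
Lemma sol_sup_le_l2norm p q (M : R) : cbm p -> cbm q -> exists2 B, 0 < B &
  forall l, cmod l <= M -> forall u, sol p q l u -> forall x, 0 <= x <= pi -> nrm2 (u x) <= B * l2norm u.
Proof.
move=> bp bq; have [B B0 hB] := sol_bnd_any bp bq M.
exists (Num.sqrt (2 * B ^+ 2 / pi)).
  by rewrite sqrtr_gt0 divr_gt0 ?mulr_gt0 ?exprn_gt0 ?pi_gt0.
move=> l lM u su x xI; have [b1 b2] := sol_cbm su.
rewrite /l2norm -sqrtrM; last by rewrite divr_ge0 ?pi_ge0 // mulr_ge0 // sqr_ge0.
rewrite -[leLHS]ger0_norm ?nrm2_ge0 // -sqrtr_sqr ler_wsqrtr //.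
rewrite mulrAC ler_pdivlMr ?pi_gt0 //.
have ReE1 (a : C) : Re (a * cconj a) = cmod a ^+ 2 by rewrite cmod_sqr ReM /=; ring.
have -> : 2 * B ^+ 2 * Re (ip u u) = Rintegral (@lebesgue_measure R) [set` `[0, pi]]
    (fun y => 2 * B ^+ 2 * (cmod (u y).1 ^+ 2 + cmod (u y).2 ^+ 2)).
  rewrite RIZ //; last by apply: bmD; rewrite /GRing.exp /=; apply: bmM; exact: bm_cmod.
  by congr (_ * _); apply: RI_eq => y _; rewrite ReD !ReE1.
rewrite -(@RI_cst R (nrm2 (u x) ^+ 2) pi) ?pi_ge0 //; apply: RI_le => //.
- exact: bm_cst.
- apply: bmM; first exact: bm_cst.
  by apply: bmD; rewrite /GRing.exp /=; apply: bmM; exact: bm_cmod.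
- move=> y yI; apply: (@le_trans _ _ ((B * nrm2 (u y)) ^+ 2)).
    apply: lerXn2r; rewrite ?nnegrE ?mulr_ge0 ?nrm2_ge0 ?(ltW B0) //.
    exact: (hB l lM u su).
  rewrite /nrm2; have := mulr_ge0 (sqr_ge0 B) (sqr_ge0 (cmod (u y).1 - cmod (u y).2)).
  by move: (cmod (u y).1) (cmod (u y).2) => a b; lra.
Qed.

Lemma l2norm_conj2 u : l2norm (conj2 u) = l2norm u.
Proof.
rewrite /l2norm /ip; congr (Num.sqrt (Re (cint _ _))); apply/funext => x.
by rewrite /conj2 /= !cconjK mulrC (mulrC (cconj _)).
Qed.

(** Suprema of the two eigenfunctions are at most a constant times their L2 norms, and these are
    exactly the norms that normalise [alpha], so they cancel. *)
Lemma riesz_alpha_bound p q (M D : R) : cbm p -> cbm q -> exists2 B, 0 <= B &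
  forall l, cmod l <= M -> forall t, char_eq p q t l ->
  forall g, cbm2 g -> (forall x, 0 <= x <= pi -> nrm2 (g x) <= D) ->
  forall x, 0 <= x <= pi -> nrm2 (riesz p q t l g x) <= B / cmod (alpha p q t l).
Proof.
move=> bp bq; have [B B0 hB] := sol_sup_le_l2norm M bp bq.
exists (2 * (`|D| * B) * pi * B).
  by rewrite !mulr_ge0 ?pi_ge0 // ltW.
move=> l lM t ch g bg gD x xI.
have ePsi := PsiP bp bq ch; have eS := PsiS_conj bp bq ch.
have nv : l2norm (PsiS p q t l) = l2norm (conj2 (PsiS p q t l)) by rewrite l2norm_conj2.
have ipE w : ip w (PsiS p q t l) = pr w (conj2 (PsiS p q t l)) by [].
rewrite /riesz /alpha !ipE nv {ipE nv}.
set u := Psi p q t l in ePsi *; set v := conj2 _ in eS *; clearbody u v.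
have su : sol p q l u by apply/is_solP => //; case: ePsi.
have sv : sol p q l v by apply/is_solP => //; case: eS.
have hu := hB l lM u su; have hv := hB l lM v sv.
rewrite /nrm2 /= !cmodM -mulrDr !cmodV cmod_rc invfM invrK.
have l0 w : 0 <= l2norm w := sqrtr_ge0 _.
rewrite (ger0_norm (mulr_ge0 (l0 u) (l0 v))).
have gv : cmod (pr g v) <= 2 * (`|D| * (B * l2norm v)) * pi.
  apply: cint_bnd; rewrite ?pi_ge0 //; first exact: cbm2_dt (sol_cbm sv).
  move=> y yI; rewrite (le_trans (cmod_dt _ _ _)) // ler_pM ?nrm2_ge0 ?hv //.
  by rewrite (le_trans (gD y yI)) // ler_norm.
have -> : 2 * (`|D| * B) * pi * B * ((cmod (pr u v))^-1 * (l2norm u * l2norm v)) =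
  2 * (`|D| * (B * l2norm v)) * pi * (cmod (pr u v))^-1 * (B * l2norm u) by ring.
apply: ler_pM.
- by rewrite mulr_ge0 ?invr_ge0 ?cmod_ge0.
- exact: (nrm2_ge0 (u x)).
- by rewrite ler_wpM2r // invr_ge0 cmod_ge0.
- exact: hu.
Qed.
End AlphaBound.

(** * Lower bound for the derivative near a zero of finite order *)

Section DerivativeLowerBound.
Variable R : realType.
Local Notation C := R[i].
Implicit Types (A Q : {poly C}) (z w x h : C).

Lemma poly_bnd A : exists2 K : R, 0 <= K & forall x, cmod x <= 2 -> cmod A.[x] <= K.
Proof.
elim/poly_ind: A => [|A c [K K0 IH]].
  by exists 0 => // x _; rewrite horner0 cmod0.
exists (K * 2 + cmod c) => [|x x2]; first by rewrite addr_ge0 ?mulr_ge0 ?cmod_ge0.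
rewrite !hornerE (le_trans (cmodD _ _)) // lerD2r cmodM ler_pM ?cmod_ge0 ?IH //.
Qed.

Lemma poly_taylor2 A : exists2 K : R, 0 <= K & forall x h, cmod x <= 1 -> cmod h <= 1 ->
  cmod (A.[x + h] - A.[x] - h * A^`().[x]) <= K * cmod h ^+ 2.
Proof.
elim/poly_ind: A => [|A c [K K0 IH]].
  by exists 0 => // x h _ _; rewrite derivC !horner0 mulr0 !subr0 cmod0 mul0r.
have [L L0 hL] := poly_bnd A^`().
exists (K * 2 + L) => [|x h x1 h1]; first by rewrite addr_ge0 ?mulr_ge0.
have x2 : cmod x <= 2 by rewrite (le_trans x1) // ler1n.
rewrite derivD derivM derivX derivC addr0 mulr1 !hornerMXaddC hornerD hornerM hornerX.
have -> : A.[x + h] * (x + h) + c - (A.[x] * x + c) - h * (A^`().[x] * x + A.[x]) =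
  (A.[x + h] - A.[x] - h * A^`().[x]) * (x + h) + h * h * A^`().[x] by ring.
rewrite (le_trans (cmodD _ _)) // !cmodM -expr2 mulrDl; apply: lerD.
  rewrite mulrAC; apply: ler_pM; rewrite ?cmod_ge0 ?IH // (le_trans (cmodD _ _)) //.
  by rewrite -[2]/(1 + 1) lerD.
by rewrite mulrC ler_wpM2r ?sqr_ge0 // hL.
Qed.

Lemma poly_lip0 A : exists2 K : R, 0 <= K & forall x, cmod x <= 1 -> cmod (A.[x] - A.[0]) <= K * cmod x.
Proof.
have : root (A - A.[0]%:P) 0 by rewrite rootE !hornerE subrr.
case/factor_theorem => Q AQ; have [K K0 hK] := poly_bnd Q.
exists K => // x x1; have := congr1 (fun B : {poly C} => B.[x]) AQ; rewrite /= !hornerE subr0 => ->.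
by rewrite cmodM ler_wpM2r ?cmod_ge0 // hK // (le_trans x1) // ler1n.
Qed.

(* Comparing the expansion of F at l0 + w and at l0 + w + w^(k+1) transfers it to the derivative, with no control on the derivative of the remainder. *)
Lemma derivative_lower_bound (F G : C -> C) (l0 c0 : C) (m : nat) (B : R) :
  root_order (fun z => F z - c0) l0 m -> F l0 = c0 -> 0 <= B ->
  (forall z w, cmod (z - l0) <= 2 -> cmod (w - l0) <= 2 ->
     cmod (F w - F z - (w - z) * G z) <= B * cmod (w - z) ^+ 2) ->
  (forall N : nat, exists A, exists2 K : R, 0 <= K & forall w, cmod w <= 1 ->
     cmod (F (l0 + w) - A.[w]) <= K * cmod w ^+ N) ->
  exists (k : nat) (a b d : R), [/\ 0 < a, 0 < b, 0 < d & forall w, 0 < cmod w < d ->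
    cmod (F (l0 + w) - c0) <= b * cmod w ^+ k.+1 /\ a * cmod w ^+ k <= cmod (G (l0 + w))].
Proof.
move=> [L L0 hL] Fl0 B0 FG FA.
(* Order 2 m + 4 covers 2 (k + 1) for every k <= m, which puts the polynomial error below the square
   of the increment w^(k+1) used later. *)
have [N hN] : exists N : nat, (N = 2 * m + 4)%N by exists (2 * m + 4)%N.
have [A0 [K K0 hA0]] := FA N.
pose A := A0 - c0%:P.
have hA w : cmod w <= 1 -> cmod (F (l0 + w) - c0 - A.[w]) <= K * cmod w ^+ N.
  by move=> /hA0; rewrite /A !hornerE opprB addrA subrK.
have pow1 (n k : nat) (w : C) : cmod w <= 1 -> (k <= n)%N -> cmod w ^+ n <= cmod w ^+ k.
  by move=> w1 kn; apply: ler_wiXn2l => //; exact: cmod_ge0.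
(* Otherwise, along real e tending to 0, the quotient by e^m would tend to 0 instead of L. *)
have notO (D : R) : 0 <= D -> ~ (forall w, cmod w <= 1 -> cmod (F (l0 + w) - c0) <= D * cmod w ^+ m.+1).
  move=> D0 hD; have L00 : 0 < cmod L / 2 by rewrite divr_gt0 // cmod_gt0.
  have [d d0 hd] := hL _ L00.
  pose e := Num.min 1 (Num.min (d / 2) (cmod L / 4 / (D + 1))).
  have D10 : 0 < D + 1 by rewrite ltr_wpDl.
  have e0 : 0 < e by rewrite !lt_min ltr01 !divr_gt0 // cmod_gt0.
  have ce : cmod (rc e : C) = e by rewrite cmod_rc gtr0_norm.
  have := hd (l0 + rc e); rewrite addrAC subrr add0r ce e0 /=.
  have ed : e < d by rewrite gt_min gt_min ltr_pdivrMr // ltr_pMr // ltr1n !orbT.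
  move=> /(_ ed); have := hD (rc e); rewrite ce ge_min lexx /= => /(_ isT) h1 h2.
  have h3 : cmod ((F (l0 + rc e) - c0) / rc e ^+ m) <= D * e.
    rewrite cmodM cmodV cmodX ce ler_pdivrMr ?exprn_gt0 // -mulrA -exprS; exact: h1.
  have h4 : D * e <= cmod L / 4.
    have : e <= cmod L / 4 / (D + 1) by rewrite !ge_min lexx !orbT.
    rewrite ler_pdivlMr // => h; apply: le_trans h.
    by rewrite mulrDr mulr1 mulrC lerDl ltW.
  have := cmod_dist L ((F (l0 + rc e) - c0) / rc e ^+ m); rewrite cmod_distC => h5.
  have := cmod_ge0 L; have : 0 < cmod L by rewrite cmod_gt0.
  lra.
have A_neq0 : A != 0.
  apply/eqP => A00; apply: (notO K K0) => w w1; have := hA w w1; rewrite A00 horner0 subr0.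
  move=> /le_trans; apply; rewrite ler_wpM2l // pow1 //; lia.
(* k is the order of vanishing of the approximating polynomial at 0; [km] and [k0] place it between
   1 and m. *)
have [k [Q hQ AQ]] := multiplicity_XsubC A 0; rewrite A_neq0 /= in hQ.
have AE w : A.[w] = Q.[w] * w ^+ k by rewrite AQ !hornerE subr0.
have Q00 : Q.[0] != 0 by [].
have [KQ KQ0 hKQ] := poly_bnd Q.
have one2 (w : C) : cmod w <= 1 -> cmod w <= 2 by move=> h; rewrite (le_trans h) // ler1n.
have Fup w (n : nat) : cmod w <= 1 -> (n <= k)%N -> (n <= N)%N ->
    cmod (F (l0 + w) - c0) <= (K + KQ) * cmod w ^+ n.
  move=> w1 nk nm; rewrite -[F _ - c0](subrK A.[w]) (le_trans (cmodD _ _)) // mulrDl; apply: lerD.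
    by rewrite (le_trans (hA w w1)) // ler_wpM2l // pow1.
  by rewrite AE cmodM cmodX ler_pM ?cmod_ge0 ?exprn_ge0 ?cmod_ge0 ?hKQ ?one2 // pow1.
have km : (k <= m)%N.
  rewrite leqNgt; apply/negP => mk; apply: (notO (K + KQ)); first exact: addr_ge0.
  by move=> w w1; apply: Fup => //; lia.
have k0 : (0 < k)%N.
  rewrite lt0n; apply/negP => /eqP k0; case/negP: Q00.
  have := hA 0; rewrite addr0 Fl0 subrr sub0r cmodN cmod0 ler01 => /(_ isT).
  have -> : N = N.-1.+1 by lia.
  rewrite exprS mul0r mulr0 AE k0 expr0 mulr1 => h.
  by rewrite -cmod_eq0 eq_le h cmod_ge0.
have [KT KT0 hKT] := poly_taylor2 A.
have [KL KL0 hKL] := poly_lip0 Q.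
have [KD KD0 hKD] := poly_bnd Q^`().
pose T : R := K * 2 ^+ N + K + KT + B.
have T0 : 0 <= T by rewrite /T !addr_ge0 // mulr_ge0 // exprn_ge0.
have kN : (k.+1 * 2 <= N)%N by clear -km hN; lia.
have half1 (w : C) : cmod w <= 1 / 2 -> cmod w <= 1 by move=> h; rewrite (le_trans h) // ler_pdivrMr // mul1r ler1n.
have GA w : cmod w <= 1 / 2 -> w != 0 -> cmod (G (l0 + w) - A^`().[w]) <= T * cmod w ^+ k.
  (* The increment h = w^(k+1) is so small that quadratic remainders divided by h are O(w^k), of
     lower order than the main term w^(k-1) of A', yet h^2 still dominates the error w^N. *)
  move=> wh w0; pose h := w ^+ k.+1; have w1 := half1 w wh.
  have ch : cmod h = cmod w ^+ k.+1 by rewrite cmodX.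
  have hw : cmod h <= cmod w by rewrite ch -[leRHS]expr1 pow1.
  have h1 : cmod h <= 1 := le_trans hw w1.
  have h0 : 0 < cmod h by rewrite ch exprn_gt0 // cmod_gt0.
  have wh2 : cmod (w + h) <= 2 * cmod w.
    by rewrite (le_trans (cmodD _ _)) // mulr_natl mulr2n lerD2l.
  have wh1 : cmod (w + h) <= 1 by rewrite (le_trans wh2) // mulrC -ler_pdivlMr.
  have wN : cmod w ^+ N <= cmod h ^+ 2.
    by rewrite ch -exprM; apply: pow1.
  have e1 := hA w w1.
  have e2 : cmod (F (l0 + (w + h)) - c0 - A.[w + h]) <= K * 2 ^+ N * cmod w ^+ N.
    rewrite (le_trans (hA _ wh1)) // -mulrA -exprMn ler_wpM2l //.
    by apply: lerXn2r wh2; rewrite nnegrE ?mulr_ge0 ?cmod_ge0.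
  have e3 := FG (l0 + w) (l0 + (w + h)).
  have {}e3 : cmod (F (l0 + (w + h)) - F (l0 + w) - h * G (l0 + w)) <= B * cmod h ^+ 2.
    move: e3; have -> : l0 + (w + h) - (l0 + w) = h by ring.
    have -> : l0 + w - l0 = w by ring.
    have -> : l0 + (w + h) - l0 = w + h by ring.
    by apply; exact: one2.
  have e4 := hKT w h w1 h1.
  rewrite -(ler_pM2l h0) -cmodM.
  have -> : h * (G (l0 + w) - A^`().[w]) =
     (F (l0 + (w + h)) - c0 - A.[w + h]) - (F (l0 + w) - c0 - A.[w]) -
     (F (l0 + (w + h)) - F (l0 + w) - h * G (l0 + w)) + (A.[w + h] - A.[w] - h * A^`().[w]) by ring.
  have tri (x y z u : C) : cmod (x - y - z + u) <= cmod x + cmod y + cmod z + cmod u.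
    rewrite (le_trans (cmodD _ _)) // lerD2r (le_trans (cmodB _ _)) // lerD2r.
    exact: cmodB.
  rewrite (le_trans (tri _ _ _ _)) //.
  apply: (@le_trans _ _ (T * cmod h ^+ 2)).
    have g1 := ler_wpM2l K0 wN.
    have P2 : 0 <= K * 2 ^+ N by rewrite mulr_ge0 // exprn_ge0.
    have g2 := ler_wpM2l P2 wN.
    rewrite /T; move: e1 e2 e3 e4 g1 g2; move: (cmod h ^+ 2) (cmod w ^+ _) => X Y; lra.
  rewrite expr2 mulrCA ler_wpM2l ?cmod_ge0 // ler_wpM2l // ch; apply: pow1 => //.
have A'E w : A^`().[w] = Q^`().[w] * w ^+ k + k%:R * (Q.[w] * w ^+ k.-1).
  rewrite AQ derivM deriv_exp derivXsubC mul1r hornerD !hornerM !horner_exp hornerMn.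
  by rewrite horner_exp !hornerXsubC subr0 mulrnAr mulr_natl.
pose a := cmod Q.[0] / 2; have a0 : 0 < a by rewrite divr_gt0 // cmod_gt0.
pose W := KL + KD + T + 1; have W0 : 0 < W by rewrite /W; lra.
(* The exponent returned is k - 1: F - c0 vanishes like w^k and G like w^(k-1). *)
exists k.-1, a, (K + KQ + 1), (Num.min (1 / 2) (a / W)); split => //.
- by rewrite ltr_wpDl // addr_ge0.
- by rewrite lt_min; apply/andP; split; [lra|exact: divr_gt0].
move=> w /andP[w0]; rewrite lt_min => /andP[wh wa].
have w1 := half1 w (ltW wh).
rewrite prednK //; split.
  rewrite (le_trans (Fup w k w1 _ _)) //; first by clear -km hN; lia.
  by rewrite ler_wpM2r ?exprn_ge0 ?cmod_ge0 // lerDl.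
have e1 := GA w (ltW wh); rewrite -cmod_gt0 in e1; have {}e1 := e1 w0.
have e2 := hKL w w1; have e3 := hKD w (one2 _ w1).
rewrite ltr_pdivlMr // in wa.
have kk : cmod w ^+ k = cmod w * cmod w ^+ k.-1 by rewrite -exprS prednK.
have p0 : 0 <= cmod w ^+ k.-1 by rewrite exprn_ge0 ?cmod_ge0.
have f1 : cmod (k%:R * (Q.[w] * w ^+ k.-1)) >= (2 * a - KL * cmod w) * cmod w ^+ k.-1.
  rewrite !cmodM cmodX mulrA ler_wpM2r //.
  have -> : cmod (k%:R : C) = k%:R by rewrite -rc_nat cmod_rc ger0_norm.
  apply: (@le_trans _ _ (cmod Q.[w])); last by rewrite ler_peMl ?cmod_ge0 // ler1n.
  have -> : 2 * a = cmod Q.[0] by rewrite /a mulrC divfK.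
  have := cmod_dist Q.[0] Q.[w]; rewrite cmod_distC; lra.
have f2 : cmod (Q^`().[w] * w ^+ k) <= KD * (cmod w * cmod w ^+ k.-1).
  by rewrite cmodM cmodX kk ler_wpM2r // mulr_ge0 ?cmod_ge0.
have f3 := cmod_dist (k%:R * (Q.[w] * w ^+ k.-1)) (- (Q^`().[w] * w ^+ k)).
rewrite cmodN opprK (addrC (k%:R * _)) -A'E in f3.
have f4 := cmod_dist A^`().[w] (G (l0 + w)); rewrite cmod_distC in f4.
rewrite kk in e1.
have f5 : (cmod w * W) * cmod w ^+ k.-1 <= a * cmod w ^+ k.-1 by rewrite ler_wpM2r // ltW.
have f6 := mulr_ge0 (cmod_ge0 w) p0.
move: f1 f2 f3 f4 f5 f6 e1; rewrite /W.
move: (cmod w ^+ k.-1) => X *.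
lra.
Qed.
End DerivativeLowerBound.

(** * Polynomial approximation of F to any order *)

Section Taylor.
Variable R : realType.
Local Notation C := R[i].
Local Notation C2 := (C * C)%type.
Local Notation P f x := (cint [set` `[0, x]] f).
Variables p q : R -> C.
Hypotheses (bp : cbm p) (bq : cbm q).
Variable l0 : C.
Local Notation c := (c_fun p q l0).
Local Notation s := (s_fun p q l0).
Implicit Types (y z : R -> C2) (m w : C) (x : R) (u : C -> R -> C2).

(* The Volterra operator through which solutions at l0 + w are perturbations of solutions at l0. *)
Definition volterra y x : C2 :=
  (P (dt y c) x * (s x).1 - P (dt y s) x * (c x).1, P (dt y c) x * (s x).2 - P (dt y s) x * (c x).2).

Definition axpy w (a b : C2) : C2 := (a.1 + w * b.1, a.2 + w * b.2).

Let bc : cbm2 c := sol_cbm (c_sol bp bq l0).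
Let bs : cbm2 s := sol_cbm (s_sol bp bq l0).

Lemma volterra_cbm2 y : cbm2 y -> cbm2 (volterra y).
Proof.
move=> b; case: (bc) => c1 c2; case: (bs) => s1 s2.
have ic := cbm_cint (cbm2_dt b bc); have ks := cbm_cint (cbm2_dt b bs).
split; first exact: (cbmB (cbmM ic s1) (cbmM ks c1)).
exact: (cbmB (cbmM ic s2) (cbmM ks c2)).
Qed.

Lemma volterra_bnd : exists2 B, 0 <= B & forall y (D : R), cbm2 y ->
  (forall x, 0 <= x <= pi -> nrm2 (y x) <= D) -> forall x, 0 <= x <= pi -> nrm2 (volterra y x) <= B * D.
Proof.
have [E E0 hE] := cs_bnd bp bq (cmod l0).
exists (2 * (2 * E * pi * E)) => [|y D b yD x xI]; first by rewrite !mulr_ge0 ?pi_ge0 // ltW.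
have [x0 xp] := andP xI; have D0 : 0 <= D := le_trans (nrm2_ge0 _) (yD _ (zeroI R)).
have pb v : cbm2 v -> (forall t, 0 <= t <= pi -> nrm2 (v t) <= E) -> cmod (P (dt y v) x) <= 2 * (D * E) * pi.
  move=> bv vE; apply: cint_bnd => //; first exact: cbm2_dt.
  by move=> t tI; rewrite (le_trans (cmod_dt _ _ _)) // ler_pM ?nrm2_ge0 ?yD ?vE.
have pc := pb c bc (fun t tI => (hE l0 (lexx _) t tI).1).
have ps := pb s bs (fun t tI => (hE l0 (lexx _) t tI).2).
have [hc hs] := hE l0 (lexx _) x xI.
set W := 2 * (D * E) * pi in pc ps; have W0 : 0 <= W := le_trans (cmod_ge0 _) pc.
have -> : 2 * (2 * E * pi * E) * D = W * E + W * E by rewrite /W; ring.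
apply: le_trans (lerD (ler_wpM2l W0 hc) (ler_wpM2l W0 hs)).
rewrite /nrm2 /volterra /= (le_trans (lerD (cmodB _ _) (cmodB _ _))) // !cmodM !mulrDr.
have kc a := ler_wpM2r (cmod_ge0 a) pc; have ks a := ler_wpM2r (cmod_ge0 a) ps.
have := kc (s x).1; have := kc (s x).2; have := ks (c x).1; have := ks (c x).2.
lra.
Qed.

Lemma volterra_axpy w y z t : cbm2 y -> cbm2 z -> (forall x, 0 <= x <= pi -> t x = axpy w (y x) (z x)) ->
  forall x, 0 <= x <= pi -> volterra t x = axpy w (volterra y x) (volterra z x).
Proof.
move=> b1 b2 tE x xI; have [x0 xp] := andP xI.
have pE v : cbm2 v -> P (dt t v) x = P (dt y v) x + w * P (dt z v) x.
  move=> bv; rewrite -cintZ //; last exact: cbm2_dt.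
  rewrite -cintD //; try by [exact: cbm2_dt|apply: cbmZ; exact: cbm2_dt].
  apply: cint_eq => r /andP[r0 rx]; rewrite /dt tE ?r0 ?(le_trans rx) //= /axpy /=; ring.
rewrite /volterra !pE // /axpy /=.
move: (P (dt y c) x) (P (dt z c) x) (P (dt y s) x) (P (dt z s) x) (s x) (c x) => *.
by congr (_, _); ring.
Qed.

Section Family.
Variables (u : C -> R -> C2) (y0 : C2).
Hypothesis fu : family p q u y0.
Local Notation K n m := (iter n volterra (u m)).

Lemma iter_volterra_cbm2 n m : cbm2 (K n m).
Proof.
elim: n => [|n IH] /=; first exact: family_cbm2 fu.
exact: volterra_cbm2.
Qed.

(** The case n = 0 is [sol_expand] read as a resolvent identity; applying the linear operator
    repeatedly gives the others. *)
Lemma iter_volterraE n m x : 0 <= x <= pi -> K n m x = axpy (m - l0) (K n l0 x) (K n.+1 m x).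
Proof.
elim: n x => [|n IH] x xI.
  have [_ h] := fu; have [um sm] := h m; have [ul sl] := h l0.
  rewrite /= (sol_expand bp bq l0 sm xI) (sol_repr bp bq sl xI) um ul /axpy /volterra /=.
  move: (P (dt (u m) c) x) (P (dt (u m) s) x) (c x) (s x) => *; by congr (_, _); ring.
by apply: (volterra_axpy (iter_volterra_cbm2 n l0) (iter_volterra_cbm2 n.+1 m)).
Qed.

(** Unrolling [iter_volterraE] N times leaves terms built from the solution at l0 alone, which are
    the coefficients, and w^N times an iterate bounded by V^N U. *)
Lemma family_taylor (N : nat) : exists A B : {poly C}, exists2 D : R, 0 <= D & forall w, cmod w <= 1 ->
  cmod ((u (l0 + w) pi).1 - A.[w]) <= D * cmod w ^+ N /\ cmod ((u (l0 + w) pi).2 - B.[w]) <= D * cmod w ^+ N.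
Proof.
have [V V0 hV] := volterra_bnd; have [U U0 hU] := family_bnd bp bq (cmod l0 + 1) fu.
exists (\poly_(k < N) (K k l0 pi).1), (\poly_(k < N) (K k l0 pi).2), (V ^+ N * U).
  by rewrite mulr_ge0 ?exprn_ge0 // ltW.
move=> w w1; have lw : cmod (l0 + w) <= cmod l0 + 1 by rewrite (le_trans (cmodD _ _)) // lerD2l.
have Kb n x : 0 <= x <= pi -> nrm2 (K n (l0 + w) x) <= V ^+ n * U.
  elim: n x => [|n IH] x xI; first by rewrite expr0 mul1r hU.
  by rewrite exprS -mulrA; apply: (hV _ _ (iter_volterra_cbm2 n _)) => //; exact: IH.
have e n : (u (l0 + w) pi).1 = \sum_(k < n) (K k l0 pi).1 * w ^+ k + w ^+ n * (K n (l0 + w) pi).1 /\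
    (u (l0 + w) pi).2 = \sum_(k < n) (K k l0 pi).2 * w ^+ k + w ^+ n * (K n (l0 + w) pi).2.
  elim: n => [|n [IH1 IH2]]; first by rewrite !big_ord0 expr0 !add0r !mul1r.
  have dl : l0 + w - l0 = w by ring.
  have sE (a : nat -> C) : \sum_(k < n.+1) a k * w ^+ k = \sum_(k < n) a k * w ^+ k + a n * w ^+ n.
    by rewrite big_ord_recr.
  rewrite !(sE (fun k => (K k l0 pi).1)) !(sE (fun k => (K k l0 pi).2)) exprSr IH1 IH2.
  have -> := iter_volterraE n (l0 + w) (piI R); rewrite dl.
  have ax1 (a b : C2) : (axpy w a b).1 = a.1 + w * b.1 by [].
  have ax2 (a b : C2) : (axpy w a b).2 = a.2 + w * b.2 by [].
  rewrite ax1 ax2; move: (K n l0 pi) (K n.+1 (l0 + w) pi) (\sum_(k < n) _) (\sum_(k < n) _) => *.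
  by split; ring.
have [e1 e2] := e N; rewrite e1 e2 !horner_poly !(addrC (\sum_(k < N) _)) !addrK !cmodM !cmodX.
rewrite !(mulrC (V ^+ N * U)); split; rewrite ler_wpM2l ?exprn_ge0 ?cmod_ge0 //.
  exact: le_trans (cmod1_le _) (Kb N pi (piI R)).
exact: le_trans (cmod2_le _) (Kb N pi (piI R)).
Qed.
End Family.

Lemma Fdisc_taylor (N : nat) : exists A : {poly C}, exists2 D : R, 0 <= D & forall w, cmod w <= 1 ->
  cmod (Fdisc p q (l0 + w) - A.[w]) <= D * cmod w ^+ N.
Proof.
have [A1 [B1 [D1 D10 h1]]] := family_taylor (c_family bp bq) N.
have [A2 [B2 [D2 D20 h2]]] := family_taylor (s_family bp bq) N.
exists (A1 + B2), (D1 + D2) => [|w w1]; first exact: addr_ge0.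
have [k1 _] := h1 w w1; have [_ k2] := h2 w w1.
by rewrite /Fdisc hornerD opprD addrACA mulrDl (le_trans (cmodD _ _)) // lerD.
Qed.

Lemma G_lower_bound (c0 : C) (m : nat) : root_order (fun z : C => Fdisc p q z - c0) l0 m -> Fdisc p q l0 = c0 ->
  exists (k : nat) (a b d : R), [/\ 0 < a, 0 < b, 0 < d & forall w, 0 < cmod w < d ->
    cmod (Fdisc p q (l0 + w) - c0) <= b * cmod w ^+ k.+1 /\ a * cmod w ^+ k <= cmod (G p q (l0 + w))].
Proof.
move=> ro Fl; have [B B0 hB] := Fdisc_taylor2 bp bq (cmod l0 + 2).
have ball2 (m1 : C) : cmod (m1 - l0) <= 2 -> cmod m1 <= cmod l0 + 2.
  by move=> h; rewrite -{1}(subrK l0 m1) (le_trans (cmodD _ _)) // addrC lerD2l.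
apply: (derivative_lower_bound ro Fl B0) => [m1 m2 h1 h2|N]; last exact: Fdisc_taylor.
by apply: hB; exact: ball2.
Qed.
End Taylor.

(** * Oscillatory integrals over full periods *)

Section Oscillation.
Variable R : realType.
Local Notation C := R[i].
Local Notation P f x := (cint [set` `[0, x]] f).
Implicit Types (U V : R -> R) (a g H : R -> C) (x y K D T L : R) (l : C) (n k : nat).

(** The exponent -2 i sg: for |sg| = n its exponential has period pi / n, and [0, pi] consists of n
    full periods. *)
Definition freq (sg : R) : C := Complex 0 (- (2 * sg)).

Lemma cmod_freq (sg x : R) : cmod (cexp (freq sg * rc x)) = 1.
Proof. by rewrite cmod_cexp ReM /= mul0r mulr0 subrr expR0. Qed.

Lemma cexp_freq_period (sg : R) n : (0 < n)%N -> `|sg| = n%:R -> cexp (freq sg * rc (pi / n%:R)) = 1.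
Proof.
move=> n0 sn; have nR : (n%:R : R) != 0 by rewrite pnatr_eq0 -lt0n.
have s2 : - (2 * sg) * (pi / n%:R) = pi + pi \/ - (2 * sg) * (pi / n%:R) = - (pi + pi).
  have [s0|s0] := ger0P sg; [right|left]; move: sn.
    by rewrite ger0_norm // => ->; field.
  by rewrite ltr0_norm // => <-; field; rewrite lt_eqF.
have I1 : Im (freq sg * rc (pi / n%:R)) = - (2 * sg) * (pi / n%:R) by rewrite ImM /= mul0r add0r.
have R1 : Re (freq sg * rc (pi / n%:R)) = 0 by rewrite ReM /= mul0r mulr0 subrr.
rewrite /cexp R1 I1 expR0 !mul1r.
by case: s2 => ->; rewrite ?cosN ?sinN cosDpi sinDpi cospi sinpi opprK !oppr0.
Qed.

Lemma increment_bound_mono U g : increment_bound U g -> forall x y, 0 <= x -> x <= y -> y <= pi -> U x <= U y.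
Proof. by move=> h x y x0 xy yp; rewrite -subr_ge0 (le_trans _ (h x y _ _ _)) ?cmod_ge0. Qed.

(* Over each full period only the increments of g contribute. *)
Lemma riemann_lebesgue U g D (sg : R) n x : increment_bound U g -> (forall y, 0 <= y <= pi -> cmod (g y) <= D) ->
  (0 < n)%N -> `|sg| = n%:R -> 0 <= x <= pi ->
  cmod (P (fun s => cexp (freq sg * rc s) * g s) x) <= pi / n%:R * (2 * (U pi - U 0) + 2 * D).
Proof.
move=> gU gD n0 sn /andP[x0 xp]; have bg := increment_bound_cbm gU.
have Umono := increment_bound_mono gU.
have nR : 0 < (n%:R : R) by rewrite ltr0n.
pose d : R := pi / n%:R; have d0 : 0 < d by rewrite divr_gt0 // pi_gt0.
pose e s := cexp (freq sg * rc s); have pe := prim_cexp (freq sg).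
have be : cbm e := prim_cbm pe.
have beg : cbm (fun s => e s * g s) by exact: cbmM.
have freq0 : freq sg != 0.
  have sg0 : sg != 0 by rewrite -normr_eq0 sn gt_eqF.
  apply/eqP => -[] /eqP; rewrite oppr_eq0 mulf_eq0 (negbTE sg0) orbF pnatr_eq0 //.
have eper s : e (s + d) = e s.
  by rewrite /e rcD mulrDr cexpD (cexp_freq_period n0 sn) mulr1.
have Pe z : 0 <= z <= pi -> P e z = (e z - e 0) / freq sg.
  move=> zI; have [_ pz] := andP zI; case: pe => be' pe.
  have -> : e z - e 0 = freq sg * P e z.
    by rewrite /e (pe z zI) addrAC subrr add0r cintZ.
  by rewrite mulrC mulKf.
pose r (k : nat) : R := k%:R * d.
have rS k : r k.+1 = r k + d by rewrite /r -natr1 mulrDl mul1r.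
have rn : r n = pi by rewrite /r /d mulrC divfK // gt_eqF.
have r0 k : 0 <= r k by rewrite mulr_ge0 // ltW.
have rmono (k j : nat) : (k <= j)%N -> r k <= r j by move=> kj; rewrite ler_wpM2r ?ler_nat // ltW.
have diff y z : 0 <= y -> y <= z -> z <= pi -> z <= y + d ->
    cmod (P (fun s => e s * g s) z - P (fun s => e s * g s) y) <= 2 * D * d.
  move=> y0 yz zp zd; have D0 : 0 <= D := le_trans (cmod_ge0 _) (gD _ (zeroI R)).
  apply: (@le_trans _ _ (2 * D * (z - y))).
    apply: cint_diff => // s /andP[s0 sz]; rewrite cmodM cmod_freq mul1r gD //.
    by rewrite (le_trans y0 s0) (le_trans sz zp).
  by rewrite ler_wpM2l ?mulr_ge0 // lerBlDl.
have step k : (k <= n)%N -> cmod (P (fun s => e s * g s) (r k)) <= 2 * d * (U (r k) - U 0).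
  elim: k => [|k IH] kn.
    by rewrite /r mul0r cint0 cmod0 subrr mulr0.
  have rp : r k.+1 <= pi by rewrite -rn rmono.
  have rk : r k <= r k.+1 by exact: rmono.
  have rkI : 0 <= r k <= pi by rewrite r0 (le_trans rk).
  (* Subtracting the value of g at the left end changes nothing over a full period, where the
     exponential integrates to 0; what is left is bounded by the increment of U. *)
  pose gk s := e s * (g s - g (r k)).
  have bgk : cbm gk by apply: cbmM => //; apply: cbmB => //; exact: cbm_cst.
  have E z : 0 <= z <= pi -> P (fun s => e s * g s) z = P gk z + g (r k) * P e z.
    move=> /andP[z0 zp]; rewrite -cintZ // -cintD //; last exact: cbmZ.
    by apply: cint_eq => s _; rewrite /gk; ring.
  have -> : P (fun s => e s * g s) (r k.+1) = P (fun s => e s * g s) (r k) + (P gk (r k.+1) - P gk (r k)).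
    rewrite !E //; last by rewrite r0 rp.
    rewrite !Pe //; last by rewrite r0 rp.
    rewrite rS eper; ring.
  have h1 : cmod (P gk (r k.+1) - P gk (r k)) <= 2 * (U (r k.+1) - U (r k)) * (r k.+1 - r k).
    apply: cint_diff => // s /andP[s0 sz]; rewrite cmodM cmod_freq mul1r.
    apply: (le_trans (gU _ _ (r0 k) s0 (le_trans sz rp))).
    by rewrite lerB // Umono // (le_trans (r0 k)).
  rewrite (le_trans (cmodD _ _)) // (le_trans (lerD (IH (ltnW kn)) h1)) // rS.
  rewrite le_eqVlt; apply/orP; left; apply/eqP; ring.
(* k counts the complete periods below x; the remaining piece is no longer than d and costs at most
   2 D d. *)
have [k [kn kx xk]] : exists k, [/\ (k <= n)%N, r k <= x & x <= r k + d].
  have q0 : 0 <= x / d by rewrite divr_ge0 // ltW.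
  have /andP[t1 t2] := Num.Theory.truncn_itv q0.
  exists (Num.truncn (x / d)); split.
  - rewrite -(ler_nat R) (le_trans t1) // ler_pdivrMr // -/(r n) rn //.
  - by rewrite /r -ler_pdivlMr.
  - by rewrite -rS /r -ler_pdivrMr // ltW.
rewrite -(subrK (P (fun s => e s * g s) (r k)) (P _ x)).
rewrite (le_trans (cmodD _ _)) // (le_trans (lerD (diff _ _ (r0 k) kx xp xk) (step k kn))) //.
have h : U (r k) - U 0 <= U pi - U 0 by rewrite lerB // Umono // -rn rmono.
have {}h : 2 * d * (U (r k) - U 0) <= 2 * d * (U pi - U 0) by rewrite ler_wpM2l // mulr_ge0 // ltW.
rewrite -/d; lra.
Qed.
End Oscillation.

(** * Asymptotics of F in the closed upper half-plane *)

Section Asymptotics.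
Variable R : realType.
Local Notation C := R[i].
Local Notation C2 := (C * C)%type.
Local Notation P f x := (cint [set` `[0, x]] f).
Local Notation RP f x := (Rintegral (@lebesgue_measure R) [set` `[0, x]] f).
Implicit Types (U V : R -> R) (a b g H X : R -> C) (x y K D T L e : R) (l : C) (n k : nat).

Definition twoil l : C := ci R * l * 2.

Lemma cmod_cexp_twoil l x : cmod (cexp (twoil l * rc x)) = expR (- (2 * Im l * x)).
Proof.
rewrite cmod_cexp; congr expR; rewrite /twoil -rc_nat ?ReE /= ?ReE /= ?ReE /=; ring.
Qed.

Lemma cmod_cexpN_twoil l x : cmod (cexp (- twoil l * rc x)) = expR (2 * Im l * x).
Proof.
rewrite cmod_cexp; congr expR; rewrite /twoil -rc_nat ?ReE /= ?ReE /= ?ReE /=; ring.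
Qed.

(** The two regions that localisation uses: far from the real axis, and the lines |Re l| = n, which
    serve as barriers for the labels. *)
Definition far (T : R) l := T <= `|Im l| \/ exists n, `|Re l| = n%:R /\ T <= n%:R.

Lemma expR_lip (c T x y : R) : 0 <= c -> c <= T -> 0 <= x -> x <= y -> y <= pi ->
  cmod (cexp (rc c * rc y) - cexp (rc c * rc x)) <= 2 * (T * expR (T * pi)) * (y - x).
Proof.
move=> c0 cT x0 xy yp; have [bb pe] := prim_cexp (rc c).
rewrite (pe y) ?(le_trans x0 xy) // (pe x) ?x0 ?(le_trans xy) //.
rewrite opprD addrACA subrr add0r; apply: cint_diff => // s /andP[xs sy].
have T0 : 0 <= T := le_trans c0 cT.
rewrite cmodM cmod_rc ger0_norm // cmod_cexp -rcM /=; apply: ler_pM; [by []|exact: expR_ge0|by []|].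
by rewrite ler_expR; apply: ler_pM => //; rewrite ?(le_trans x0 xs) ?(le_trans sy yp).
Qed.

(* The first alternative of [far] gives exponential decay of the kernel, the second oscillation over full periods. *)
Lemma oscillatory_integral_small V a K D L e : increment_bound V a ->
  (forall x, 0 <= x <= pi -> cmod (a x) <= K) -> 0 <= D -> 0 <= L -> 0 < e ->
  exists2 T, 0 < T & forall l, 0 <= Im l -> far T l -> forall H,
    (forall x, 0 <= x <= pi -> cmod (H x) <= D) ->
    (forall x y, 0 <= x -> x <= y -> y <= pi -> cmod (H y - H x) <= L * (y - x)) ->
    forall x, 0 <= x <= pi -> cmod (cexp (twoil l * rc x) * P (fun s => cexp (- twoil l * rc s) * (a s * H s)) x) <= e.
Proof.
move=> aV aK D0 L0 e0; have ba := increment_bound_cbm aV.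
have K0 : 0 <= K := le_trans (cmod_ge0 _) (aK _ (zeroI R)).
(* Beyond T1 the decaying kernel alone gives K D / Im l <= e. *)
pose T1 := K * D / e + 1.
have T10 : 0 < T1 by rewrite ltr_wpDl // divr_ge0 ?mulr_ge0 // ltW.
(* In the oscillatory regime Im l stays below T1, so exp(2 Im l s) can be absorbed in the amplitude:
   [B1] bounds its product with H, [B2] is a Lipschitz constant of that product, and [U] controls
   the increments after multiplication by a. *)
pose B1 := expR (2 * T1 * pi) * D.
pose B2 := 2 * (2 * T1 * expR (2 * T1 * pi)) * D + expR (2 * T1 * pi) * L.
have B10 : 0 <= B1 by rewrite mulr_ge0 // expR_ge0.
have B20 : 0 <= B2 by rewrite addr_ge0 // !mulr_ge0 ?expR_ge0 // ltW.
pose U x := B1 * V x + K * B2 * x.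
pose W := 2 * (U pi - U 0) + 2 * (B1 * K).
exists (Num.max T1 (pi * `|W| / e + 1)); first by rewrite lt_max T10.
move=> l l0 lT H HD HL x xI; have [x0 xp] := andP xI; have bH := cbm_lip HL.
have bE : cbm (fun s => cexp (- twoil l * rc s)) := prim_cbm (prim_cexp _).
have bf : cbm (fun s => cexp (- twoil l * rc s) * (a s * H s)) by do 2?apply: cbmM.
have [hT|hT] := lerP T1 (Im l).
  have l1 : 0 < Im l := lt_le_trans T10 hT.
  rewrite cmodM cmod_cexp_twoil.
  have -> : e = expR (- (2 * Im l * x)) * (expR (2 * Im l * x) * e).
    by rewrite mulrA -expRD addNr expR0 mul1r.
  rewrite ler_wpM2l ?expR_ge0 //.
  pose m s := (K * D) * expR (2 * Im l * s).
  have bm_m : bm m by apply: bmM; [exact: bm_cst|exact: bm_expR].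
  apply: (@le_trans _ _ (2 * RP m x)).
    apply: cint_norm_le => // s /andP[s0 sx].
    have sI : 0 <= s <= pi by rewrite s0 (le_trans sx).
    by rewrite !cmodM cmod_cexpN_twoil mulrC ler_wpM2r ?expR_ge0 // ler_pM ?cmod_ge0 ?aK ?HD.
  apply: (@le_trans _ _ (2 * (K * D / (2 * Im l) * expR (2 * Im l * x)))).
    by rewrite ler_wpM2l // RI_expR_le ?mulr_gt0 ?mulr_ge0.
  have -> : 2 * (K * D / (2 * Im l) * expR (2 * Im l * x)) = expR (2 * Im l * x) * (K * D / Im l).
    by field; rewrite gt_eqF.
  rewrite ler_wpM2l ?expR_ge0 // ler_pdivrMr // (mulrC e) -ler_pdivrMr // (le_trans _ hT) //.
  by rewrite /T1 lerDl.
have [n [ln nT]] : exists n, `|Re l| = n%:R /\ pi * `|W| / e + 1 <= n%:R.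
  case: lT => [|[n [ln]]]; rewrite ge_max => /andP[h1 h2]; last by exists n.
  by move: hT; rewrite ltNge -(ger0_norm l0) h1.
have n0 : (0 < n)%N.
  rewrite -(ltr_nat R) (lt_le_trans _ nT) // ltr_wpDl ?ltr01 // divr_ge0 ?(ltW e0) //.
  by rewrite mulr_ge0 ?pi_ge0.
have nR : 0 < (n%:R : R) by rewrite ltr0n.
have cT : 2 * Im l <= 2 * T1 by rewrite ler_wpM2l // ltW.
have c0 : 0 <= 2 * Im l by rewrite mulr_ge0.
have T2 : 0 <= 2 * T1 by rewrite mulr_ge0 // ltW.
pose E s := cexp (rc (2 * Im l) * rc s).
have Eb s : 0 <= s <= pi -> cmod (E s) <= expR (2 * T1 * pi).
  move=> /andP[s0 sp]; rewrite /E -rcM cmod_cexp /= ler_expR.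
  by apply: ler_pM.
pose g s := a s * (E s * H s).
have gU : increment_bound U g.
  move=> y z y0 yz zp; have yI : 0 <= y <= pi by rewrite y0 (le_trans yz).
  have zI : 0 <= z <= pi by rewrite zp (le_trans y0).
  have -> : g z - g y = (a z - a y) * (E z * H z) + a y * ((E z - E y) * H z + E y * (H z - H y)).
    by rewrite /g; ring.
  have -> : U z - U y = (V z - V y) * (expR (2 * T1 * pi) * D) +
     K * (2 * (2 * T1 * expR (2 * T1 * pi)) * (z - y) * D + expR (2 * T1 * pi) * (L * (z - y))).
    by rewrite /U /B1 /B2; ring.
  rewrite (le_trans (cmodD _ _)) //; apply: lerD.
    by rewrite !cmodM; apply: ler_pM; rewrite ?mulr_ge0 ?cmod_ge0 ?aV // ler_pM ?cmod_ge0 ?Eb ?HD.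
  rewrite cmodM; apply: ler_pM; rewrite ?cmod_ge0 ?aK // (le_trans (cmodD _ _)) // !cmodM; apply: lerD.
    by apply: ler_pM; rewrite ?cmod_ge0 ?HD //; exact: expR_lip.
  by apply: ler_pM; rewrite ?cmod_ge0 ?Eb ?HL.
have gD y : 0 <= y <= pi -> cmod (g y) <= B1 * K.
  by move=> yI; rewrite /g !cmodM mulrC ler_pM ?mulr_ge0 ?cmod_ge0 ?aK // ler_pM ?cmod_ge0 ?Eb ?HD.
have rl := riemann_lebesgue gU gD n0 ln xI.
have kE : - twoil l = freq (Re l) + rc (2 * Im l).
  rewrite /twoil; apply: complex_ext; first by rewrite -rc_nat ?ReE /= ?ReE /=; ring.
  by rewrite -rc_nat ?ReE /= ?ReE /=; ring.
have -> : P (fun s => cexp (- twoil l * rc s) * (a s * H s)) x = P (fun s => cexp (freq (Re l) * rc s) * g s) x.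
  apply: cint_eq => s _; rewrite /g /E.
  by rewrite kE mulrDl cexpD; ring.
rewrite cmodM cmod_cexp_twoil -[leRHS]mul1r ler_pM ?expR_ge0 ?cmod_ge0 //.
  by rewrite -expR0 ler_expR oppr_le0 !mulr_ge0.
have h : pi * `|W| / e <= n%:R by rewrite (le_trans _ nT) // lerDl.
rewrite ler_pdivrMr // in h.
apply: (le_trans rl); rewrite -/W mulrAC ler_pdivrMr // mulrC (mulrC e).
by apply: le_trans h; rewrite mulrC ler_wpM2l ?pi_ge0 // ler_norm.
Qed.

Variables p q : R -> C.
Hypotheses (bp : cbm p) (bq : cbm q).
Implicit Types (u : R -> C2).
Let a x := q x - ci R * p x.
Let b x := q x + ci R * p x.

(** Coordinates diagonalising the free system: for Q = 0, y1 + i y2 and y1 - i y2 are multiples of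
    e^(i l x) and e^(-i l x). The prefactor keeps both bounded in the upper half-plane and makes the
    second constant. *)
Definition Xf l u x : C := cexp (ci R * l * rc x) * ((u x).1 + ci R * (u x).2).
Definition Hf l u x : C := cexp (ci R * l * rc x) * ((u x).1 - ci R * (u x).2).

Let ba : cbm a. Proof. by apply: cbmB => //; exact: cbmZ. Qed.
Let bb : cbm b. Proof. by apply: cbmD => //; exact: cbmZ. Qed.

Lemma Xf_prim l u : sol p q l u -> prim (Xf l u) (fun x => twoil l * Xf l u x + a x * Hf l u x).
Proof.
move=> [u1 u2]; apply: prim_ext (primM (prim_cexp (ci R * l)) (primD u1 (primZ (ci R) u2))) => x _ //.
rewrite /Xf /Hf /odeM /twoil /a /=; move: (cexp _) (u x).1 (u x).2 => E y1 y2.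
have cc : ci R * ci R * y2 = - y2 by rewrite ciM mulN1r.
have -> : ci R * l * E * (y1 + ci R * y2) + E * (q x * y1 - (l + p x) * y2 + ci R * ((l - p x) * y1 - q x * y2)) =
  ci R * l * 2 * (E * (y1 + ci R * y2)) + (q x - ci R * p x) * (E * (y1 - ci R * y2)) -
   l * E * (ci R * ci R * y2 + y2) - p x * E * (ci R * ci R * y2 + y2) by ring.
by rewrite cc addNr !mulr0 !subr0.
Qed.

Lemma Hf_prim l u : sol p q l u -> prim (Hf l u) (fun x => b x * Xf l u x).
Proof.
move=> [u1 u2]; apply: prim_ext (primM (prim_cexp (ci R * l)) (primB u1 (primZ (ci R) u2))) => x _ //.
rewrite /Xf /Hf /odeM /b /=; move: (cexp _) (u x).1 (u x).2 => E y1 y2.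
have cc : ci R * ci R * y2 = - y2 by rewrite ciM mulN1r.
have -> : ci R * l * E * (y1 - ci R * y2) + E * (q x * y1 - (l + p x) * y2 - ci R * ((l - p x) * y1 - q x * y2)) =
  (q x + ci R * p x) * (E * (y1 + ci R * y2)) -
   l * E * (ci R * ci R * y2 + y2) - p x * E * (ci R * ci R * y2 + y2) by ring.
by rewrite cc addNr !mulr0 !subr0.
Qed.

(** Variation of constants with the integrating factor e^(-2 i l x). *)
Lemma Xf_duhamel l u x : sol p q l u -> 0 <= x <= pi ->
  Xf l u x = cexp (twoil l * rc x) * Xf l u 0 +
    cexp (twoil l * rc x) * P (fun s => cexp (- twoil l * rc s) * (a s * Hf l u s)) x.
Proof.
move=> su xI; have pX := Xf_prim su.
have [_ h] := primM (prim_cexp (- twoil l)) pX.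
have := h x xI; rewrite rc0 mulr0 cexp0 mul1r.
have -> : P (fun x => - twoil l * cexp (- twoil l * rc x) * Xf l u x +
   cexp (- twoil l * rc x) * (twoil l * Xf l u x + a x * Hf l u x)) x =
   P (fun s => cexp (- twoil l * rc s) * (a s * Hf l u s)) x.
  by apply: cint_eq => s _; ring.
by move=> e0; rewrite -mulrDr -e0 mulrA -cexpD -mulrDl subrr mul0r cexp0 mul1r.
Qed.

(** In the Duhamel form the kernel e^(2 i l (x - s)) has modulus at most 1 for s <= x and Im l >= 0,
    so the Gronwall constant does not depend on l. *)
Lemma XfHf_bnd : exists2 D, 0 <= D & forall l, 0 <= Im l -> forall u, sol p q l u ->
  cmod (Xf l u 0) + cmod (Hf l u 0) <= 1 -> forall x, 0 <= x <= pi ->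
  cmod (Xf l u x) <= D /\ cmod (Hf l u x) <= D.
Proof.
have [A A0 hA] := cbm_bnd ba; have [B B0 hB] := cbm_bnd bb.
pose K := A + B + 1; have K0 : 0 < K by rewrite ltr_wpDl // addr_ge0.
exists (2 * 1 * expR (2 * (2 * K) * pi)); first by rewrite !mulr_ge0 // expR_ge0.
move=> l l0 u su n0 x xI; have pX := Xf_prim su; have pH := Hf_prim su.
have bX := prim_cbm pX; have bH := prim_cbm pH.
pose m y := cmod (Xf l u y) + cmod (Hf l u y).
have bmm : bm m by apply: bmD; exact: bm_cmod.
have bE : cbm (fun s => cexp (- twoil l * rc s)) := prim_cbm (prim_cexp _).
have bf : cbm (fun s => cexp (- twoil l * rc s) * (a s * Hf l u s)) by do 2?apply: cbmM.
have mle y : 0 <= y <= pi -> m y <= 1 + 2 * K * RP m y.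
  move=> yI; have [y0 yp] := andP yI.
  have eX : cmod (Xf l u y) <= cmod (Xf l u 0) + 2 * (K * RP (fun s => cmod (Hf l u s)) y).
    rewrite (Xf_duhamel su yI) (le_trans (cmodD _ _)) //; apply: lerD.
      rewrite cmodM cmod_cexp_twoil ler_piMl ?cmod_ge0 //.
      by rewrite -expR0 ler_expR oppr_le0 !mulr_ge0.
    rewrite -cintZ // -RIZ //; last exact: bm_cmod.
    apply: cint_norm_le => //; first exact: cbmZ.
      by apply: bmM; [exact: bm_cst|exact: bm_cmod].
    move=> s /andP[s0 sy]; have sI : 0 <= s <= pi by rewrite s0 (le_trans sy).
    rewrite 3!cmodM cmod_cexp_twoil cmod_cexpN_twoil mulrA -expRD -[leRHS]mul1r.
    apply: ler_pM; rewrite ?expR_ge0 ?mulr_ge0 ?cmod_ge0 //.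
      by rewrite -expR0 ler_expR addrC -mulrBr mulr_ge0_le0 ?mulr_ge0 // subr_le0.
    rewrite ler_wpM2r ?cmod_ge0 // (le_trans (hA _ sI)) // /K; lra.
  have eH : cmod (Hf l u y) <= cmod (Hf l u 0) + 2 * (K * RP (fun s => cmod (Xf l u s)) y).
    case: pH => bbX ->//; rewrite (le_trans (cmodD _ _)) // lerD2l -RIZ //; last exact: bm_cmod.
    apply: cint_norm_le => //.
      by apply: bmM; [exact: bm_cst|exact: bm_cmod].
    move=> s /andP[s0 sy]; have sI : 0 <= s <= pi by rewrite s0 (le_trans sy).
    rewrite cmodM ler_wpM2r ?cmod_ge0 // (le_trans (hB _ sI)) // /K; lra.
  rewrite /m RID //; try exact: bm_cmod.
  move: (RP _ _) (RP _ _) eX eH => r1 r2; lra.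
have g := gronwall bmm ler01 (mulr_gt0 (ltr0n R 2) K0) mle.
have {}g y : 0 <= y <= pi -> m y <= 2 * 1 * expR (2 * (2 * K) * pi).
  move=> yI; rewrite (le_trans (g y yI)) // ler_wpM2l ?mulr_ge0 // ler_expR ler_wpM2l //.
    by rewrite !mulr_ge0 // ltW.
  by case/andP: yI.
by split; apply: le_trans (g x xI); rewrite /m ?lerDl ?lerDr cmod_ge0.
Qed.

Lemma Hf_lip l u (B D : R) : sol p q l u -> (forall x, 0 <= x <= pi -> cmod (b x) <= B) ->
  (forall x, 0 <= x <= pi -> cmod (Xf l u x) <= D) ->
  forall x y, 0 <= x -> x <= y -> y <= pi -> cmod (Hf l u y - Hf l u x) <= 2 * (B * D) * (y - x).
Proof.
move=> su hB hD x y x0 xy yp; have [bbX h] := Hf_prim su.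
rewrite (h y) ?(le_trans x0 xy) // (h x) ?x0 ?(le_trans xy) //.
rewrite opprD addrACA subrr add0r; apply: cint_diff => // s /andP[xs sy].
have sI : 0 <= s <= pi by rewrite (le_trans x0 xs) (le_trans sy yp).
by rewrite cmodM; apply: ler_pM; rewrite ?cmod_ge0 ?hB ?hD.
Qed.

Local Notation c := (c_fun p q).
Local Notation s := (s_fun p q).

(** The solutions [yA] and [yB] have initial coordinates (1, 0) and (0, 1) in ([Xf], [Hf]), and e^(i
    l pi) F is the trace, Xf of yA plus Hf of yB, at pi. Its leading part e^(2 i l pi) + 1 gives 2
    cos(pi l); the rest is an oscillatory integral, or an integral of b times one. *)
Lemma Fdisc_upper V W e : increment_bound V p -> increment_bound W q -> 0 < e ->
  exists2 T, 0 < T & forall l, 0 <= Im l -> far T l ->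
  cmod (Fdisc p q l - (mult l + mult (- l))) <= e * expR (pi * Im l).
Proof.
move=> pV qW e0.
have aVW : increment_bound (fun x => W x + V x) a.
  move=> x y x0 xy yp; rewrite /a.
  have -> : q y - ci R * p y - (q x - ci R * p x) = (q y - q x) - ci R * (p y - p x) by ring.
  rewrite (le_trans (cmodB _ _)) // cmodM cmod_ci mul1r opprD addrACA.
  by apply: lerD; [exact: qW|exact: pV].
have [A A0 hA] := cbm_bnd ba; have [B B0 hB] := cbm_bnd bb.
have [D D0 hD] := XfHf_bnd.
(* The two error terms are e1 and 2 B e1 pi, which together have to make e. *)
pose e1 := e / (1 + 2 * B * pi).
have d0 : 0 < 1 + 2 * B * pi by rewrite ltr_pwDl // !mulr_ge0 // pi_ge0.
have e10 : 0 < e1 by rewrite divr_gt0.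
have BD0 : 0 <= 2 * (B * D) by rewrite !mulr_ge0.
have [T T0 hT] := oscillatory_integral_small aVW hA D0 BD0 e10.
exists T => // l l0 lT.
have small u : sol p q l u -> cmod (Xf l u 0) + cmod (Hf l u 0) <= 1 ->
    forall x, 0 <= x <= pi -> cmod (cexp (twoil l * rc x) * P (fun s => cexp (- twoil l * rc s) * (a s * Hf l u s)) x) <= e1.
  move=> su u0 x xI; have XD y (yI : 0 <= y <= pi) := (hD l l0 u su u0 y yI).1.
  apply: hT => // [y yI|]; first exact: (hD l l0 u su u0 y yI).2.
  exact: (Hf_lip su hB XD).
pose yA x : C2 := (1 / 2 * (c l x).1 + - (ci R / 2) * (s l x).1, 1 / 2 * (c l x).2 + - (ci R / 2) * (s l x).2).
pose yB x : C2 := (1 / 2 * (c l x).1 + (ci R / 2) * (s l x).1, 1 / 2 * (c l x).2 + (ci R / 2) * (s l x).2).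
have sA : sol p q l yA := sol_comb _ _ (c_sol bp bq l) (s_sol bp bq l).
have sB : sol p q l yB := sol_comb _ _ (c_sol bp bq l) (s_sol bp bq l).
have ci2 : ci R * (ci R / 2) = - (1 / 2) by rewrite mulrA ciM mulNr.
have half2 : (1 / 2 + 1 / 2 : C) = 1 by rewrite -mulrDl divff // pnatr_eq0.
have XA0 : Xf l yA 0 = 1.
  by rewrite /Xf /yA c0 // s0 //= rc0 mulr0 cexp0 !mulr1 !mulr0 addr0 add0r mulrN ci2 opprK mul1r.
have HA0 : Hf l yA 0 = 0.
  by rewrite /Hf /yA c0 // s0 //= rc0 mulr0 cexp0 !mulr1 !mulr0 addr0 add0r mulrN ci2 opprK mul1r subrr.
have XB0 : Xf l yB 0 = 0.
  by rewrite /Xf /yB c0 // s0 //= rc0 mulr0 cexp0 !mulr1 !mulr0 addr0 add0r ci2 mul1r subrr.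
have HB0 : Hf l yB 0 = 1.
  by rewrite /Hf /yB c0 // s0 //= rc0 mulr0 cexp0 !mulr1 !mulr0 addr0 add0r ci2 opprK mul1r.
have nA : cmod (Xf l yA 0) + cmod (Hf l yA 0) <= 1 by rewrite XA0 HA0 cmod1 cmod0 addr0.
have nB : cmod (Xf l yB 0) + cmod (Hf l yB 0) <= 1 by rewrite XB0 HB0 cmod1 cmod0 add0r.
have pI := piI R.
pose E := cexp (ci R * l * rc pi).
have EF : E * Fdisc p q l = Xf l yA pi + Hf l yB pi.
  rewrite /Xf /Hf -/E /yA /yB /Fdisc /=; move: (c l pi) (s l pi) => z w.
  transitivity (E * ((1 / 2 + 1 / 2) * z.1 - (ci R * (ci R / 2) + ci R * (ci R / 2)) * w.2)).
    by rewrite ci2 half2 -opprD half2; ring.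
  by move: (1 / 2 : C) (ci R / 2) => h k; ring.
have E2 : cexp (twoil l * rc pi) = E * E by rewrite -cexpD; congr cexp; rewrite /twoil; ring.
have mE : mult l = E by rewrite /mult /E /piC; congr cexp; ring.
have mEN : E * mult (- l) = 1 by rewrite -mE multN.
have key : E * (Fdisc p q l - (mult l + mult (- l))) =
  cexp (twoil l * rc pi) * P (fun s => cexp (- twoil l * rc s) * (a s * Hf l yA s)) pi +
  P (fun x => b x * Xf l yB x) pi.
  have d1 : E * (mult l + mult (- l)) = E * E + 1 by rewrite mulrDr mEN mE.
  rewrite mulrBr d1 EF (Xf_duhamel sA pI) XA0 mulr1 E2.
  have [_ ->//] := Hf_prim sB; rewrite HB0; ring.
have XBs x : 0 <= x <= pi -> cmod (Xf l yB x) <= e1.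
  by move=> xI; rewrite (Xf_duhamel sB xI) XB0 mulr0 add0r small.
have bX : cmod (P (fun x => b x * Xf l yB x) pi) <= 2 * (B * e1) * pi.
  apply: cint_bnd => //; rewrite ?pi_ge0 //; first by case: (Hf_prim sB).
  by move=> y yI; rewrite cmodM; apply: ler_pM; rewrite ?cmod_ge0 ?hB ?XBs.
have cE : cmod E = expR (- (pi * Im l)).
  rewrite /E cmod_cexp; congr expR; rewrite ?ReE /= ?ReE /=; ring.
have Ee : expR (- (pi * Im l)) * cmod (Fdisc p q l - (mult l + mult (- l))) <= e.
  rewrite -cE -cmodM key (le_trans (cmodD _ _)) // (le_trans (lerD (small _ sA nA _ pI) bX)) //.
  have e1E : e1 + e1 * (2 * B * pi) = e by rewrite -{1}(mulr1 e1) -mulrDr divfK // lt0r_neq0.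
  rewrite -[leRHS]e1E lerD2l.
  by rewrite le_eqVlt; apply/orP; left; apply/eqP; ring.
have := ler_wpM2l (expR_ge0 (pi * Im l)) Ee.
by rewrite mulrA -expRD subrr expR0 mul1r mulrC.
Qed.
End Asymptotics.

(** * Asymptotics of F in both half-planes *)

Section AsymptoticsAll.
Variable R : realType.
Local Notation C := R[i].
Implicit Types (p q : R -> C) (V W : R -> R) (l : C) (T : R).

Lemma Fdisc_flip p q l : cbm p -> cbm q -> Fdisc (fun x => - p x) q (- l) = Fdisc p q l.
Proof.
move=> bp bq; have bn : cbm (fun x => - p x) := cbmN bp.
have pI := piI R.
have := sol_repr bn bq (sol_flip (c_sol bp bq l)) pI.
have := sol_repr bn bq (sol_flip (s_sol bp bq l)) pI.
rewrite c0 // s0 //= oppr0 !mul0r !mul1r !add0r !addr0 !mulN1r => -[_ e1] [e2 _].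
by rewrite /Fdisc e2 -[in RHS](opprK (s_fun p q l pi).2) e1 opprK.
Qed.

Lemma far_le T T' l : T' <= T -> far T l -> far T' l.
Proof.
move=> TT [h|[n [hn h]]]; [left|right]; first exact: le_trans h.
by exists n; split=> //; exact: le_trans h.
Qed.

Lemma Fdisc_asymptotics p q : BVc p -> BVc q -> exists2 T : R, 0 < T & forall l, far T l ->
  cmod (Fdisc p q l - (mult l + mult (- l))) <= 1 / 2 * expR (pi * `|Im l|).
Proof.
move=> /BVc_increment_bound[V pV] /BVc_increment_bound[W qW].
have bp := increment_bound_cbm pV; have bq := increment_bound_cbm qW.
have pV' : increment_bound V (fun x => - p x).
  by move=> x y x0 xy yp; rewrite opprK addrC cmod_distC; exact: pV.
have e0 : 0 < (1 / 2 : R) by rewrite divr_gt0.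
have [T1 T10 h1] := Fdisc_upper bp bq pV qW e0.
have [T2 T20 h2] := Fdisc_upper (cbmN bp) bq pV' qW e0.
exists (Num.max T1 T2); first by rewrite lt_max T10.
move=> l lT; have [l0|l0] := lerP 0 (Im l).
  by rewrite ger0_norm //; apply: h1 => //; apply: far_le lT; rewrite le_max lexx.
have mE : mult l + mult (- l) = mult (- l) + mult (- - l) by rewrite opprK addrC.
rewrite ltr0_norm // -ImN mE -(Fdisc_flip l bp bq); apply: h2; first by rewrite ImN oppr_ge0 ltW.
have : far T2 l by apply: far_le lT; rewrite le_max lexx orbT.
by rewrite /far ImN ReN !normrN.
Qed.
End AsymptoticsAll.

(** * Barriers that keep continuous eigenvalue paths bounded *)

Section Localisation.
Variable R : realType.
Local Notation C := R[i].
Implicit Types (p q : R -> C) (l : C) (t T : R).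

Lemma mult_rc t : mult (rc t : C) = Complex (cos (pi * t)) (sin (pi * t)).
Proof.
rewrite /mult /cexp /piC; have -> : ci R * rc pi * rc t = Complex 0 (pi * t).
  by apply: complex_ext; rewrite !ReE /= ?ReE /=; ring.
by rewrite /= expR0 !mul1r.
Qed.

Lemma mult_rc_sum t : mult (rc t : C) + mult (- rc t) = rc (2 * cos (pi * t)).
Proof.
rewrite -rcN !mult_rc mulrN cosN sinN; apply: complex_ext; rewrite ReE /=; ring.
Qed.

Lemma cmod_mult l : cmod (mult l) = expR (- (pi * Im l)).
Proof.
rewrite /mult cmod_cexp; congr expR; rewrite /piC ?ReE /= ?ReE /= ?ReE /=; ring.
Qed.

Lemma mult_line l n : `|Re l| = n%:R -> mult l + mult (- l) =
  (-1) ^+ n * rc (expR (pi * Im l) + expR (- (pi * Im l))).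
Proof.
have cn (m : nat) : cos (m%:R * pi) = (-1) ^+ m :> R.
  elim: m => [|m IH]; first by rewrite mul0r cos0.
  by rewrite -natr1 mulrDl mul1r cosDpi IH exprS mulN1r.
have sn (m : nat) : sin (m%:R * pi) = 0 :> R.
  elim: m => [|m IH]; first by rewrite mul0r sin0.
  by rewrite -natr1 mulrDl mul1r sinDpi IH oppr0.
have rs (m : nat) : rc ((-1) ^+ m : R) = (-1) ^+ m.
  by elim: m => [|m IH]; rewrite ?expr0 // !exprS rcM rcN IH.
have mc z : mult z = Complex (expR (- (pi * Im z)) * cos (pi * Re z)) (expR (- (pi * Im z)) * sin (pi * Re z)).
  rewrite /mult /cexp /piC; congr (Complex (expR _ * cos _) (expR _ * sin _));
    by rewrite ?ReE /= ?ReE /= ?ReE /=; ring.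
move=> ln; have [c1 s1] : cos (pi * Re l) = (-1) ^+ n /\ sin (pi * Re l) = 0.
  have [h|h] := ger0P (Re l).
    by rewrite ger0_norm // in ln; rewrite ln mulrC cn sn.
  rewrite ltr0_norm // in ln; have -> : Re l = - n%:R by rewrite -ln opprK.
  by rewrite mulrN cosN sinN mulrC cn sn oppr0.
rewrite !mc ReN ImN !mulrN opprK cosN sinN c1 s1 -rs -rcM.
by apply: complex_ext; rewrite !ReE /=; ring.
Qed.

Lemma half_sum_ge1 (X Y : R) : 0 < X -> 0 < Y -> X * Y = 1 -> 1 <= X + Y - 1 / 2 * X.
Proof.
move=> X0 Y0 XY.
have h : 0 <= X * (X + Y - 1 / 2 * X - 1).
  have -> : X * (X + Y - 1 / 2 * X - 1) = X * Y - 1 / 2 + 1 / 2 * (X - 1) ^+ 2 by field.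
  by rewrite XY; have := sqr_ge0 (X - 1); lra.
by move: h; rewrite pmulr_rge0 // subr_ge0.
Qed.

(** On |Re l| = n the main term is (-1)^n times 2 cosh(pi Im l), larger than the error by at least
    1, so the real number 2 cos(pi t) has the sign (-1)^n and modulus at least 1. *)
Lemma line_Re p q : BVc p -> BVc q -> exists2 T : R, 0 < T & forall l n t, `|Re l| = n%:R -> T <= n%:R ->
  Fdisc p q l = mult (rc t) + mult (- rc t) -> if odd n then cos (pi * t) <= - (1 / 2) else 1 / 2 <= cos (pi * t).
Proof.
move=> bp bq; have [T T0 hT] := Fdisc_asymptotics bp bq; exists T => // l n t ln nT.
rewrite mult_rc_sum => Fl; have := hT l (or_intror (ex_intro _ n (conj ln nT))).
rewrite Fl (mult_line ln); set S : R := expR _ + expR _.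
have S1 : 1 <= S - 1 / 2 * expR (pi * `|Im l|).
  have ee : expR (pi * Im l) * expR (- (pi * Im l)) = 1 by rewrite -expRD subrr expR0.
  have [h|h] := ger0P (Im l).
    by rewrite /S; apply: half_sum_ge1; rewrite ?expR_gt0.
  by rewrite mulrN /S (addrC (expR _)); apply: half_sum_ge1; rewrite ?expR_gt0 // mulrC.
move=> h; have {h} := le_trans (Re_le _) h.
rewrite -signr_odd; case: (odd n) => /=.
  by rewrite ler_norml => /andP[_]; lra.
by rewrite ler_norml => /andP[]; lra.
Qed.

Lemma Im_bounded p q : BVc p -> BVc q -> exists2 T : R, 0 < T & forall l t,
  Fdisc p q l = mult (rc t) + mult (- rc t) -> `|Im l| <= T.
Proof.
move=> bp bq; have [T T0 hT] := Fdisc_asymptotics bp bq.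
(* With X = exp(pi |Im l|) the asymptotics give X - 1 <= 2 + X / 2, so X <= 6, whereas |Im l| > 6
   makes X at least 7. *)
exists (Num.max T 6); first by rewrite lt_max T0.
move=> l t Fl; rewrite leNgt; apply/negP; rewrite gt_max => /andP[Tl l5].
have := hT l (or_introl (ltW Tl)); rewrite Fl => h.
have F2 : cmod (mult (rc t : C) + mult (- rc t)) <= 2.
  rewrite mult_rc_sum cmod_rc normrM ger0_norm // ler_piMr //.
  by rewrite ler_norml cos_geN1 cos_le1.
have := cmod_dist (mult l + mult (- l)) (mult (rc t) + mult (- rc t)); rewrite cmod_distC => h1.
have big : expR (pi * `|Im l|) - 1 <= cmod (mult l + mult (- l)).
  have [h2|h2] := ger0P (Im l).
    apply: (@le_trans _ _ (cmod (mult (- l)) - cmod (- mult l))).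
      rewrite cmodN !cmod_mult ImN mulrN opprK lerD2l lerN2 -expR0 ler_expR oppr_le0 mulr_ge0 ?pi_ge0 //.
    by have := cmod_dist (mult (- l)) (- mult l); rewrite opprK (addrC (mult (- l))).
  rewrite mulrN; apply: (@le_trans _ _ (cmod (mult l) - cmod (- mult (- l)))).
    rewrite cmodN !cmod_mult ImN mulrN opprK lerD2l lerN2 -expR0 ler_expR.
    by rewrite mulr_ge0_le0 ?pi_ge0 // ltW.
  by have := cmod_dist (mult l) (- mult (- l)); rewrite opprK.
have e7 : 7 <= expR (pi * `|Im l|).
  rewrite (le_trans _ (expR_ge1Dx _)) //.
  have : 6 <= pi * `|Im l|.
    rewrite -[leLHS]mul1r; apply: ler_pM => //; last exact: ltW.
    by rewrite (le_trans _ (pi_ge2 R)) // ler1n.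
  lra.
lra.
Qed.

(** Intermediate value theorem: |Re g| is below n at the midpoint and never equals n, because on
    such a line cos(pi t) would be at least 1/2 in modulus with the sign dictated by the parity of
    n. *)
Lemma path_bounded p q (g : R -> C) (a b : R) : BVc p -> BVc q -> a < b ->
  (forall t, a < t < b -> Fdisc p q (g t) = mult (rc t) + mult (- rc t)) ->
  (forall t, a < t < b -> {for t, continuous (fun t => Re (g t))}) ->
  (forall t, a < t < b -> - (1 / 2) < cos (pi * t)) \/ (forall t, a < t < b -> cos (pi * t) < 1 / 2) ->
  exists M : R, forall t, a < t < b -> cmod (g t) <= M.
Proof.
move=> bp bq ab Fg cg cosab.
have [T T0 hT] := line_Re bp bq; have [S S0 hS] := Im_bounded bp bq.
pose t1 := (a + b) / 2; have t1I : a < t1 < b by rewrite !midf_lt.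
pose m := Num.bound (`|T| + `|Re (g t1)|).
have mb : `|T| + `|Re (g t1)| < m%:R.
  by rewrite (le_lt_trans _ (archi_boundP _)) ?ler_norm // addr_ge0.
(* Odd n if cos(pi t) > -1/2 on the interval, even n if cos(pi t) < 1/2. *)
have [n [nm no]] : exists n, (m <= n)%N /\ (forall t, a < t < b ->
    ~ (if odd n then cos (pi * t) <= - (1 / 2) else 1 / 2 <= cos (pi * t))).
  case: cosab => hc.
    exists (m.*2.+1); split; first by lia.
    by move=> t tI; rewrite /= odd_double /=; apply/negP; rewrite -ltNge hc.
  exists m.*2; split; first by lia.
  by move=> t tI; rewrite odd_double; apply/negP; rewrite -ltNge hc.
have mn : (m%:R : R) <= n%:R by rewrite ler_nat.
have Tn : T <= n%:R.
  have := ler_norm T; have := normr_ge0 (Re (g t1)); lra.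
have t1n : `|Re (g t1)| < n%:R by have := normr_ge0 T; lra.
have nohit t : a < t < b -> `|Re (g t)| <> n%:R.
  by move=> tI e; apply: (no t tI); exact: hT e Tn (Fg t tI).
have cseg u v : a < u -> v < b -> {within `[u, v], continuous (fun t => `|Re (g t)|)}.
  move=> au vb; apply: continuous_in_subspaceT => t; rewrite inE /= in_itv /= => /andP[ut tv].
  apply: continuous_comp; last exact: norm_continuous.
  by apply: cg; rewrite (lt_le_trans au ut) (le_lt_trans tv vb).
exists (n%:R + S) => t tI; have {}Fg := Fg t tI.
rewrite (le_trans (cmod_le _)) // lerD ?(hS _ _ Fg) //.
rewrite leNgt; apply/negP => tn.
have [a1 b1] := andP t1I; have [at_ tb] := andP tI.
have [h|/ltW h] := lerP t1 t.
  have [|z] := @IVT _ (fun t => `|Re (g t)|) t1 t n%:R h (cseg _ _ a1 tb).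
    by rewrite ge_min le_max (ltW t1n) (ltW tn) orbT.
  rewrite in_itv /= => /andP[z1 z2]; apply: nohit.
  by rewrite (lt_le_trans a1 z1) (le_lt_trans z2 tb).
have [|z] := @IVT _ (fun t => `|Re (g t)|) t t1 n%:R h (cseg _ _ at_ b1).
  by rewrite ge_min le_max (ltW t1n) (ltW tn) !orbT.
rewrite in_itv /= => /andP[z1 z2]; apply: nohit.
by rewrite (lt_le_trans at_ z1) (le_lt_trans z2 b1).
Qed.
End Localisation.

(** * Continuity of complex functions of a real variable *)

Section PointwiseContinuity.
Variable R : realType.
Local Notation C := R[i].
Implicit Types (g : R -> C) (t s e d K : R).

Definition ccont g t := forall e, 0 < e -> exists2 d, 0 < d & forall s, `|s - t| < d -> cmod (g s - g t) < e.

Lemma ccont_Re g t : ccont g t -> {for t, continuous (fun s => Re (g s))}.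
Proof.
move=> h; apply/cvgrPdist_lt => e e0; have [d d0 hd] := h e e0.
apply/nbhs_normP; exists d => // s /=; rewrite (distrC t) => /hd hs.
by rewrite distrC -ReB (le_lt_trans (Re_le _)).
Qed.

Lemma ccont_Im g t : ccont g t -> {for t, continuous (fun s => Im (g s))}.
Proof.
move=> h; apply/cvgrPdist_lt => e e0; have [d d0 hd] := h e e0.
apply/nbhs_normP; exists d => // s /=; rewrite (distrC t) => /hd hs.
by rewrite distrC -ImB (le_lt_trans (Im_le _)).
Qed.

Lemma ccont_ReIm g t : {for t, continuous (fun s => Re (g s))} -> {for t, continuous (fun s => Im (g s))} ->
  ccont g t.
Proof.
move=> /cvgrPdist_lt h /cvgrPdist_lt k e e0; have e20 : 0 < e / 2 by rewrite divr_gt0.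
have /nbhs_normP[d /= d0 hd] := h _ e20; have /nbhs_normP[d' /= d'0 hd'] := k _ e20.
exists (Num.min d d') => [|s]; first by rewrite lt_min d0.
rewrite lt_min distrC => /andP[/hd /= h1 /hd' /= h2].
rewrite (le_lt_trans (cmod_le _)) // ReB ImB (splitr e) ltrD // distrC; [exact: h1|exact: h2].
Qed.

Lemma ccont_lip g t K d : 0 < d -> (forall s, `|s - t| < d -> cmod (g s - g t) <= K * `|s - t|) -> ccont g t.
Proof.
move=> d0 h e e0; have K0 : 0 < `|K| + 1 by rewrite ltr_wpDl.
exists (Num.min d (e / (`|K| + 1))) => [|s]; first by rewrite lt_min d0 divr_gt0.
rewrite lt_min => /andP[sd]; rewrite ltr_pdivlMr // => se.
rewrite (le_lt_trans (h s sd)) // (le_lt_trans _ se) // mulrC ler_wpM2l //.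
by rewrite (le_trans (ler_norm _)) // lerDl.
Qed.

Lemma ccont_cst (a : C) t : ccont (fun=> a) t.
Proof. by move=> e e0; exists 1 => // s _; rewrite subrr cmod0. Qed.

Lemma ccontD g (k : R -> C) t : ccont g t -> ccont k t -> ccont (fun s => g s + k s) t.
Proof.
move=> hg hk e e0; have e20 : 0 < e / 2 by rewrite divr_gt0.
have [d d0 hd] := hg _ e20; have [d' d'0 hd'] := hk _ e20.
exists (Num.min d d') => [|s]; first by rewrite lt_min d0.
rewrite lt_min => /andP[/hd h1 /hd' h2].
by rewrite opprD addrACA (le_lt_trans (cmodD _ _)) // (splitr e) ltrD.
Qed.

Lemma ccontM g (k : R -> C) t : ccont g t -> ccont k t -> ccont (fun s => g s * k s) t.
Proof.
move=> hg hk; apply: ccont_ReIm.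
  rewrite (_ : (fun s => _) = (fun s => Re (g s) * Re (k s) - Im (g s) * Im (k s))).
    by apply: cvgB; apply: cvgM; [exact: ccont_Re|exact: ccont_Re|exact: ccont_Im|exact: ccont_Im].
  by apply/funext => s; rewrite ReM.
rewrite (_ : (fun s => _) = (fun s => Re (g s) * Im (k s) + Im (g s) * Re (k s))).
  by apply: cvgD; apply: cvgM; [exact: ccont_Re|exact: ccont_Im|exact: ccont_Im|exact: ccont_Re].
by apply/funext => s; rewrite ImM.
Qed.

Lemma ccontN g t : ccont g t -> ccont (fun s => - g s) t.
Proof.
move=> h e /h[d d0 hd]; exists d => // s /hd.
by rewrite -opprD cmodN.
Qed.

Lemma ccontV g t : ccont g t -> g t != 0 -> ccont (fun s => (g s)^-1) t.
Proof.
move=> h g0; have n0 : Re (g t) ^+ 2 + Im (g t) ^+ 2 != 0.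
  by rewrite -cmod_sqr expf_eq0 /= cmod_eq0.
have cn : {for t, continuous (fun s => Re (g s) ^+ 2 + Im (g s) ^+ 2)}.
  by apply: cvgD; rewrite /GRing.exp /=; apply: cvgM; first [exact: ccont_Re|exact: ccont_Im].
apply: ccont_ReIm.
  rewrite (_ : (fun s => _) = (fun s => Re (g s) / (Re (g s) ^+ 2 + Im (g s) ^+ 2))).
    by apply: cvgM; [exact: ccont_Re|exact: cvgV].
  by apply/funext => s; rewrite ReV.
rewrite (_ : (fun s => _) = (fun s => - (Im (g s) / (Re (g s) ^+ 2 + Im (g s) ^+ 2)))).
  by apply: cvgN; apply: cvgM; [exact: ccont_Im|exact: cvgV].
by apply/funext => s; rewrite ImV.
Qed.

Lemma ccont_loclip Phi g t : loclip Phi -> ccont g t -> ccont (fun s => Phi (g s)) t.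
Proof.
move=> hP hg e e0; have [B B0 hB] := hP (cmod (g t) + 1).
have [d d0 hd] := hg _ (ltr01 : 0 < (1 : R)).
have [d' d'0 hd'] := hg (e / (B + 1)) (divr_gt0 e0 (ltr_wpDl B0 ltr01)).
exists (Num.min d d') => [|s]; first by rewrite lt_min d0.
rewrite lt_min => /andP[/hd h1 /hd' h2].
have gs : cmod (g s) <= cmod (g t) + 1.
  by rewrite -{1}(subrK (g t) (g s)) (le_trans (cmodD _ _)) // addrC lerD2l ltW.
have gt : cmod (g t) <= cmod (g t) + 1 by rewrite lerDl.
rewrite (le_lt_trans (hB _ _ gt gs)) //; rewrite ltr_pdivlMr ?ltr_wpDl // in h2.
by apply: le_lt_trans h2; rewrite mulrC ler_wpM2l ?cmod_ge0 // lerDl.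
Qed.

Lemma le0_of_linear (x K d : R) : 0 < d -> (forall e, 0 < e < d -> x <= K * e) -> x <= 0.
Proof.
move=> d0 h; rewrite leNgt; apply/negP => x0.
have K0 : 0 < `|K| + 1 by rewrite ltr_wpDl.
pose e := Num.min (d / 2) (x / 2 / (`|K| + 1)).
have e0 : 0 < e by rewrite lt_min !divr_gt0.
have ed : e < d by rewrite gt_min ltr_pdivrMr // ltr_pMr // ltr1n.
have := h e; rewrite e0 ed => /(_ isT) h1.
have h2 : e * (`|K| + 1) <= x / 2 by rewrite -ler_pdivlMr // /e ge_min lexx orbT.
have h3 : K * e <= e * (`|K| + 1).
  by rewrite mulrC ler_wpM2l ?(ltW e0) // (le_trans (ler_norm _)) // lerDl.
have : x <= x / 2 by rewrite (le_trans h1) // (le_trans h3).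
by rewrite ler_pdivlMr // ger_pMr // lern1.
Qed.

(** Convergence at the single point t + r/2 bounds the coefficients, and comparison with a geometric
    series gives a Lipschitz estimate at t. *)
Lemma series_lip g (a : nat -> C) t r : 0 < r -> (forall s, `|s - t| < r ->
  series_to (fun k => a k * rc (s - t) ^+ k) (g s)) -> ccont g t.
Proof.
move=> r0 ha; pose h := r / 2; have h0 : 0 < h by rewrite divr_gt0.
have hr : h < r by rewrite ltr_pdivrMr // ltr_pMr // ltr1n.
(* A term beyond N is a difference of two partial sums, each within 1 of the limit; this is the
   summand 2 of the witness. *)
have [D D0 hD] : exists2 D, 0 <= D & forall k : nat, cmod (a k) * h ^+ k <= D.
  have := ha (t + h); rewrite addrAC subrr add0r gtr0_norm // => /(_ hr) /(_ 1 ltr01)[N hN].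
  pose T (k : nat) : C := a k * rc h ^+ k.
  have cT (k : nat) : cmod (T k) = cmod (a k) * h ^+ k by rewrite cmodM cmodX cmod_rc gtr0_norm.
  exists (\sum_(k < N) cmod (T k) + 2) => [|k]; first by rewrite addr_ge0 // sumr_ge0 // => i _; exact: cmod_ge0.
  rewrite -cT; have [kN|Nk] := ltnP k N.
    rewrite (bigD1 (Ordinal kN)) //= -addrA lerDl addr_ge0 // sumr_ge0 // => i _; exact: cmod_ge0.
  have h1 := hN k Nk; have h2 := hN k.+1 (leqW Nk).
  have TE : T k = (\sum_(i < k.+1) T i - g (t + h)) - (\sum_(i < k) T i - g (t + h)).
    by rewrite big_ord_recr /=; ring.
  rewrite TE (le_trans (cmodB _ _)) //.
  have S0 : 0 <= \sum_(k < N) cmod (T k) by rewrite sumr_ge0 // => i _; exact: cmod_ge0.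
  by move: (ltW h1) (ltW h2) => h3 h4; rewrite addrC; lra.
have part s (N : nat) : `|s - t| < h / 2 -> cmod (\sum_(k < N.+1) a k * rc (s - t) ^+ k - a 0%N) <= 2 * D / h * `|s - t|.
  move=> st; rewrite big_ord_recl /= expr0 mulr1 addrAC subrr add0r.
  pose w := `|s - t| / h; have w0 : 0 <= w by rewrite divr_ge0 // ltW.
  have w2 : w <= 1 / 2 by rewrite ler_pdivrMr // mulrC mul1r (mulrC h) mulrC ltW // mulrC.
  have ind n : cmod (\sum_(k < n) a (bump 0 k) * rc (s - t) ^+ bump 0 k) <= 2 * D * w * (1 - (1 / 2) ^+ n).
    elim: n => [|n IH]; first by rewrite big_ord0 cmod0 expr0 subrr mulr0.
    rewrite big_ord_recr /= (le_trans (cmodD _ _)) //.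
    have tm : cmod (a (bump 0 n) * rc (s - t) ^+ bump 0 n) <= D * (w * (1 / 2) ^+ n).
      have sw : `|s - t| = w * h by rewrite /w divfK // gt_eqF.
      rewrite cmodM cmodX cmod_rc sw exprMn mulrCA mulrC; apply: ler_pM => //.
      - by rewrite mulr_ge0 ?cmod_ge0 // exprn_ge0 // ltW.
      - by rewrite exprn_ge0.
      - by rewrite /bump leq0n add1n exprS ler_wpM2l // lerXn2r // nnegrE.
    have E : (1 / 2 : R) ^+ n.+1 = (1 / 2) ^+ n / 2 by rewrite exprSr mul1r.
    rewrite (le_trans (lerD IH tm)) // E.
    by rewrite le_eqVlt; apply/orP; left; apply/eqP; field.
  have -> : 2 * D / h * `|s - t| = 2 * D * w by rewrite /w; ring.
  apply: (le_trans (ind N)); apply: ler_piMr; first by apply: mulr_ge0 => //; exact: mulr_ge0.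
  by rewrite lerBlDr lerDl exprn_ge0.
have a0 : g t = a 0%N.
  apply/eqP; rewrite -subr_eq0 -cmod_eq0 eq_le cmod_ge0 andbT.
  apply/ler_addgt0Pr => e e0; rewrite add0r.
  have := ha t; rewrite subrr normr0 => /(_ r0) /(_ e e0)[N hN].
  have := hN N.+1 (leqnSn N); rewrite big_ord_recl expr0 mulr1 big1 ?addr0 => [|i _].
    by rewrite cmod_distC => /ltW.
  by rewrite /= exprS mul0r mulr0.
have h20 : 0 < h / 2 by rewrite divr_gt0.
apply: (@ccont_lip _ _ (2 * D / h) (h / 2)) => // s st.
apply/ler_addgt0Pr => e e0.
have sr : `|s - t| < r by rewrite (lt_trans st) // (lt_trans _ hr) // ltr_pdivrMr // ltr_pMr // ltr1n.
have [N hN] := ha s sr e e0.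
have h1 := hN N.+1 (leqnSn N); have h2 := part s N st.
rewrite a0; apply: le_trans (cmod_tri (\sum_(k < N.+1) a k * rc (s - t) ^+ k) _ _) _.
by rewrite addrC lerD // cmod_distC ltW.
Qed.
End PointwiseContinuity.

(** * Local properties of the labels *)

Section Labels.
Variable R : realType.
Local Notation C := R[i].
Variables p q : R -> C.
Hypotheses (Bp : BVc p) (Bq : BVc q).
Implicit Types (t : R) (l mu : C).
Local Notation F := (Fdisc p q).

Lemma BVc_cbm (r : R -> C) : BVc r -> cbm r.
Proof. by move=> /BVc_increment_bound[V /increment_bound_cbm]. Qed.

Let bp := BVc_cbm Bp.
Let bq := BVc_cbm Bq.

(** [root_order] constrains only punctured neighbourhoods; the value at [mu] itself comes from the
    continuity of F. *)
Lemma root_order_value (c0 mu : C) m : (0 < m)%N -> root_order (fun z => F z - c0) mu m -> F mu = c0.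
Proof.
move=> m0 [L L0 /(_ 1 ltr01)[d d0 hd]]; apply/eqP; rewrite -subr_eq0 -cmod_eq0 eq_le cmod_ge0 andbT.
have [B B0 hB] := loclip_F bp bq (cmod mu + 1).
apply: (@le0_of_linear _ _ (cmod L + 1 + B) (Num.min d 1)) => [|e /andP[e0]]; first by rewrite lt_min d0 ltr01.
rewrite lt_min => /andP[ed e1]; have ce : cmod (rc e : C) = e by rewrite cmod_rc gtr0_norm.
have := hd (mu + rc e); rewrite addrAC subrr add0r ce e0 ed => /(_ isT) h.
have mm : cmod mu <= cmod mu + 1 by rewrite lerDl.
have me : cmod (mu + rc e) <= cmod mu + 1 by rewrite (le_trans (cmodD _ _)) // ce lerD2l ltW.
have := hB mu (mu + rc e) mm me; rewrite [mu + rc e - mu]addrAC subrr add0r ce => h2.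
have em : e ^+ m <= e by rewrite -[leRHS]expr1; apply: ler_wiXn2l; rewrite // ltW.
have h3 : cmod (F (mu + rc e) - c0) <= (cmod L + 1) * e.
  have -> : F (mu + rc e) - c0 = (F (mu + rc e) - c0) / rc e ^+ m * rc e ^+ m.
    by rewrite divfK // expf_neq0 // -cmod_eq0 ce gt_eqF.
  rewrite cmodM cmodX ce; apply: ler_pM => //; rewrite ?cmod_ge0 ?exprn_ge0 ?(ltW e0) //.
  move: h; set Z := _ / _ => h; rewrite -(subrK L Z) (le_trans (cmodD _ _)) // addrC lerD2l.
  exact: ltW.
rewrite -(subrKA (F (mu + rc e))) (le_trans (cmodD _ _)) // cmod_distC addrC mulrDl; exact: lerD.
Qed.

(** If G vanished, F - c0 would be O(e^2) at distance e from [mu], and its quotient by e could not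
    have a nonzero limit. *)
Lemma simple_root_G (c0 mu : C) : F mu = c0 -> root_order (fun z => F z - c0) mu 1 -> G p q mu != 0.
Proof.
move=> Fm [L L0 hL]; apply/eqP => G0; case/negP: L0.
rewrite -cmod_eq0 eq_le cmod_ge0 andbT; apply/ler_addgt0Pr => eta eta0; rewrite add0r.
have [d d0 hd] := hL _ eta0; have [B B0 hB] := Fdisc_taylor2 bp bq (cmod mu + 1).
rewrite -subr_le0; apply: (@le0_of_linear _ _ B (Num.min d 1)) => [|e /andP[e0]]; first by rewrite lt_min d0 ltr01.
rewrite lt_min => /andP[ed e1]; have ce : cmod (rc e : C) = e by rewrite cmod_rc gtr0_norm.
have rce : rc e != 0 :> C by rewrite -cmod_eq0 ce gt_eqF.
have := hd (mu + rc e); rewrite addrAC subrr add0r ce e0 ed expr1 => /(_ isT) h.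
have mm : cmod mu <= cmod mu + 1 by rewrite lerDl.
have me : cmod (mu + rc e) <= cmod mu + 1 by rewrite (le_trans (cmodD _ _)) // ce lerD2l ltW.
have := hB mu (mu + rc e) mm me; rewrite [mu + rc e - mu]addrAC subrr add0r ce G0 mulr0 subr0 Fm => h2.
have h3 : cmod ((F (mu + rc e) - c0) / rc e) <= B * e.
  by rewrite cmodM cmodV ce ler_pdivrMr // -mulrA -expr2.
have := cmod_dist L ((F (mu + rc e) - c0) / rc e); rewrite cmod_distC; lra.
Qed.

Variable lam : int -> 'I_2 -> R -> C.
Hypothesis lab : is_labeling p q lam.
Variables (n : int) (j : 'I_2).
Local Notation lm := (lam n j).

Lemma label_char t : char_eq p q (rc t) (lm t).
Proof.
have [h _ _] := lab; have [m [ro [s [us sz hs]]]] := h t (lm t).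
apply: (root_order_value _ ro); rewrite -sz lt0n size_eq0; apply/eqP => s0.
by have := (hs (n, j)).2 erefl; rewrite s0.
Qed.

Lemma label_simple_G t : simple_lab lam n j t -> G p q (lm t) != 0.
Proof.
move=> simp; have [h _ _] := lab; have [m [ro [s [us sz hs]]]] := h t (lm t).
apply: (simple_root_G (label_char t)).
(* Simplicity leaves (n, j) as the only label with this value, so the list has length 1, and that
   length is the order of the root. *)
suff s1 : s = [:: (n, j)] by move: ro; rewrite -sz s1.
have sin : (n, j) \in s by apply/hs.
have : perm_eq s [:: (n, j)].
  apply: uniq_perm => // -[m1 i1]; rewrite inE; apply/idP/eqP => [/hs /= e|->//].
  by apply/eqP; apply/negPn/negP => /simp; rewrite e eqxx.
by move=> pe; apply: (perm_small_eq _ pe).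
Qed.

Lemma label_ccont t : simple_lab lam n j t -> ccont lm t.
Proof.
move=> simp; have [_ h _] := lab; have [r r0 [a ha]] := h n j t simp.
exact: series_lip r0 ha.
Qed.

Lemma label_isolated t : exists2 d, 0 < d & forall s, 0 < `|s - t| < d -> simple_lab lam n j s.
Proof.
have [_ _ h] := lab; have [sq hsq] := h n j (`|t| + 1).
have [d d0 hd] : exists2 d : R, 0 < d & forall s, s \in sq -> s != t -> d <= `|s - t|.
  elim: sq {hsq} => [|a sq [d d0 IH]]; first by exists 1.
  have [->|at_] := eqVneq a t.
    exists d => // s; rewrite inE => /orP[/eqP->|/IH//]; by rewrite eqxx.
  exists (Num.min d `|a - t|); first by rewrite lt_min d0 normr_gt0 subr_eq0.
  move=> s; rewrite inE => /orP[/eqP-> _|/IH h1 /h1 h2]; rewrite ge_min ?lexx ?orbT // h2 //.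
exists (Num.min d 1) => [|s /andP[s0]]; first by rewrite lt_min d0 ltr01.
rewrite lt_min => /andP[sd s1]; have st : s != t by rewrite -subr_eq0 -normr_gt0.
have sM : `|s| <= `|t| + 1.
  by rewrite -(subrK t s) (le_trans (ler_normD _ _)) // addrC lerD2l ltW.
apply: contrapT => ns; have := hd s (hsq s sM ns) st; by rewrite leNgt sd.
Qed.

Lemma label_eqF t : F (lm t) = mult (rc t) + mult (- rc t).
Proof. exact: (char_eqE p q (rc t) (lm t)).1 (label_char t). Qed.

Lemma cos_continuous_scale (t : R) : forall e, 0 < e -> exists2 d, 0 < d & forall s, `|s - t| < d ->
  `|cos (pi * s) - cos (pi * t)| < e.
Proof.
move=> e e0; have h : {for t, continuous (fun s : R => cos (pi * s))}.
  apply: differentiable_continuous; apply/derivable1_diffP.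
  by case: (is_derive_cos_scale pi t).
have /cvgrPdist_lt/(_ _ e0)/nbhs_normP[d /= d0 hd] := h.
by exists d => // s; rewrite distrC => /hd /=; rewrite distrC.
Qed.

(** On each side of t the label is continuous and [path_bounded] applies, since cos(pi s) stays
    within 1/2 of cos(pi t) and thus either above -1/2 or below 1/2. The value at t is added
    separately. *)
Lemma label_locally_bounded t : exists2 d, 0 < d & exists M, forall s, `|s - t| < d -> cmod (lm s) <= M.
Proof.
have [d1 d10 h1] := label_isolated t.
have e0 : 0 < (1 / 2 : R) by rewrite divr_gt0.
have [d2 d20 h2] := cos_continuous_scale t e0.
pose d := Num.min d1 d2; have d0 : 0 < d by rewrite lt_min d10.
have side (a b : R) : a < b -> (forall s, a < s < b -> 0 < `|s - t| < d) ->
    exists M, forall s, a < s < b -> cmod (lm s) <= M.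
  move=> ab hs; apply: (path_bounded Bp Bq ab).
  - by move=> s _; exact: label_eqF.
  - move=> s /hs/andP[s0]; rewrite lt_min => /andP[sd _]; apply: ccont_Re; apply: label_ccont.
    by apply: h1; rewrite s0.
  - have [c0|c0] := lerP 0 (cos (pi * t)); [left|right] => s /hs/andP[_];
      rewrite lt_min => /andP[_ /h2]; rewrite ltr_norml => /andP[]; lra.
have [||M1 hM1] := side (t - d) t; first by rewrite ltrBlDr ltrDl.
  move=> s /andP[a1 a2]; rewrite ltr0_norm ?subr_lt0 // opprB subr_gt0 a2 /=; lra.
have [||M2 hM2] := side t (t + d); first by rewrite ltrDl.
  move=> s /andP[a1 a2]; rewrite gtr0_norm ?subr_gt0 // a1 /=; lra.
exists d => //; exists (Num.max (cmod (lm t)) (Num.max M1 M2)) => s.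
rewrite ltr_norml => /andP[s1 s2]; rewrite !le_max; case: (ltgtP s t) => [st|st|->].
- by rewrite hM1 ?orbT // st andbT; lra.
- by rewrite hM2 ?orbT // st /=; lra.
- by rewrite lexx.
Qed.
End Labels.

(** * The Lojasiewicz inequality *)

Section CriticalValues.
Variable R : realType.
Local Notation C := R[i].
Variables p q : R -> C.
Hypotheses (bp : cbm p) (bq : cbm q).
Local Notation F := (Fdisc p q).
Local Notation G := (G p q).

(* A Lojasiewicz inequality near the level set F = c0; the exponent n/(n+1) < 1 is what makes 1/G integrable along the branches. *)
Lemma lojasiewicz_on_disc (c0 : C) (M : R) : (forall mu, exists m, root_order (fun z => F z - c0) mu m) ->
  exists2 n : nat, (0 < n)%N & forall z, cmod z <= M -> cmod (F z - c0) < n.+1%:R^-1 ->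
    cmod (F z - c0) ^+ n <= n.+1%:R * cmod (G z) ^+ n.+1.
Proof.
move=> ro.
have nat_id (k i : nat) : (k.+1 * (k + i) = i + k * (k + i).+1)%N by rewrite mulSn mulnS; lia.
pose K : set (R * R) := [set` `[- M, M]] `*` [set` `[- M, M]].
have cK : compact K by apply: compact_setX; exact: segment_compact.
have /compact_near_coveringP cover := cK.
pose Z (w : R * R) : C := Complex w.1 w.2.
(* One integer n serves as exponent, constant and threshold, so that a property holding near each
   point for all large n becomes uniform by compactness. *)
pose Q (n : nat) (w : R * R) := cmod (F (Z w) - c0) < n.+1%:R^-1 ->
    cmod (F (Z w) - c0) ^+ n <= n.+1%:R * cmod (G (Z w)) ^+ n.+1.
have local (w : R * R) : exists2 d : R, 0 < d & exists N : nat, forall n w', (N <= n)%N ->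
    cmod (Z w' - Z w) < d -> Q n w'.
  have [Fc|Fc] := eqVneq (F (Z w)) c0; last first.
    have e0 : 0 < cmod (F (Z w) - c0) by rewrite cmod_gt0 subr_eq0.
    have [B B0 hB] := loclip_F bp bq (cmod (Z w) + 1).
    set e := cmod (F (Z w) - c0) in e0.
    have B10 : 0 < B + 1 by rewrite ltr_wpDl.
    exists (Num.min 1 (e / 2 / (B + 1))); first by rewrite lt_min ltr01 !divr_gt0.
    (* Off the level set |F - c0| stays above e / 2 nearby, so for n beyond 2 / e the premise |F -
       c0| < 1/(n+1) fails. *)
    exists (Num.bound (2 / e)) => n w' Nn; rewrite lt_min => /andP[w1 wd]; rewrite /Q => small.
    exfalso; move: small; apply/negP; rewrite -leNgt.
    have zz : cmod (Z w) <= cmod (Z w) + 1 by rewrite lerDl.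
    have zw : cmod (Z w') <= cmod (Z w) + 1.
      by rewrite -{1}(subrK (Z w) (Z w')) (le_trans (cmodD _ _)) // addrC lerD2l ltW.
    have h := hB _ _ zz zw.
    have h2 : cmod (F (Z w') - F (Z w)) <= e / 2.
      rewrite (le_trans h) // (le_trans (_ : _ <= cmod (Z w' - Z w) * (B + 1))) //.
        by rewrite mulrC ler_wpM2l ?cmod_ge0 // lerDl.
      by rewrite -ler_pdivlMr // ltW.
    have h3 : e / 2 <= cmod (F (Z w') - c0).
      have := cmod_dist (F (Z w) - c0) (F (Z w) - F (Z w')).
      have -> : F (Z w) - c0 - (F (Z w) - F (Z w')) = F (Z w') - c0 by ring.
      rewrite -/e (cmod_distC (F (Z w))) => h4.
      have : e / 2 + e / 2 = e by rewrite -splitr.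
      lra.
    apply: le_trans h3; rewrite -[leRHS]invrK lef_pV2 ?posrE ?ltr0n ?invr_gt0 ?divr_gt0 //.
    rewrite invfM invrK mulrC; apply: ltW; apply: lt_le_trans (archi_boundP _) _.
      by rewrite divr_ge0 // ltW.
    by rewrite ler_nat leqW.
  have [m rm] := ro (Z w).
  have [k [a [b [d [a0 b0 d0 hd]]]]] := G_lower_bound bp bq rm Fc.
  exists (Num.min d (a / b)); first by rewrite lt_min d0 divr_gt0.
  (* For n = k + i the bounds |F - c0| <= b W^(k+1) and |G| >= a W^k reduce the claim to (b W)^i <=
     a^i, true as W < a / b, and to b^k / a^(k+1) <= n + 1. *)
  exists (maxn k.+1 (Num.bound (b ^+ k / a ^+ k.+1))) => n w'.
  rewrite geq_max => /andP[kn Nn]; rewrite lt_min => /andP[wd wab]; rewrite /Q => _.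
  pose W := cmod (Z w' - Z w); have W0 : 0 <= W := cmod_ge0 _.
  have [ww|ww] := eqVneq (Z w' - Z w) 0.
    rewrite (subr0_eq ww) Fc subrr cmod0 expr0n; case: n kn {Nn} => // n _ /=.
    by rewrite mulr_ge0 // exprn_ge0 // cmod_ge0.
  have Wp : 0 < W by rewrite cmod_gt0.
  have := hd (Z w' - Z w); rewrite -/W Wp wd => /(_ isT).
  have -> : Z w + (Z w' - Z w) = Z w' by rewrite addrC subrK.
  move=> [Fb Ga].
  have p1 : cmod (F (Z w') - c0) ^+ n <= (b * W ^+ k.+1) ^+ n.
    by apply: lerXn2r Fb; rewrite nnegrE ?cmod_ge0 // mulr_ge0 ?exprn_ge0 // ltW.
  have p2 : (a * W ^+ k) ^+ n.+1 <= cmod (G (Z w')) ^+ n.+1.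
    by apply: lerXn2r Ga; rewrite nnegrE ?cmod_ge0 // mulr_ge0 ?exprn_ge0 // ltW.
  apply: (le_trans p1); apply: le_trans (ler_wpM2l (ler0n _ _) p2).
  have [i ni] : exists i, n = (k + i)%N by exists (n - k)%N; rewrite subnKC // ltnW.
  have e1 : (b * W ^+ k.+1) ^+ n = (b ^+ k * (b * W) ^+ i) * W ^+ (k * n.+1).
    rewrite ni exprMn -exprM exprMn.
    rewrite nat_id.
    by rewrite !exprD; ring.
  have e2 : n.+1%:R * (a * W ^+ k) ^+ n.+1 = n.+1%:R * (a ^+ k.+1 * a ^+ i) * W ^+ (k * n.+1).
    by rewrite exprMn -exprM -exprD mulrA ni.
  rewrite e1 e2 ler_wpM2r ?exprn_ge0 //.
  rewrite mulrA; apply: ler_pM; rewrite ?exprn_ge0 ?mulr_ge0 ?(ltW b0) //.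
    rewrite -ler_pdivrMr ?exprn_gt0 //; apply: ltW; apply: lt_le_trans (archi_boundP _) _.
      by rewrite divr_ge0 // exprn_ge0 // ltW.
    by rewrite ler_nat leqW.
  apply: lerXn2r; rewrite ?nnegrE ?mulr_ge0 ?(ltW b0) ?(ltW a0) //.
  by rewrite mulrC -ler_pdivlMr // ltW.
have [N _ hN] : \forall n \near \oo, K `<=` Q n.
  apply: cover => w _; have [d d0 [N hN]] := local w.
  exists (ball w.1 (d / 2) `*` ball w.2 (d / 2), [set n | (N <= n)%N]).
    split => /=; last by exists N.
    exists (ball w.1 (d / 2), ball w.2 (d / 2)) => //=.
    by split; apply: nbhsx_ballx; rewrite divr_gt0.
  move=> [w' n] [[b1 b2] Nn]; apply: (hN n w' Nn).
  rewrite (le_lt_trans (cmod_le _)) // ReB ImB /= (splitr d) ltrD // distrC; [exact: b1|exact: b2].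
exists N.+1 => // -[x y] zM; apply: (hN N.+1 (leqnSn N) (x, y)).
by split; rewrite /= in_itv /= -ler_norml; apply: le_trans zM; [exact: (Re_le (Complex x y))|exact: (Im_le (Complex x y))].
Qed.
End CriticalValues.

(** * Integrability from local bounds *)

Section LocalIntegrability.
Variable R : realType.
Local Notation mu := (@lebesgue_measure R).
Implicit Types (f : R -> R) (t r d : R) (n k : nat).

(* No measurability is needed: the integral of a nonnegative function is a supremum over simple functions below it. *)
Lemma ge0_integral_mono_sub (D E : set R) (f g : R -> \bar R) : D `<=` E ->
  (forall x, D x -> 0 <= f x)%E -> (forall x, D x -> f x <= g x)%E -> (forall x, E x -> 0 <= g x)%E ->
  (\int[mu]_(x in D) f x <= \int[mu]_(x in E) g x)%E.
Proof.
move=> DE f0 fg g0; rewrite !ge0_integralE //.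
apply: ereal_sup_le => _ [h /= hf <-]; exists h => //= x; apply: le_trans (hf x) _.
rewrite !patchE; case: ifPn => [/set_mem Dx|_].
  by rewrite mem_set ?fg //; exact: DE.
by case: ifPn => // /set_mem; exact: g0.
Qed.

(** On a non-measurable E measurability of f is vacuous, since [measurable_fun] presupposes a
    measurable domain, and finiteness of the integral passes to subsets by monotonicity. *)
Lemma integrable_subset_any (D E : set R) f : E `<=` D -> measurable D ->
  mu.-integrable D (EFin \o f) -> mu.-integrable E (EFin \o f).
Proof.
move=> ED mD intf; have [mE|nE] := pselect (measurable E); first exact: integrableS intf.
apply/integrableP; split; first by move=> /nE.
have [_ fin] := integrableP _ _ _ intf.
by apply: le_lt_trans fin; exact: ge0_integral_mono_sub.
Qed.

Lemma measurable_abs_EFin (D : set R) f : measurable_fun D f -> measurable_fun D (fun x => `|(f x)%:E|%E).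
Proof.
move=> mf; have h : measurable_fun D (fun x => `|f x|) by exact: measurableT_comp.
exact/measurable_EFinP.
Qed.

Lemma integrable_union (A B : set R) f : measurable A -> measurable B ->
  mu.-integrable A (EFin \o f) -> mu.-integrable B (EFin \o f) -> mu.-integrable (A `|` B) (EFin \o f).
Proof.
move=> mA mB /integrableP[/measurable_EFinP fA iA] /integrableP[/measurable_EFinP fB iB].
have mfU : measurable_fun (A `|` B) f by apply/measurable_funU.
apply/integrableP; split; first exact/measurable_EFinP.
have AB : A `|` B = A `|` (B `\` A).
  apply/seteqP; split=> x; last by move=> [h|[h _]]; [left|right].
  by have [h _|h [//|h']] := pselect (A x); [left|right].
rewrite AB ge0_integral_setU //; last 3 first.
- exact: measurableD.
- by rewrite -AB; exact: measurable_abs_EFin.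
- by apply/disj_setPS => x [h1 [_ h2]]; exact: h2.
rewrite lte_add_pinfty //; by apply: le_lt_trans iB; apply: ge0_integral_mono_sub => //.
Qed.

Lemma measurable_punctured f (D : set R) t : measurable D -> measurable_fun (D `\ t) f -> measurable_fun D f.
Proof.
move=> mD mf; have [Dt|nDt] := pselect (D t); last by rewrite -(not_setD1 nDt).
rewrite -(setD1K Dt); apply/measurable_funU => //; first exact: measurableD.
by split=> //; exact: measurable_fun_set1.
Qed.

(** The shells r_(k+1) <= |x - t| < r_k contribute at most 2 M_k r_k each, which sums geometrically;
    monotone convergence over the complements of shrinking balls reaches the punctured ball. *)
Lemma integrable_dyadic f t d (M r : nat -> R) K : 0 < d -> measurable_fun (ball t d `\ t) f ->
  r 0%N = d -> (forall k, 0 < r k) -> (forall k, r k.+1 <= r k) -> (forall e, 0 < e -> exists k, r k < e) ->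
  (forall k x, r k.+1 <= `|x - t| -> `|x - t| < r k -> `|f x| <= M k) -> (forall k, 0 <= M k) -> 0 <= K ->
  (forall k, M k * (2 * r k) <= K / 2 ^+ k.+1) -> mu.-integrable (ball t d) (EFin \o f).
Proof.
move=> d0 mf r0 rp rmono rlim fM M0 K0 MK.
have mball x e : measurable (ball x e : set R) by apply: open_measurable; exact: ball_open.
have ballE x (e : R) y : ball x e y <-> `|y - x| < e by rewrite -ball_normE /= distrC.
pose A k := ball t d `\` ball t (r k).
have mA k : measurable (A k) by exact: measurableD.
have rle k j : (k <= j)%N -> r j <= r k.
  move=> kj; rewrite -(subnK kj); elim: (j - k)%N => [|i IH]; first by rewrite add0n.
  by rewrite addSn (le_trans (rmono _)).
have mfA k : measurable_fun (A k) f.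
  apply: measurable_funS mf; first exact: measurableD.
  move=> x [h1 h2]; split=> // xt; apply: h2; rewrite xt; apply: ballxx; exact: rp.
have mg (D : set R) : measurable_fun D f -> measurable_fun D (fun x => `|(f x)%:E|%E).
  exact: measurable_abs_EFin.
have bound k : (\int[mu]_(x in A k) `|(f x)%:E| <= (K * (1 - 1 / 2 ^+ k))%:E)%E.
  elim: k => [|k IH].
    by rewrite /A r0 setDv integral_set0 expr0 divr1 subrr mulr0.
  pose B := ball t (r k) `\` ball t (r k.+1).
  have mB : measurable B by exact: measurableD.
  have AE : A k.+1 = A k `|` B.
    apply/seteqP; split=> x; rewrite /A /B /=.
      move=> [h1 h2]; have [h3|h3] := pselect (ball t (r k) x); [right|left]; by split.
    move=> [[h1 h2]|[h1 h2]]; split=> //.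
      by move=> /ballE h3; apply: h2; apply/ballE; exact: lt_le_trans (rmono k).
    by apply/ballE; move/ballE: h1 => h1; rewrite (lt_le_trans h1) // -r0 rle.
  rewrite AE ge0_integral_setU //; last 2 first.
  - by rewrite -AE; exact: (mg _ (mfA k.+1)).
  - by apply/disj_setPS => x [[_ h1] [h2 _]]; exact: h1.
  have BM : (\int[mu]_(x in B) `|(f x)%:E| <= (M k * (2 * r k))%:E)%E.
    apply: (@le_trans _ _ (\int[mu]_(x in ball t (r k)) (M k)%:E)%E).
      apply: ge0_integral_mono_sub => [x []//| | |] x //=.
        move=> [/ballE h1 h2]; rewrite lee_fin; apply: (fM k) => //.
        by rewrite leNgt; apply/negP => /ballE.
      by move=> _; rewrite lee_fin.
    rewrite integral_cst; last exact: mball.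
    have mb := lebesgue_measure_ball t (ltW (rp k)).
    by rewrite [X in (_ * X)%E]mb -EFinM lee_fin mulr_natl.
  apply: le_trans (leeD IH BM) _; rewrite -EFinD lee_fin.
  have -> : K * (1 - 1 / 2 ^+ k.+1) = K * (1 - 1 / 2 ^+ k) + K / 2 ^+ k.+1.
    by rewrite exprS; field; rewrite expf_neq0 // pnatr_eq0.
    by rewrite lerD2l.
  exact: mA.
have AU : \bigcup_k A k = ball t d `\ t.
  apply/seteqP; split=> x.
    by move=> [k _ [h1 h2]]; split=> // xt; apply: h2; rewrite xt; apply: ballxx; exact: rp.
  move=> [h1 h2]; have xt : 0 < `|x - t| by rewrite normr_gt0 subr_eq0; apply/eqP.
  have [k hk] := rlim _ xt; exists k => //; split=> // /ballE.
  by rewrite ltNge (ltW hk).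
apply/integrableP; split.
  by apply/measurable_EFinP; apply: measurable_punctured mf.
rewrite -(@integral_setD1 _ _ t) //; last 2 first.
- exact: measurableD.
- exact: mg.
rewrite -AU; apply: (@le_lt_trans _ _ K%:E); last exact: ltry.
have ndA : nondecreasing_seq A.
  move=> k j kj; rewrite subsetEset => x [h1 h2]; split=> // /ballE h3; apply: h2; apply/ballE.
  by rewrite (lt_le_trans h3) // rle.
have cv : (\int[mu]_(x in A i) `|(f x)%:E|)%E @[i --> \oo] --> (\int[mu]_(x in \bigcup_i A i) `|(f x)%:E|)%E.
  by apply: ge0_nondecreasing_set_cvg_integral => // k; exact: (mg _ (mfA k)).
rewrite -(cvg_lim _ cv) //; apply: lime_le; first by apply/cvg_ex; eexists; exact: cv.
apply: nearW => k; apply: le_trans (bound k) _; rewrite lee_fin ler_piMr // lerBlDr lerDl.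
Qed.

(** The hypothesis is the bound f = O(|x - t|^(-n/(n+1))) raised to the power n + 1, which keeps all
    exponents integral. *)
Lemma integrable_power_singularity f t d n (Cst : R) : 0 < d -> d <= 1 -> 0 <= Cst ->
  measurable_fun (ball t d `\ t) f ->
  (forall x, 0 < `|x - t| < d -> `|f x| ^+ n.+1 * `|x - t| ^+ n <= Cst) ->
  mu.-integrable (ball t d) (EFin \o f).
Proof.
move=> d0 d1 C0 mf fC.
(* Adding 1 makes D >= 1, hence D <= D^(n+1), and no root of the constant has to be taken. *)
pose D := Cst / d ^+ n + 1; have D1 : 1 <= D by rewrite lerDr divr_ge0 // exprn_ge0 // ltW.
have D0 : 0 <= D := le_trans ler01 D1.
(* Radii shrinking by 2^(n+1) turn the singularity into the integer power 2^(n (k+1)) on the k-th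
   shell, up to the constant; the shell then carries a mass of order 2^(-k). *)
pose r k := d / 2 ^+ (n.+1 * k)%N; pose M k := D * 2 ^+ (n * k.+1)%N.
have p2 k : 0 < (2 : R) ^+ k by rewrite exprn_gt0.
have rp k : 0 < r k by rewrite divr_gt0.
have twoge k : k%:R <= (2 : R) ^+ k by rewrite -natrX ler_nat ltnW // ltn_expl.
apply: (@integrable_dyadic f t d M r (d * (D * 2 ^+ n) * 4)) => //.
- by rewrite /r muln0 expr0 divr1.
- move=> k; rewrite ler_wpM2l ?(ltW d0) // lef_pV2 ?posrE // ler_eXn2l ?ltr1n //.
  by rewrite mulnS leq_addl.
- move=> e e0; exists (Num.bound (d / e)); rewrite /r ltr_pdivrMr // mulrC -ltr_pdivrMr //.
  apply: lt_le_trans (archi_boundP _) _; first by rewrite divr_ge0 // ltW.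
  rewrite (le_trans (twoge _)) // ler_eXn2l ?ltr1n //.
  by rewrite -[leqLHS]mul1n leq_mul2r ltnS leq0n orbT.
- move=> k x h1 h2; have x0 : 0 < `|x - t| := lt_le_trans (rp _) h1.
  have rd : r k <= d by rewrite ler_pdivrMr // ler_peMr ?(ltW d0) // exprn_ege1 // ler1n.
  have := fC x; rewrite x0 (lt_le_trans h2 rd) => /(_ isT) h.
  have pn : 0 < r k.+1 ^+ n by rewrite exprn_gt0.
  have h3 : `|f x| ^+ n.+1 <= Cst / r k.+1 ^+ n.
    rewrite ler_pdivlMr //; apply: le_trans h; rewrite ler_wpM2l ?exprn_ge0 //.
    by apply: lerXn2r h1; rewrite nnegrE ?ltW.
  rewrite -(@ler_pXn2r _ n.+1) ?nnegrE ?mulr_ge0 ?(ltW (p2 _)) //.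
  apply: (le_trans h3); rewrite /M /r exprMn exprVn -!exprM invfM invrK mulrA exprMn -exprM.
  have -> : (n.+1 * k.+1 * n = n * k.+1 * n.+1)%N by rewrite (mulnC _ n) (mulnC n.+1) mulnA.
  rewrite ler_wpM2r ?(ltW (p2 _)) // (@le_trans _ _ D) //; first by rewrite lerDl.
  by rewrite -[leLHS]expr1 ler_weXn2l.
- by move=> k; rewrite mulr_ge0 // ltW.
- by rewrite !mulr_ge0 // ltW.
- move=> k; rewrite /M /r mulSn mulnS !exprD exprS.
  have := p2 k; have := p2 (n * k)%N; have := p2 n.
  move: (2 ^+ n) (2 ^+ k) (2 ^+ (n * k)) => a b c a0 b0 c0.
  rewrite le_eqVlt; apply/orP; left; apply/eqP; field.
  by rewrite !gt_eqF.
Qed.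

(** Compactness turns the local radii into one radius valid at every point, after which [a, b] is
    exhausted in finitely many steps. *)
Lemma integrable_locally f (a b : R) : a <= b ->
  (forall t, a <= t <= b -> exists2 d, 0 < d & mu.-integrable (ball t d) (EFin \o f)) ->
  mu.-integrable [set` `[a, b]] (EFin \o f).
Proof.
move=> ab loc.
have /compact_near_coveringP cover := @segment_compact R a b.
have mball x e : measurable (ball x e : set R) by apply: open_measurable; exact: ball_open.
have [N _ hN] : \forall n \near \oo, [set` `[a, b]] `<=` (fun t => mu.-integrable (ball t n.+1%:R^-1) (EFin \o f)).
  apply: cover => t; rewrite /= in_itv /= => tab; have [d d0 intd] := loc t tab.
  have d20 : 0 < d / 2 by rewrite divr_gt0.
  exists (ball t (d / 2), [set n | (Num.bound (2 / d) <= n)%N]).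
    split=> /=; [exact: nbhsx_ballx|by exists (Num.bound (2 / d))].
  move=> [s n] /= [sb nb].
  apply: integrableS intd; [exact: mball|exact: mball|] => y yb; have : n.+1%:R^-1 < d / 2.
    rewrite -[ltRHS]invrK ltf_pV2 ?posrE ?ltr0n ?invr_gt0 // invfM invrK mulrC.
    apply: lt_le_trans (archi_boundP _) _; first by rewrite divr_ge0 // ltW.
    by rewrite ler_nat leqW.
  move=> nd; rewrite (splitr d); apply: ball_triangle sb _.
  exact: le_ball (ltW nd) _ yb.
have {}hN := hN N (leqnn N).
(* Half of the common radius, so that each step of the march from a to b ends strictly inside the
   ball around the previous endpoint. *)
pose e : R := N.+1%:R^-1 / 2; have e0 : 0 < e by rewrite divr_gt0 // invr_gt0 ltr0n.
have step k : mu.-integrable [set` `[a, Num.min b (a + k%:R * e)]] (EFin \o f).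
  elim: k => [|k IH].
    rewrite mul0r addr0 (min_idPr ab) set_itv1; apply/integrableP; split.
      exact: measurable_fun_set1.
    by rewrite integral_set1 ltry.
  have [bk|kb] := lerP b (a + k%:R * e).
    by move: IH; rewrite !min_l // (le_trans bk) // lerD2l ler_wpM2r ?(ltW e0) // ler_nat.
  rewrite (min_idPr (ltW kb)) in IH.
  pose tk := a + k%:R * e.
  have atk : a <= tk by rewrite lerDl mulr_ge0 // ltW.
  have tI : [set` `[a, b]] tk by rewrite /= in_itv /= atk ltW.
  have := hN _ tI => intb.
  have sub : [set` `[a, Num.min b (a + k.+1%:R * e)]] `<=` [set` `[a, tk]] `|` ball tk N.+1%:R^-1.
    move=> x; rewrite /= !in_itv /= le_min => /and3P[ax xb xk].
    have [h|h] := lerP x tk; [left|right]; first by rewrite ax.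
    rewrite /ball /= ltr0_norm ?subr_lt0 // opprB ltrBlDl (le_lt_trans xk) //.
    rewrite -natr1 mulrDl mul1r addrA ltrD2l /e ltr_pdivrMr // ltr_pMr ?invr_gt0 ?ltr0n // ltr1n //.
  have intU : mu.-integrable ([set` `[a, tk]] `|` ball tk N.+1%:R^-1) (EFin \o f).
    by apply: integrable_union => //; exact: mball.
  apply: integrableS intU => //.
  by apply: measurableU => //; exact: mball.
have [k hk] : exists k : nat, b <= a + k%:R * e.
  exists (Num.bound ((b - a) / e)); rewrite -lerBlDl -ler_pdivrMr // ltW //.
  by apply: archi_boundP; rewrite divr_ge0 ?subr_ge0 // ltW.
by have := step k; rewrite min_l.
Qed.
End LocalIntegrability.

(** * The functions f_t and continuity of the projection formula *)

Section QuasiPeriodization.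
Variable R : realType.
Local Notation C := R[i].
Local Notation C2 := (C * C)%type.
Local Notation P f x := (cint [set` `[0, x]] f).
Local Notation pr u v := (P (dt u v) pi).
Implicit Types (k : int) (t : C) (y : R).

Lemma cbm_sum (S : seq int) (H : int -> R -> C) : (forall k, cbm (H k)) -> cbm (fun y => \sum_(k <- S) H k y).
Proof.
move=> h; elim: S => [|k S IH].
  by apply: (@cbm_ext _ (fun=> 0)) => [y _|]; [rewrite big_nil|exact: cbm_cst].
apply: (@cbm_ext _ (fun y => H k y + \sum_(k <- S) H k y)) => [y _|]; first by rewrite big_cons.
exact: cbmD.
Qed.

Lemma cint_sum (S : seq int) (H : int -> R -> C) : (forall k, cbm (H k)) ->
  P (fun y => \sum_(k <- S) H k y) pi = \sum_(k <- S) P (H k) pi.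
Proof.
move=> h; elim: S => [|k S IH].
  rewrite big_nil (@cint_eq _ _ (fun=> 0)) => [|y _]; last by rewrite big_nil.
  by rewrite cint_cst ?pi_ge0 // mulr0.
rewrite big_cons -IH -cintD //; last exact: cbm_sum.
by apply: cint_eq => y _; rewrite big_cons.
Qed.

Lemma ccont_sum (S : seq int) (H : int -> R -> C) x : (forall k, ccont (H k) x) ->
  ccont (fun y => \sum_(k <- S) H k y) x.
Proof.
move=> h; elim: S => [|k S IH].
  by rewrite (_ : (fun=> _) = fun=> 0); [exact: ccont_cst|apply/funext => y; rewrite big_nil].
rewrite (_ : (fun=> _) = fun y => H k y + \sum_(k <- S) H k y); first exact: ccontD.
by apply/funext => y; rewrite big_cons.
Qed.

Lemma ccont_cexp (g : R -> C) x : ccont g x -> ccont (fun y => cexp (g y)) x.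
Proof.
move=> h.
have e : {for x, continuous (fun y => expR (Re (g y)))}.
  exact: (continuous_comp (ccont_Re h) (@continuous_expR R _)).
have c : {for x, continuous (fun y => cos (Im (g y)))}.
  exact: (continuous_comp (ccont_Im h) (@continuous_cos R _)).
have s : {for x, continuous (fun y => sin (Im (g y)))}.
  exact: (continuous_comp (ccont_Im h) (@continuous_sin R _)).
by apply: ccont_ReIm; apply: cvgM.
Qed.

Lemma ccont_mult (g : R -> C) x : ccont g x -> ccont (fun y => mult (g y)) x.
Proof. by move=> h; apply: ccont_cexp; apply: ccontM => //; exact: ccont_cst. Qed.

Variable f : R -> C2.
Hypotheses (fc : c2continuous f) (fs : exists M : R, forall x, M < `|x| -> f x = (0, 0)).

Definition shift k : R -> C2 := fun y => f (y + k%:~R * pi).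
Definition phase k t : C := cexp (- (ci R * piC R * rc k%:~R * t)).

Lemma cbm2_shift k : cbm2 (shift k).
Proof.
have cs (g : R -> R) : continuous g -> bm (fun y => g (y + k%:~R * pi)).
  move=> cg; apply: bm_continuous; apply: continuous_in_subspaceT => y _.
  apply: (@continuous_comp _ _ _ (fun y => y + k%:~R * pi) g); last exact: cg.
  by apply: cvgD; [exact: cvg_id|exact: cvg_cst].
case: fc => h1 h2 h3 h4; split; split.
- exact: (cs _ h1).
- exact: (cs _ h2).
- exact: (cs _ h3).
- exact: (cs _ h4).
Qed.

(** For y in [0, pi] the point y + k pi leaves the support once |k| pi > M + pi, so one finite list
    of shifts serves all t. *)
Lemma ft_finite : exists S : seq int, forall t y, 0 <= y <= pi ->
  ft f t y = (\sum_(k <- S) (shift k y).1 * phase k t, \sum_(k <- S) (shift k y).2 * phase k t).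
Proof.
case: fs => M hM; have pi0 := pi_gt0 R.
have [N hN] : exists N : nat, M + pi < N%:R * pi.
  exists (Num.bound `|(M + pi) / pi|); rewrite -ltr_pdivrMr //; exact: le_lt_trans (ler_norm _) (archi_boundP (normr_ge0 _)).
pose S : seq int := [seq (i%:Z - N%:Z)%R | i <- iota 0 N.*2.+1].
have uS : uniq S by rewrite map_inj_uniq ?iota_uniq // => a b /addIr[].
have out k : k \notin S -> (N < `|k|)%N.
  apply: contraNltn => kN; apply/mapP; exists `|(k + N%:Z)%R|%N; last by lia.
  by rewrite mem_iota; lia.
have z k y : 0 <= y <= pi -> k \notin S -> shift k y = (0, 0).
  move=> /andP[y0 y1] /out kN; apply: hM.
  have h1 : N%:R * pi <= `|(k%:~R : R) * pi|.
    rewrite normrM (gtr0_norm pi0) ler_pM2r // -intr_norm -natr_absz ler_nat; exact: ltnW.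
  have h2 : `|(k%:~R : R) * pi| <= `|y + k%:~R * pi| + `|y|.
    by rewrite -{1}(addrK y (k%:~R * pi)) (addrC (k%:~R * pi)) ler_normB.
  by move: h2; rewrite (ger0_norm y0); lra.
have widen (H : int -> C) : (forall k, k \notin S -> H k = 0) -> \sum_(k \in [set: int]) H k = \sum_(k <- S) H k.
  move=> h0; rewrite [RHS]fsbig_seq //; apply/esym; apply: fsbig_widen => // k [_ /negP kS] /=; exact: h0.
by exists S => t y yI; congr (_, _); apply: widen => k kS; rewrite -/(shift k y) z // mul0r.
Qed.

Lemma cbm2_ft t : cbm2 (ft f t).
Proof.
have [S hS] := ft_finite.
split; [apply: (@cbm_ext _ (fun y => \sum_(k <- S) (shift k y).1 * phase k t))|
  apply: (@cbm_ext _ (fun y => \sum_(k <- S) (shift k y).2 * phase k t))];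
  try by move=> y yI; rewrite hS.
- by apply: cbm_sum => k; apply: cbmM; [exact: (cbm2_shift k).1|exact: cbm_cst].
- by apply: cbm_sum => k; apply: cbmM; [exact: (cbm2_shift k).2|exact: cbm_cst].
Qed.

(** Moves all dependence on t into finitely many phases; what remains is the pairing of a solution
    with a fixed function. *)
Lemma pr_ft : exists S : seq int, forall t u, cbm2 u ->
  pr (ft f t) u = \sum_(k <- S) phase k t * pr u (shift k).
Proof.
have [S hS] := ft_finite; exists S => t u hu.
rewrite (@cint_eq _ _ (fun y => \sum_(k <- S) phase k t * dt u (shift k) y)) => [|y yI].
  rewrite cint_sum => [|k]; last by apply: cbmZ; apply: cbm2_dt => //; exact: cbm2_shift.
  apply: eq_bigr => k _; rewrite cintZ //; apply: cbm2_dt => //; exact: cbm2_shift.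
rewrite /dt hS //= !mulr_suml -big_split /=; apply: eq_bigr => k _; ring.
Qed.

Lemma cmod_phase k (s : R) : cmod (phase k (rc s)) = 1.
Proof.
rewrite /phase cmod_cexp.
have -> : Re (- (ci R * piC R * rc k%:~R * rc s)) = 0.
  by rewrite ReN !(ReM, ImM) /=; ring.
exact: expR0.
Qed.

Lemma cmod_sum (S : seq int) (z : int -> C) : cmod (\sum_(k <- S) z k) <= \sum_(k <- S) cmod (z k).
Proof.
elim: S => [|k S IH]; first by rewrite !big_nil cmod0.
by rewrite !big_cons (le_trans (cmodD _ _)) // lerD2l.
Qed.

Lemma ft_bounded : exists2 D, 0 <= D & forall s : R, forall y, 0 <= y <= pi -> nrm2 (ft f (rc s) y) <= D.
Proof.
have [S hS] := ft_finite.
have /boolp.choice[K hK] : forall k, exists K : R, 0 <= K /\ forall y, 0 <= y <= pi ->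
    cmod (shift k y).1 <= K /\ cmod (shift k y).2 <= K.
  move=> k; have [/cbm_bnd[K K0 hK] /cbm_bnd[L L0 hL]] := cbm2_shift k.
  exists (K + L); split=> [|y yI]; first exact: addr_ge0.
  by split; [rewrite (le_trans (hK y yI)) // lerDl|rewrite (le_trans (hL y yI)) // lerDr].
exists (\sum_(k <- S) K k + \sum_(k <- S) K k) => [|s y yI].
  by apply: addr_ge0; apply: sumr_ge0 => k _; exact: (hK k).1.
rewrite hS // /nrm2 /=; apply: lerD; apply: (le_trans (cmod_sum _ _)); apply: ler_sum => k _;
  rewrite cmodM cmod_phase mulr1.
  exact: ((hK k).2 y yI).1.
exact: ((hK k).2 y yI).2.
Qed.

Variables p q : R -> C.
Hypotheses (bp : cbm p) (bq : cbm q).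

Lemma ccont_pr_ft (u : C -> R -> C2) (z0 : C2) (tau g : R -> C) (s : R) : family p q u z0 -> ccont tau s -> ccont g s ->
  ccont (fun r => pr (ft f (tau r)) (u (g r))) s.
Proof.
move=> fu ct cg; have [S hS] := pr_ft.
rewrite (_ : (fun=> _) = fun r => \sum_(k <- S) phase k (tau r) * pr (u (g r)) (shift k)); last first.
  by apply/funext => r; apply: hS; exact: (family_cbm2 _ fu).
apply: ccont_sum => k; apply: ccontM.
  by apply: ccont_cexp; apply: ccontN; apply: ccontM => //; exact: ccont_cst.
have h := loclip_pair bp bq fu (cbm2_shift k).
exact: (ccont_loclip h cg).
Qed.

(** Stated for the kernel formula and not for [riesz], whose eigenfunctions are chosen pointwise.
    Here [tau] may run along the real line or a contour, with [g] an eigenvalue following it. *)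
Lemma ccont_riesz (tau g : R -> C) (s x : R) : 0 <= x <= pi -> ccont tau s -> ccont g s -> G p q (g s) != 0 ->
  ccont (fun r => - (((c_fun p q (g r) x).1 * rnum1 p q (tau r) (g r) (ft f (tau r)) +
                      (s_fun p q (g r) x).1 * rnum2 p q (tau r) (g r) (ft f (tau r))) / G p q (g r))) s /\
  ccont (fun r => - (((c_fun p q (g r) x).2 * rnum1 p q (tau r) (g r) (ft f (tau r)) +
                      (s_fun p q (g r) x).2 * rnum2 p q (tau r) (g r) (ft f (tau r))) / G p q (g r))) s.
Proof.
move=> xI ct cg G0.
have cf := c_family bp bq; have sf := s_family bp bq.
have v1 (u : C -> R -> C2) z0 y : family p q u z0 -> 0 <= y <= pi -> ccont (fun r => (u (g r) y).1) s.
  by move=> fu yI; exact: (ccont_loclip (loclip_val1 bp bq fu yI) cg).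
have v2 (u : C -> R -> C2) z0 y : family p q u z0 -> 0 <= y <= pi -> ccont (fun r => (u (g r) y).2) s.
  by move=> fu yI; exact: (ccont_loclip (loclip_val2 bp bq fu yI) cg).
have gc := ccont_pr_ft cf ct cg; have gs := ccont_pr_ft sf ct cg.
have pI := piI R; have cm : ccont (fun r => mult (- tau r)) s by apply: ccont_mult; exact: ccontN.
have n1 : ccont (fun r => rnum1 p q (tau r) (g r) (ft f (tau r))) s.
  apply: ccontD; first by apply: ccontN; apply: ccontM; [exact: v1 sf pI|exact: gc].
  by apply: ccontM; [apply: ccontD; [exact: v1 cf pI|exact: ccontN]|exact: gs].
have n2 : ccont (fun r => rnum2 p q (tau r) (g r) (ft f (tau r))) s.
  apply: ccontD; last by apply: ccontM; [exact: v2 cf pI|exact: gs].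
  by apply: ccontN; apply: ccontM; [apply: ccontD; [exact: v2 sf pI|exact: ccontN]|exact: gc].
have Gi : ccont (fun r => (G p q (g r))^-1) s.
  by apply: ccontV G0; exact: (ccont_loclip (loclip_G bp bq) cg).
split; apply: ccontN; apply: ccontM => //; apply: ccontD; apply: ccontM => //;
  by [exact: v1 cf xI|exact: v1 sf xI|exact: v2 cf xI|exact: v2 sf xI].
Qed.

(** For real t the multipliers have modulus 1, so everything in [riesz_formula] except 1/G is
    bounded uniformly for l in a disc. *)
Lemma riesz_G_bound (M : R) x : 0 <= x <= pi -> exists2 B, 0 <= B & forall s l, cmod l <= M ->
  char_eq p q (rc s) l -> mult (rc s : C) != mult (- rc s) ->
  nrm2 (riesz p q (rc s) l (ft f (rc s)) x) <= B / cmod (G p q l).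
Proof.
move=> xI; have [D D0 hD] := ft_bounded; have [B B0 hB] := cs_bnd bp bq M.
pose K := 2 * (B * D) * pi; pose N := (B + 1) * K + (B + 1) * K.
have K0 : 0 <= K by rewrite !mulr_ge0 ?pi_ge0 // ltW.
have B1 : 0 <= B + 1 by rewrite addr_ge0 // ltW.
have N0 : 0 <= N by rewrite addr_ge0 // mulr_ge0.
exists (2 * (B * N + B * N)) => [|s l lM ce mm].
  by rewrite mulr_ge0 // addr_ge0 // mulr_ge0 // ltW.
rewrite (riesz_formula bp bq ce mm (cbm2_ft (rc s)) xI).
have m1 : cmod (mult (- rc s)) = 1 by rewrite cmod_mult ImN /= oppr0 mulr0 oppr0 expR0.
have prb (u : R -> C2) : cbm2 u -> (forall y, 0 <= y <= pi -> nrm2 (u y) <= B) -> cmod (pr (ft f (rc s)) u) <= K.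
  move=> cu hu; apply: cint_bnd => [||//|y yI]; [|exact: pi_ge0|].
    by apply: cbm2_dt => //; exact: cbm2_ft.
  rewrite (le_trans (cmod_dt _ _ _)) // mulrC; apply: ler_pM.
  - exact: nrm2_ge0.
  - exact: nrm2_ge0.
  - exact: hu.
  - exact: hD.
have kc := prb _ (family_cbm2 l (c_family bp bq)) (fun y yI => (hB l lM y yI).1).
have ks := prb _ (family_cbm2 l (s_family bp bq)) (fun y yI => (hB l lM y yI).2).
have [hc hs] := hB l lM pi (piI R); have [hcx hsx] := hB l lM x xI.
have n1 : cmod (rnum1 p q (rc s) l (ft f (rc s))) <= N.
  rewrite (le_trans (cmodD _ _)) //; apply: lerD.
    rewrite cmodN cmodM; apply: ler_pM; rewrite ?cmod_ge0 //.
    by rewrite (le_trans (cmod1_le _)) // (le_trans hs) // lerDl.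
  rewrite cmodM; apply: ler_pM; rewrite ?cmod_ge0 //.
  by rewrite (le_trans (cmodB _ _)) // m1 lerD2r (le_trans (cmod1_le _)).
have n2 : cmod (rnum2 p q (rc s) l (ft f (rc s))) <= N.
  rewrite (le_trans (cmodD _ _)) //; apply: lerD.
    rewrite cmodN cmodM; apply: ler_pM; rewrite ?cmod_ge0 //.
    by rewrite (le_trans (cmodB _ _)) // m1 lerD2r (le_trans (cmod2_le _)).
  rewrite cmodM; apply: ler_pM; rewrite ?cmod_ge0 //.
  by rewrite (le_trans (cmod2_le _)) // (le_trans hc) // lerDl.
have cmp (a b : C) : cmod a <= B -> cmod b <= B -> cmod (- ((a * rnum1 p q (rc s) l (ft f (rc s)) +
   b * rnum2 p q (rc s) l (ft f (rc s))) / G p q l)) <= (B * N + B * N) / cmod (G p q l).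
  move=> ha hb; rewrite cmodN cmodM cmodV; apply: ler_wpM2r; first by rewrite invr_ge0 cmod_ge0.
  by rewrite (le_trans (cmodD _ _)) //; apply: lerD; rewrite cmodM; apply: ler_pM; rewrite ?cmod_ge0.
rewrite [2 * _]mulr_natl mulr2n [leRHS]mulrDl [leLHS]/nrm2.
apply: lerD; apply: cmp.
- exact: le_trans (cmod1_le _) hcx.
- exact: le_trans (cmod1_le _) hsx.
- exact: le_trans (cmod2_le _) hcx.
- exact: le_trans (cmod2_le _) hsx.
Qed.
End QuasiPeriodization.

(** * Integrability of the projections along a label *)

Section LabelIntegrability.
Variable R : realType.
Local Notation C := R[i].
Local Notation C2 := (C * C)%type.
Local Notation leb := (@lebesgue_measure R).
Implicit Types (s t d : R).

Lemma sin_pi_neq0 t : -1 < t < 2 -> t != 0 -> t != 1 -> sin (pi * t) != 0.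
Proof.
move=> /andP[t1 t2] t0 tn1; have pi0 := pi_gt0 R.
have sp (s : R) : 0 < s < 1 -> 0 < sin (pi * s).
  by move=> /andP[s0 s1]; apply: sin_gt0_pi; rewrite mulr_gt0 //= gtr_pMr.
case: (ltgtP t 0) t0 => // tlt _.
  have := sp (- t); rewrite mulrN sinN => h; rewrite -oppr_eq0 gt_eqF // h //.
  by apply/andP; split; lra.
case: (ltgtP t 1) tn1 => // tlt1 _; first by rewrite gt_eqF // sp // tlt tlt1.
have E : pi * t = pi * (t - 1) + pi by ring.
by rewrite E sinDpi oppr_eq0 gt_eqF // sp //; apply/andP; split; lra.
Qed.

Lemma mult_rc_neq t : sin (pi * t) != 0 -> mult (rc t : C) != mult (- rc t).
Proof.
move=> s0; rewrite -rcN !mult_rc mulrN sinN; apply/eqP => -[_ e].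
by case/negP: s0; apply/eqP; lra.
Qed.

(** The derivative -pi sin(pi t0) is nonzero, and near t0 the difference quotients keep half of its
    size. *)
Lemma cos_lower t0 : sin (pi * t0) != 0 -> exists2 K : R, 0 < K & exists2 d : R, 0 < d &
  forall s, `|s - t0| < d -> K * `|s - t0| <= `|cos (pi * s) - cos (pi * t0)|.
Proof.
move=> s0; have [dv ev] := is_derive_cos_scale pi t0.
pose D := pi * sin (pi * t0); have D0 : 0 < `|D| by rewrite normr_gt0 mulf_neq0 // gt_eqF // pi_gt0.
have D20 : 0 < `|D| / 2 by rewrite divr_gt0.
exists (`|D| / 2) => //.
move: dv; rewrite /derivable => /cvg_ex[/= L hL].
have LE : L = - D by rewrite -ev /derive; apply/esym/cvg_lim.
move/cvgrPdist_lt: hL => /(_ _ D20); rewrite LE => /nbhs_ballP[d /= d0 hd].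
exists d => // s sd; have [->|st] := eqVneq s t0; first by rewrite !subrr normr0 mulr0.
have h0 : s - t0 != 0 by rewrite subr_eq0.
have := hd (s - t0); rewrite /ball /= sub0r normrN => /(_ sd h0).
rewrite /= scaler1 subrK.
set q := (s - t0)^-1 *: _ => hq.
have -> : cos (pi * s) - cos (pi * t0) = (s - t0) * q by rewrite /q; set z : R := cos _ - _; rewrite -[_ *: z]/(_ * z) mulVKf.
rewrite [leRHS]normrM [leRHS]mulrC; apply: ler_wpM2r => //.
have := ler_normB (- D - q) (- D); rewrite opprK addrAC addNr add0r normrN normrN => h.
have := ler_normD (- D - q) q; rewrite subrK normrN; lra.
Qed.

Lemma ccont_near (g k : R -> C) t d : 0 < d -> (forall s, `|s - t| < d -> g s = k s) -> ccont g t -> ccont k t.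
Proof.
move=> d0 h hg e e0; have [d' d'0 hd] := hg e e0.
exists (Num.min d d') => [|s]; first by rewrite lt_min d0.
rewrite lt_min => /andP[sd sd']; rewrite -(h s sd) -(h t) ?subrr ?normr0 //; exact: hd.
Qed.

(** Indexes the four real conditions hidden in [c2integrable], so that each estimate is made only
    once. *)
Definition component (b1 b2 : bool) (y : C2) : R :=
  let z := if b1 then y.1 else y.2 in if b2 then Re z else Im z.

Lemma component_le b1 b2 y : `|component b1 b2 y| <= nrm2 y.
Proof.
by case: b1; case: b2; rewrite /component; [apply: le_trans (Re_le _) (cmod1_le _)|
  apply: le_trans (Im_le _) (cmod1_le _)|apply: le_trans (Re_le _) (cmod2_le _)|
  apply: le_trans (Im_le _) (cmod2_le _)].
Qed.

Lemma c2integrable_component (D : set R) (g : R -> C2) :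
  (forall b1 b2, leb.-integrable D (EFin \o (fun t => component b1 b2 (g t)))) -> c2integrable D g.
Proof.
by move=> h; split; split; [exact: (h true true)|exact: (h true false)|exact: (h false true)|exact: (h false false)].
Qed.

Lemma component_continuous (g : R -> C2) t b1 b2 : ccont (fun s => (g s).1) t -> ccont (fun s => (g s).2) t ->
  {for t, continuous (fun s => component b1 b2 (g s))}.
Proof.
move=> h1 h2; case: b1; case: b2; rewrite /component.
- exact: ccont_Re h1.
- exact: ccont_Im h1.
- exact: ccont_Re h2.
- exact: ccont_Im h2.
Qed.

Variables p q : R -> C.
Hypotheses (Bp : BVc p) (Bq : BVc q).
Variable lam : int -> 'I_2 -> R -> C.
Hypothesis lab : is_labeling p q lam.
Variables (n : int) (j : 'I_2).
Local Notation lm := (lam n j).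
Variable f : R -> C2.
Hypotheses (fc : c2continuous f) (fs : exists M : R, forall x, M < `|x| -> f x = (0, 0)).
Variable x : R.
Hypothesis xI : 0 <= x <= pi.
Let bp := BVc_cbm Bp.
Let bq := BVc_cbm Bq.

Definition lriesz t : C2 := riesz p q (rc t) (lm t) (ft f (rc t)) x.

Lemma continuous_sin_scale t : sin (pi * t) != 0 -> exists2 d, 0 < d & forall s, `|s - t| < d -> sin (pi * s) != 0.
Proof.
move=> t0; have h : {for t, continuous (fun s : R => sin (pi * s))}.
  apply: differentiable_continuous; apply/derivable1_diffP; by case: (is_derive_sin_scale pi t).
have e0 : 0 < `|sin (pi * t)| by rewrite normr_gt0.
have /cvgrPdist_lt/(_ _ e0)/nbhs_normP[d /= d0 hd] := h.
exists d => // s; rewrite distrC => /hd /=; apply: contraTneq => ->.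
by rewrite subr0 ltxx.
Qed.

Lemma lriesz_ccont t : simple_lab lam n j t -> sin (pi * t) != 0 ->
  ccont (fun s => (lriesz s).1) t /\ ccont (fun s => (lriesz s).2) t.
Proof.
move=> st s0; have G0 := label_simple_G Bp Bq lab st; have cl := label_ccont lab st.
have ct : ccont (fun s => rc s : C) t.
  by apply: (@ccont_lip _ _ _ 1 1) => // s _; rewrite -rcB cmod_rc mul1r.
have [h1 h2] := ccont_riesz fc fs bp bq xI ct cl G0.
have [d d0 hd] := continuous_sin_scale s0.
have E s : `|s - t| < d -> _ := fun sd => riesz_formula bp bq (label_char Bp Bq lab n j s) (mult_rc_neq (hd s sd))
  (cbm2_ft fc fs (rc s)) xI.
split.
- by apply: (ccont_near d0 _ h1) => s sd; rewrite /lriesz (E s sd).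
- by apply: (ccont_near d0 _ h2) => s sd; rewrite /lriesz (E s sd).
Qed.

Lemma lriesz_measurable b1 b2 t0 d : (forall s, 0 < `|s - t0| < d -> simple_lab lam n j s /\ sin (pi * s) != 0) ->
  measurable_fun (ball t0 d `\ t0) (fun t => component b1 b2 (lriesz t)).
Proof.
move=> h; apply: open_continuous_measurable_fun.
  by rewrite setDE; apply: openI; [exact: ball_open|apply: closed_openC; exact: closed_eq].
move=> s; rewrite inE => -[/= sd st].
have [|ss s0] := h s.
  by rewrite normr_gt0 subr_eq0 distrC sd andbT; apply/eqP.
by have [h1 h2] := lriesz_ccont ss s0; exact: component_continuous.
Qed.

Lemma lriesz_integrable_noninteger b1 b2 t0 : sin (pi * t0) != 0 ->
  exists2 d, 0 < d & leb.-integrable (ball t0 d) (EFin \o (fun t => component b1 b2 (lriesz t))).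
Proof.
move=> s0; have [d1 d10 simp] := label_isolated lab n j t0.
have [d2 d20 [M hM]] := label_locally_bounded Bp Bq lab n j t0.
have [d3 d30 sn0] := continuous_sin_scale s0.
have [K K0 [d4 d40 cosl]] := cos_lower s0.
pose c0 := Fdisc p q (lm t0).
(* The label is not known to have a limit at t0, so the inequality is taken on a whole disc
   containing its values near t0. *)
have [N N0 loja] : exists2 N, (0 < N)%N & forall z, cmod z <= M -> cmod (Fdisc p q z - c0) < N.+1%:R^-1 ->
    cmod (Fdisc p q z - c0) ^+ N <= N.+1%:R * cmod (G p q z) ^+ N.+1.
  apply: (lojasiewicz_on_disc bp bq) => mu; have [h _ _] := lab; have [m [ro _]] := h t0 mu.
  by exists m; rewrite /c0 (label_char Bp Bq lab n j t0).
have e0 : 0 < N.+1%:R^-1 / 2 :> R by rewrite divr_gt0 // invr_gt0 ltr0n.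
have [d5 d50 cosu] := cos_continuous_scale t0 e0.
have [B B0 hB] := riesz_G_bound fc fs bp bq M xI.
pose d := Num.min (Num.min (Num.min d1 d2) (Num.min d3 d4)) (Num.min d5 1).
have d0 : 0 < d by rewrite !lt_min d10 d20 d30 d40 d50 ltr01.
have dall s : `|s - t0| < d -> [/\ `|s - t0| < d1, `|s - t0| < d2, `|s - t0| < d3, `|s - t0| < d4 & `|s - t0| < d5].
  by rewrite !lt_min => /andP[/andP[/andP[-> ->] /andP[-> ->]] /andP[-> _]].
exists d => //; pose Cst := B ^+ N.+1 * (N.+1%:R / K ^+ N).
have KN : 0 < K ^+ N by rewrite exprn_gt0.
apply: (@integrable_power_singularity _ _ _ _ N Cst) => //.
- by rewrite !ge_min lexx !orbT.
- by apply: mulr_ge0; [exact: exprn_ge0|apply: divr_ge0; [exact: ler0n|exact: ltW]].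
- apply: lriesz_measurable => s /andP[st /dall[sd1 _ sd3 _ _]]; split; last exact: sn0.
  by apply: simp; rewrite st.
move=> s /andP[st /dall[sd1 sd2 sd3 sd4 sd5]].
have G0 : 0 < cmod (G p q (lm s)).
  by rewrite cmod_gt0; apply: (label_simple_G Bp Bq lab); apply: simp; rewrite st.
have FE : cmod (Fdisc p q (lm s) - c0) = 2 * `|cos (pi * s) - cos (pi * t0)|.
  by rewrite /c0 !(label_eqF Bp Bq lab) !mult_rc_sum -rcB cmod_rc -mulrBr normrM ger0_norm.
have low : K * `|s - t0| <= cmod (Fdisc p q (lm s) - c0).
  rewrite FE (le_trans (cosl s sd4)) // ler_peMl // ler1n //.
have := loja _ (hM s sd2); rewrite {1}FE => l0.
have {l0}l1 := l0 (ltac:(by rewrite mulrC -ltr_pdivlMr //; exact: cosu)).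
have l2 : (K * `|s - t0|) ^+ N <= N.+1%:R * cmod (G p q (lm s)) ^+ N.+1.
  by apply: le_trans l1; apply: lerXn2r; rewrite // nnegrE ?cmod_ge0 // mulr_ge0 // ltW.
have l3 : `|s - t0| ^+ N / cmod (G p q (lm s)) ^+ N.+1 <= N.+1%:R / K ^+ N.
  rewrite ler_pdivrMr ?exprn_gt0 // mulrAC ler_pdivlMr // -exprMn.
  by rewrite [X in X ^+ N]mulrC.
have l4 : `|component b1 b2 (lriesz s)| <= B / cmod (G p q (lm s)).
  apply: (le_trans (component_le _ _ _)); apply: hB; first exact: hM.
    exact: label_char.
  by apply: mult_rc_neq; exact: sn0.
have l5 : `|component b1 b2 (lriesz s)| ^+ N.+1 <= B ^+ N.+1 / cmod (G p q (lm s)) ^+ N.+1.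
  rewrite -expr_div_n; apply: lerXn2r => //; rewrite nnegrE //; apply: divr_ge0 => //; exact: cmod_ge0.
apply: (le_trans (ler_wpM2r _ l5)); first exact: exprn_ge0.
by rewrite /Cst -mulrA; apply: ler_wpM2l; [exact: exprn_ge0|rewrite mulrC].
Qed.

Lemma lriesz_integrable_integer b1 b2 t0 : t0 = 0 \/ t0 = 1 -> ~ ESS p q lam (lm t0) ->
  exists2 d, 0 < d & leb.-integrable (ball t0 d) (EFin \o (fun t => component b1 b2 (lriesz t))).
Proof.
move=> t01 ness.
have [eps eps0 fin] : exists2 eps : R, 0 < eps & (\int[leb]_(t in `](t0 - eps)%R, (t0 + eps)%R[)
    ((cmod (alpha p q (rc t) (lm t)))^-1)%:E != +oo)%E.
  apply: contrapT => no; apply: ness; exists n, j, t0; split=> //.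
    by case: t01 => ->; rewrite ?lexx ?ltrN10 ?ler01 ?andbT //; lra.
  by move=> e e0; apply/eqP; apply: contrapT => /negP h; apply: no; exists e.
have [d1 d10 simp] := label_isolated lab n j t0.
have [d2 d20 [M hM]] := label_locally_bounded Bp Bq lab n j t0.
have [D D0 hD] := ft_bounded fc fs.
have [B B0 hB] := riesz_alpha_bound M D bp bq.
pose d := Num.min (Num.min d1 d2) (Num.min eps (1 / 2)).
have d0 : 0 < d by rewrite !lt_min d10 d20 eps0 /=; lra.
have dall s : `|s - t0| < d -> [/\ `|s - t0| < d1, `|s - t0| < d2, `|s - t0| < eps & `|s - t0| < 1 / 2].
  by rewrite !lt_min => /andP[/andP[-> ->] /andP[-> ->]].
exists d => //; have mb : measurable (ball t0 d) by exact: measurable_ball.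
have mf : measurable_fun (ball t0 d) (fun t => component b1 b2 (lriesz t)).
  apply: (@measurable_punctured _ _ _ t0) => //; apply: lriesz_measurable => s /andP[st /dall[sd1 _ _ s2]].
  split; first by apply: simp; rewrite st.
  move: st s2; rewrite normr_gt0 subr_eq0 ltr_norml => st /andP[a b].
  by apply: sin_pi_neq0; [case: t01 => e; apply/andP; split; lra| |];
    apply/eqP => e; case: t01 => e1; move: st; rewrite e e1 ?eqxx //; lra.
have B1 : 0 < B + 1 by rewrite ltr_wpDl.
(* The constant is put on the side of the measurable function, because 1/|alpha| is not known to be
   measurable and no factor can be pulled out of its integral. *)
have -> : EFin \o (fun t => component b1 b2 (lriesz t)) =
    (fun t => (B + 1)%:E * ((B + 1)^-1 * component b1 b2 (lriesz t))%:E)%E.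
  by apply/funext => t /=; rewrite -EFinM mulrA divff ?mul1r // gt_eqF.
apply: integrableZl => //; apply/integrableP; split.
  by apply/measurable_EFinP; exact: measurable_funM.
apply: le_lt_trans (_ : \int[leb]_(t in `](t0 - eps)%R, (t0 + eps)%R[)
    ((cmod (alpha p q (rc t) (lm t)))^-1)%:E < +oo)%E; last by rewrite ltey.
apply: ge0_integral_mono_sub => [s|s _|s|s _].
- rewrite /ball /= distrC => /dall[_ _ se _]; rewrite in_itv /=.
  by move: se; rewrite ltr_norml => /andP[a b]; apply/andP; split; lra.
- exact: abse_ge0.
- rewrite /ball /= distrC => /dall[_ sd2 _ _]; rewrite lee_fin normrM gtr0_norm ?invr_gt0 //.
  rewrite mulrC ler_pdivrMr //.
  apply: (le_trans (component_le _ _ _)).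
  apply: (le_trans (hB _ (hM s sd2) _ (label_char Bp Bq lab n j s) _ (cbm2_ft fc fs (rc s)) (hD s) x xI)).
  by rewrite mulrC; apply: ler_wpM2l; [rewrite invr_ge0 cmod_ge0|rewrite lerDl].
- by rewrite lee_fin invr_ge0 cmod_ge0.
Qed.
End LabelIntegrability.

(** * The semicircular contours *)

Section Contours.
Variable R : realType.
Local Notation C := R[i].
Local Notation C2 := (C * C)%type.
Implicit Types (s t th : R).

(** Equality of the moduli forces Im t = 0, and for real t equality means sin(pi t) = 0. *)
Lemma mult_eq_opp (t : C) : mult t = mult (- t) -> -1 < Re t < 2 -> t = 0 \/ t = 1.
Proof.
move=> e tI; have pi0 := pi_gt0 R.
have It : Im t = 0.
  have := congr1 (@cmod R) e; rewrite !cmod_mult => /expR_inj; rewrite ImN mulrN opprK => h.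
  have : pi * Im t = 0 by lra.
  by move/eqP; rewrite mulf_eq0 gt_eqF //= => /eqP.
have tE : t = rc (Re t) by apply: complex_ext.
have [t0|t0] := eqVneq (Re t) 0; first by left; rewrite tE t0.
have [t1|t1] := eqVneq (Re t) 1; first by right; rewrite tE t1.
by have := mult_rc_neq (sin_pi_neq0 tI t0 t1); rewrite -tE e eqxx.
Qed.

Lemma gam0E (h th : R) : gam0 h th = Complex (h * cos th) (h * sin th).
Proof.
by apply: complex_ext; rewrite /gam0 /cexp ?ReM ?ImM /= !mul0r !mul1r ?subr0 ?sub0r ?oppr0 ?add0r ?addr0 expR0 !mul1r.
Qed.

Lemma cmod_gam0 (h th : R) : 0 <= h -> cmod (gam0 h th) = h.
Proof.
move=> h0; have e := cos2Dsin2 th; rewrite gam0E cmodE /=.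
by rewrite !exprMn -mulrDr e mulr1 sqrtr_sqr ger0_norm.
Qed.

Lemma ccont_gam0 (h th : R) : ccont (gam0 h) th.
Proof.
apply: ccontM; first exact: ccont_cst.
apply: ccont_cexp; apply: ccontM; first exact: ccont_cst.
by apply: (@ccont_lip _ _ _ 1 1) => // s _; rewrite -rcB cmod_rc mul1r.
Qed.

Lemma ccont_gam1 (h th : R) : ccont (gam1 h) th.
Proof. by apply: ccontD; [exact: ccont_cst|exact: ccont_gam0]. Qed.

Lemma ccont_dgam (h th : R) : ccont (dgam h) th.
Proof.
rewrite (_ : dgam h = fun s => ci R * gam0 h s); last by apply/funext => s; rewrite /dgam /gam0 mulrA.
by apply: ccontM; [exact: ccont_cst|exact: ccont_gam0].
Qed.

Variables p q : R -> C.
Hypotheses (bp : cbm p) (bq : cbm q).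

Lemma has_cderiv_G0 (z : C) : G p q z = 0 -> has_cderiv (Fdisc p q) z 0.
Proof.
move=> G0 e e0; have [B B0 hB] := Fdisc_taylor2 bp bq (cmod z + 1).
have B1 : 0 < B + 1 by rewrite ltr_wpDl.
exists (Num.min 1 (e / (B + 1))) => [|w /andP[w0]]; first by rewrite lt_min ltr01 divr_gt0.
rewrite lt_min => /andP[w1]; rewrite ltr_pdivlMr // => we.
have zM : cmod z <= cmod z + 1 by rewrite lerDl.
have wM : cmod w <= cmod z + 1 by rewrite -{1}(subrK z w) (le_trans (cmodD _ _)) // addrC lerD2l ltW.
have := hB z w zM wM; rewrite G0 mulr0 !subr0 => h.
rewrite cmodM cmodV ltr_pdivrMr // (le_lt_trans h) // expr2 mulrA ltr_pM2r // (le_lt_trans _ we) //.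
by rewrite mulrC ler_wpM2l ?cmod_ge0 // lerDl.
Qed.

Lemma Aset_G (h : R) (t l : C) : `|Im t| <= 2 * h -> - h <= Re t <= 2 - h -> ~ Aset p q h t ->
  char_eq p q t l -> G p q l != 0.
Proof.
move=> It Rt nA ce; apply/eqP => G0; apply: nA; split=> //; exists l; split=> //; left.
exact: has_cderiv_G0.
Qed.

(** Extends a branch beyond [0, pi] by its endpoint values, so that two-sided continuity holds at
    the endpoints too. *)
Definition clamp th : R := Num.max 0 (Num.min th pi).

Lemma clamp_in th : 0 <= clamp th <= pi.
Proof. by rewrite /clamp le_max lexx /= ge_max pi_ge0 ge_min lexx orbT. Qed.

Lemma clamp_id th : 0 <= th <= pi -> clamp th = th.
Proof. by move=> /andP[t0 t1]; rewrite /clamp (min_l t1) (max_r t0). Qed.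

Lemma clamp_lip s t : `|clamp s - clamp t| <= `|s - t|.
Proof.
have p0 := pi_ge0 R; have h1 := ler_norm (s - t); have h2 := ler_norm (t - s).
rewrite (distrC t s) in h2; rewrite ler_norml /clamp.
by case: (lerP s pi) => a; case: (lerP t pi) => b; rewrite ?(max_r p0); [case: (lerP 0 s) => c; case: (lerP 0 t) => d|
  case: (lerP 0 s) => c|case: (lerP 0 t) => d|]; apply/andP; split; lra.
Qed.

Lemma branch_ccont (g mu : R -> C) th : is_branch p q g mu -> ccont (fun s => mu (clamp s)) th.
Proof.
move=> [_ h] e e0; have [d d0 hd] := h (clamp th) (clamp_in th) e e0.
exists d => // s sd; apply: hd; first exact: clamp_in.
exact: le_lt_trans (clamp_lip _ _) sd.
Qed.

Lemma ccont_cbm (g : R -> C) : (forall s, 0 <= s <= pi -> ccont g s) -> cbm g.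
Proof.
move=> h; split; apply: bm_continuous; apply: continuous_in_subspaceT => s; rewrite inE /= in_itv /= => sI.
- exact: ccont_Re (h s sI).
- exact: ccont_Im (h s sI).
Qed.

Variable f : R -> C2.
Hypotheses (fc : c2continuous f) (fs : exists M : R, forall x, M < `|x| -> f x = (0, 0)).

(** The kernel formula makes the integrand agree on [0, pi] with a function continuous up to both
    endpoints, hence bounded and measurable. *)
Lemma branch_riesz_integrable (k g mu : R -> C) (x : R) : 0 <= x <= pi -> is_branch p q g mu ->
  (forall th, ccont k th) -> (forall th, ccont g th) ->
  (forall th, 0 <= th <= pi -> mult (g th) != mult (- g th)) ->
  (forall th, 0 <= th <= pi -> G p q (mu th) != 0) ->
  c2integrable [set` `[0, pi]] (fun th => cscal2 (k th) (riesz p q (g th) (mu th) (ft f (g th)) x)).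
Proof.
move=> xI br ck cg hm hG.
have fE th (thI : 0 <= th <= pi) := riesz_formula bp bq (br.1 th thI) (hm th thI) (cbm2_ft fc fs (g th)) xI.
have cc th : 0 <= th <= pi -> _ := fun thI => ccont_riesz fc fs bp bq xI (cg th) (branch_ccont th br)
  (hG _ (clamp_in th)).
split; (apply: cbm_integrable; last exact: lexx).
- apply: (@cbm_ext _ (fun r => k r * - (((c_fun p q (mu (clamp r)) x).1 * rnum1 p q (g r) (mu (clamp r)) (ft f (g r)) +
    (s_fun p q (mu (clamp r)) x).1 * rnum2 p q (g r) (mu (clamp r)) (ft f (g r))) / G p q (mu (clamp r))))).
    by move=> th thI; rewrite /cscal2 (fE th thI) clamp_id.
  by apply: ccont_cbm => th thI; apply: ccontM; [exact: ck|exact: (cc th thI).1].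
- apply: (@cbm_ext _ (fun r => k r * - (((c_fun p q (mu (clamp r)) x).2 * rnum1 p q (g r) (mu (clamp r)) (ft f (g r)) +
    (s_fun p q (mu (clamp r)) x).2 * rnum2 p q (g r) (mu (clamp r)) (ft f (g r))) / G p q (mu (clamp r))))).
    by move=> th thI; rewrite /cscal2 (fE th thI) clamp_id.
  by apply: ccont_cbm => th thI; apply: ccontM; [exact: ck|exact: (cc th thI).2].
Qed.
End Contours.

Theorem theorem4 (R : realType) (p q : R -> R[i]) (lam : int -> 'I_2 -> R -> R[i])
    (h : R) (f : R -> R[i] * R[i]) :
  (forall x, p (x + pi) = p x) -> (forall x, q (x + pi) = q x) ->
  BVc p -> BVc q ->
  is_labeling p q lam ->
  0 < h < 10^-1 ->
  (exists2 e : R, 0 < e & forall t, Aset p q h t -> e <= cmod (t - rc h)) ->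
  (forall th : R, 0 <= th <= pi -> ~ Aset p q h (gam0 h th) /\ ~ Aset p q h (gam1 h th)) ->
  c2continuous f ->
  (exists M : R, forall x : R, M < `|x| -> f x = (0, 0)) ->
  forall (n : int) (j : 'I_2) (x : R), 0 <= x <= pi ->
  [/\ c2integrable (Eset p q h)
        (fun t : R => riesz p q (rc t) (lam n j t) (ft f (rc t)) x),
      (forall mu : R -> R[i], is_branch p q (gam0 h) mu -> mu 0 = lam n j h ->
         c2integrable `[0, pi]
           (fun th : R => cscal2 (dgam h th) (riesz p q (gam0 h th) (mu th) (ft f (gam0 h th)) x))),
      (forall mu : R -> R[i], is_branch p q (gam1 h) mu -> mu 0 = lam n j (1 + h) ->
         c2integrable `[0, pi]
           (fun th : R => cscal2 (dgam h th) (riesz p q (gam1 h th) (mu th) (ft f (gam1 h th)) x))),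
      (~ ESS p q lam (lam n j 0) ->
         c2integrable `](- h), h[
           (fun t : R => riesz p q (rc t) (lam n j t) (ft f (rc t)) x)) &
      (~ ESS p q lam (lam n j 1) ->
         c2integrable `](1 - h), (1 + h)[
           (fun t : R => riesz p q (rc t) (lam n j t) (ft f (rc t)) x))].
Proof.
move=> _ _ Bp Bq lab /andP[h0 h10] _ nA fc fs n j x xI.
have h1 : h < 1 / 10 by rewrite div1r.
have bp := BVc_cbm Bp; have bq := BVc_cbm Bq.
have nonint b1 b2 t := lriesz_integrable_noninteger Bp Bq lab n j fc fs xI b1 b2 (t0 := t).
have int b1 b2 t := lriesz_integrable_integer Bp Bq lab fc fs xI b1 b2 (n := n) (j := j) (t0 := t).
(* Integer points of the segment are covered by the hypothesis on [ESS], all other points by the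
   Lojasiewicz argument. *)
have seg b1 b2 (a b : R) : a <= b -> (forall t, a <= t <= b -> -1 < t < 2) ->
    (forall t, a <= t <= b -> t = 0 \/ t = 1 -> ~ ESS p q lam (lam n j t)) ->
    (@lebesgue_measure R).-integrable [set` `[a, b]]
      (EFin \o (fun t => component b1 b2 (lriesz p q lam n j f x t))).
  move=> ab rng ness; apply: integrable_locally => // t tI.
  have [t01|t01] := pselect (t = 0 \/ t = 1); first by apply: int => //; exact: ness.
  by apply: nonint; apply: sin_pi_neq0; [exact: rng|apply/eqP => e; apply: t01; left|apply/eqP => e; apply: t01; right].
have cosb (th : R) : -1 <= cos th <= 1 by rewrite cos_geN1 cos_le1.
have sinb (th : R) : -1 <= sin th <= 1 by rewrite sin_geN1 sin_le1.
have hb (z : R) : -1 <= z <= 1 -> - h <= h * z <= h.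
  by move=> /andP[z1 z2]; apply/andP; split; nra.
have R0 th : Re (gam0 h th) = h * cos th by rewrite gam0E.
have I0 th : Im (gam0 h th) = h * sin th by rewrite gam0E.
have R1 th : Re (gam1 h th) = 1 + h * cos th by rewrite /gam1 ReD R0.
have I1 th : Im (gam1 h th) = h * sin th by rewrite /gam1 ImD I0 /= add0r.
have h_neq0 : h != 0 by rewrite gt_eqF.
split.
(* Every point of B(h) has an integrable neighbourhood; E(h) is then reached by restriction. *)
- apply: c2integrable_component => b1 b2; apply: (@integrable_subset_any _ (Bset h)).
  + by move=> t [].
  + by apply: measurableU; exact: measurable_itv.
  + apply: integrable_union; [exact: measurable_itv|exact: measurable_itv|apply: seg|apply: seg]; try lra.
    * by move=> t /andP[a b]; apply/andP; split; lra.
    * by move=> t /andP[a b] [e|e]; lra.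
    * by move=> t /andP[a b]; apply/andP; split; lra.
    * by move=> t /andP[a b] [e|e]; lra.
- move=> mu br _; apply: branch_riesz_integrable => // [th|th|th thI|th thI].
  + exact: ccont_dgam.
  + exact: ccont_gam0.
  (* The multipliers could coincide only at 0 or 1, but the semicircle keeps distance h from 0 and
     its real part stays at most h < 1. *)
  + apply/eqP => /mult_eq_opp e; have /andP[c1 c2] := hb _ (cosb th).
    case: e => [|e|e]; first by rewrite R0; apply/andP; split; lra.
      by have := cmod_gam0 th (ltW h0); rewrite e cmod0 => /esym/eqP; rewrite (negPf h_neq0).
    by have := R0 th; rewrite e /=; lra.
  (* At a point outside A no root of the characteristic equation is a critical point of F, whichever
     branch it belongs to. *)
  + have /andP[c1 c2] := hb _ (cosb th); have /andP[d1 d2] := hb _ (sinb th).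
    apply: (Aset_G bp bq _ _ (nA th thI).1 (br.1 th thI)).
      by rewrite I0 ler_norml; apply/andP; split; lra.
    by rewrite R0; apply/andP; split; lra.
- move=> mu br _; apply: branch_riesz_integrable => // [th|th|th thI|th thI].
  + exact: ccont_dgam.
  + exact: ccont_gam1.
  + apply/eqP => /mult_eq_opp e; have /andP[c1 c2] := hb _ (cosb th).
    case: e => [|e|e]; first by rewrite R1; apply/andP; split; lra.
      by have := R1 th; rewrite e /=; lra.
    have : gam0 h th = 0 by have := e; rewrite /gam1 => /eqP; rewrite -subr_eq0 addrAC subrr add0r => /eqP.
    move=> e0; have := cmod_gam0 th (ltW h0); rewrite e0 cmod0 => /esym/eqP; rewrite (negPf h_neq0) //.
  + have /andP[c1 c2] := hb _ (cosb th); have /andP[d1 d2] := hb _ (sinb th).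
    apply: (Aset_G bp bq _ _ (nA th thI).2 (br.1 th thI)).
      by rewrite I1 ler_norml; apply/andP; split; lra.
    by rewrite R1; apply/andP; split; lra.
- move=> ness; apply: c2integrable_component => b1 b2; apply: (@integrable_subset_any _ [set` `[- h, h]]).
  + by apply: subset_itv_oo_cc.
  + exact: measurable_itv.
  + apply: seg; first lra.
      by move=> t /andP[a b]; apply/andP; split; lra.
    by move=> t /andP[a b] [->//|e]; lra.
- move=> ness; apply: c2integrable_component => b1 b2; apply: (@integrable_subset_any _ [set` `[1 - h, 1 + h]]).
  + by apply: subset_itv_oo_cc.
  + exact: measurable_itv.
  + apply: seg; first lra.
      by move=> t /andP[a b]; apply/andP; split; lra.
    by move=> t /andP[a b] [e|->//]; lra.
Qed.
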